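(* Given a dynamic path network with $n$ vertices in which all edges have the same capacity, and an integer $k\ge1$, an optimal $k$-sink can be found in $O(n\log n)$ time.
   Context: A dynamic path network $P$ consists of vertices $v_1,\dots,v_n$ arranged from left to right on a path; vertex $v_i$ has an integral weight $w_i>0$, and each edge $e_i=(v_i,v_{i+1})$ has a non-negative length $l_i$ and capacity $c_i>0$; here all $c_i$ equal a common value $c$. $\tau>0$ is the transit time per unit distance. $d(a,b)$ is the (prorated) distance between points $a,b$ of $P$; $c(a,b)$ is the minimum capacity of the edges between $a$ and $b$ (with $c(a,a)=+\infty$); $P[a,b]$ is the subpath from $a$ to $b$, $V[a,b]$ its vertex set; $W[v_i,v_j]=\sum_{l=i}^j w_l$. For a subpath $P[v_i,v_j]$ and sink $s\in P[v_i,v_j]$, the evacuation time is $\Theta(s,[v_i,v_j])=\max\{\max_{v_h\in V[v_i,s]}(d(v_h,s)\tau+W[v_i,v_h]/c(v_h,s)),\ \max_{v_h\in V[s,v_j]}(d(s,v_h)\tau+W[v_h,v_j]/c(s,v_h))\}$. The $k$-sink problem: choose $m\le k$, indices $0=j_0<j_1<\dots<j_m=n$ and sinks $s_q\in P[v_{j_{q-1}+1},v_{j_q}]$ minimizing $\max_q\Theta(s_q,[v_{j_{q-1}+1},v_{j_q}])$; an optimal $k$-sink is a choice attaining the minimum. *)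

(* Defs.v *)
From HB Require Import structures.
From mathcomp Require Import all_boot all_order all_algebra.
From mathcomp Require Import all_classical all_reals all_analysis.
Import Order.TTheory GRing.Theory Num.Theory.
Import numFieldNormedType.Exports.

Set Implicit Arguments.
Unset Strict Implicit.
Unset Printing Implicit Defensive.

Local Open Scope ring_scope.

(** * Dynamic path networks *)

(* Indices start at 0: edge [e : 'I_n.-1] joins vertices [e] and [e.+1]. *)
Record path_network (R : realType) (n : nat) := PathNetwork {
  weight : 'I_n -> nat;
  len : 'I_n.-1 -> R;
  cap : 'I_n.-1 -> R;
  tau : R;
  weight_gt0 : forall i, (0 < weight i)%N;
  len_ge0 : forall e, 0 <= len e;
  cap_gt0 : forall e, 0 < cap e;
  tau_gt0 : 0 < tau }.

Definition uniform_capacity (R : realType) (n : nat) (P : path_network R n) :=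
  exists2 c : R, 0 < c & forall e, cap P e = c.

(* [Inner e t] lies strictly inside edge [e], at distance [t] from its left
   end (see [is_point]).  Keeping vertices apart from positions matters when
   [len e = 0]: the two ends of [e] then have the same position, but they are
   different sinks. *)
Inductive net_point (R : realType) (n : nat) : Type :=
| Vertex of 'I_n
| Inner of 'I_n.-1 & R.
Arguments Vertex {R n} _.
Arguments Inner {R n} _ _.

Section Network.
Variables (R : realType) (n : nat) (P : path_network R n).

Definition is_point (a : net_point R n) : Prop :=
  if a is Inner e t then 0 < t < len P e else True.

(* The index of the last vertex not to the right of [a], and of the first
   vertex not to the left of [a]. *)
Definition lvertex (a : net_point R n) : nat :=
  match a with Vertex i => i | Inner e _ => e end.
Definition rvertex (a : net_point R n) : nat :=
  match a with Vertex i => i | Inner e _ => e.+1 end.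

Definition position (a : net_point R n) : R :=
  \sum_(e < n.-1 | (e < lvertex a)%N) len P e +
  if a is Inner _ t then t else 0.

Definition dist (a b : net_point R n) : R := `|position b - position a|.

(* Minimum capacity of the edges between [a] and [b], for [a] not to the right
   of [b]. *)
Definition capacity (a b : net_point R n) : \bar R :=
  if `[< a = b >] then +oo%E
  else \big[mine/+oo%E]_(e < n.-1 | (lvertex a <= e < rvertex b)%N) (cap P e)%:E.

Definition total_weight (i j : nat) : R :=
  (\sum_(h < n | (i <= h <= j)%N) weight P h)%:R.

Definition in_subpath (i j : nat) (a : net_point R n) : Prop :=
  is_point a /\ (i <= lvertex a)%N /\ (rvertex a <= j)%N.

(* Note that [x / +oo = 0] in [\bar R]. *)
Definition evac_time (s : net_point R n) (i j : nat) : \bar R :=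
  (maxe
     (\big[maxe/-oo]_(h < n | (i <= h <= lvertex s)%N)
        ((dist (Vertex h) s * tau P)%:E
         + (total_weight i h)%:E / capacity (Vertex h) s))
     (\big[maxe/-oo]_(h < n | (rvertex s <= h <= j)%N)
        ((dist s (Vertex h) * tau P)%:E
         + (total_weight h j)%:E / capacity s (Vertex h))))%E.

(** * The k-sink problem *)

(* Subpath number [q], for [q < nsinks], consists of the vertices of index
   [cut_index q] to [(cut_index q.+1).-1], and is served by [sink q]; the
   values of [cut_index] above [nsinks] are irrelevant. *)
Record ksink := KSink {
  nsinks : nat;
  cut_index : nat -> nat;
  sink : 'I_nsinks -> net_point R n }.

Definition is_ksink (k : nat) (S : ksink) : Prop :=
  [/\ (nsinks S <= k)%N, cut_index S 0 = 0%N, cut_index S (nsinks S) = n,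
      forall q, (q < nsinks S)%N -> (cut_index S q < cut_index S q.+1)%N
    & forall q : 'I_(nsinks S),
        in_subpath (cut_index S q) (cut_index S q.+1).-1 (sink q)].

Definition ksink_cost (S : ksink) : \bar R :=
  \big[maxe/-oo%E]_(q < nsinks S)
    evac_time (sink q) (cut_index S q) (cut_index S q.+1).-1.

Definition optimal_ksink (k : nat) (S : ksink) : Prop :=
  is_ksink k S /\
  forall S', is_ksink k S' -> (ksink_cost S <= ksink_cost S')%E.

End Network.

(** * A real random access machine

   The machine stores natural numbers and exact reals separately.  Each kind
   has scalar variables and arrays; names of variables and arrays are constants
   of the program, array indices are computed.  Naturals support addition,
   truncated subtraction, halving and comparison, reals support the field
   operations and comparison.  There is no floor function or any other passage
   from reals to naturals, and no unit-cost multiplication of naturals. *)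

Inductive nexp : Type :=
| NCst of nat
| NVar of nat
| NGet of nat & nexp
| NAdd of nexp & nexp
| NSub of nexp & nexp
| NHalf of nexp.

Inductive rexp : Type :=
| RCst of int
| RVar of nat
| RGet of nat & nexp
| RAdd of rexp & rexp
| RSub of rexp & rexp
| RMul of rexp & rexp
| RDiv of rexp & rexp.

Inductive bexp : Type :=
| NLe of nexp & nexp
| RLe of rexp & rexp
| BNot of bexp
| BAnd of bexp & bexp.

Inductive cmd : Type :=
| Skip
| NSet of nat & nexp
| NPut of nat & nexp & nexp
| RSet of nat & rexp
| RPut of nat & nexp & rexp
| Seq of cmd & cmd
| If of bexp & cmd & cmd
| While of bexp & cmd.

Record state (R : realType) := State {
  nvar : nat -> nat;
  rvar : nat -> R;
  narr : nat -> nat -> nat;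
  rarr : nat -> nat -> R }.

Definition upd (A : Type) (f : nat -> A) (i : nat) (x : A) : nat -> A :=
  fun j => if j == i then x else f j.

Section Semantics.
Variable R : realType.
Implicit Types s : state R.

Fixpoint neval s (e : nexp) : nat :=
  match e with
  | NCst m => m
  | NVar x => nvar s x
  | NGet a i => narr s a (neval s i)
  | NAdd e1 e2 => (neval s e1 + neval s e2)%N
  | NSub e1 e2 => (neval s e1 - neval s e2)%N
  | NHalf e1 => (neval s e1)./2
  end.

Fixpoint reval s (e : rexp) : R :=
  match e with
  | RCst z => z%:~R
  | RVar x => rvar s x
  | RGet a i => rarr s a (neval s i)
  | RAdd e1 e2 => reval s e1 + reval s e2
  | RSub e1 e2 => reval s e1 - reval s e2
  | RMul e1 e2 => reval s e1 * reval s e2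
  | RDiv e1 e2 => reval s e1 / reval s e2
  end.

Fixpoint beval s (b : bexp) : bool :=
  match b with
  | NLe e1 e2 => (neval s e1 <= neval s e2)%N
  | RLe e1 e2 => reval s e1 <= reval s e2
  | BNot b1 => ~~ beval s b1
  | BAnd b1 b2 => beval s b1 && beval s b2
  end.

(* Evaluating an expression takes one unit of time per node. *)
Fixpoint ncost (e : nexp) : nat :=
  match e with
  | NCst _ | NVar _ => 1
  | NGet _ e1 | NHalf e1 => (ncost e1).+1
  | NAdd e1 e2 | NSub e1 e2 => (ncost e1 + ncost e2).+1
  end.

Fixpoint rcost (e : rexp) : nat :=
  match e with
  | RCst _ | RVar _ => 1
  | RGet _ i => (ncost i).+1
  | RAdd e1 e2 | RSub e1 e2 | RMul e1 e2 | RDiv e1 e2 =>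
      (rcost e1 + rcost e2).+1
  end.

Fixpoint bcost (b : bexp) : nat :=
  match b with
  | NLe e1 e2 => (ncost e1 + ncost e2).+1
  | RLe e1 e2 => (rcost e1 + rcost e2).+1
  | BNot b1 => (bcost b1).+1
  | BAnd b1 b2 => (bcost b1 + bcost b2).+1
  end.

Definition set_nvar s x v :=
  State (upd (nvar s) x v) (rvar s) (narr s) (rarr s).
Definition set_rvar s x v :=
  State (nvar s) (upd (rvar s) x v) (narr s) (rarr s).
Definition set_narr s a i v :=
  State (nvar s) (rvar s) (upd (narr s) a (upd (narr s a) i v)) (rarr s).
Definition set_rarr s a i v :=
  State (nvar s) (rvar s) (narr s) (upd (rarr s) a (upd (rarr s a) i v)).

(* [exec c s t s']: run from [s], the program [c] halts in [s'] after [t] units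
   of time. *)
Inductive exec : cmd -> state R -> nat -> state R -> Prop :=
| exec_skip s : exec Skip s 1 s
| exec_nset s x e :
    exec (NSet x e) s (ncost e).+1 (set_nvar s x (neval s e))
| exec_nput s a i e :
    exec (NPut a i e) s (ncost i + ncost e).+1
      (set_narr s a (neval s i) (neval s e))
| exec_rset s x e :
    exec (RSet x e) s (rcost e).+1 (set_rvar s x (reval s e))
| exec_rput s a i e :
    exec (RPut a i e) s (ncost i + rcost e).+1
      (set_rarr s a (neval s i) (reval s e))
| exec_seq c1 c2 s s1 s2 t1 t2 :
    exec c1 s t1 s1 -> exec c2 s1 t2 s2 ->
    exec (Seq c1 c2) s (t1 + t2) s2
| exec_if b c1 c2 s t s1 :
    exec (if beval s b then c1 else c2) s t s1 ->
    exec (If b c1 c2) s (bcost b + t).+1 s1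
| exec_while_false b c s :
    beval s b = false -> exec (While b c) s (bcost b).+1 s
| exec_while_true b c s s1 s2 t1 t2 :
    beval s b = true -> exec c s t1 s1 -> exec (While b c) s1 t2 s2 ->
    exec (While b c) s (bcost b + t1 + t2).+1 s2.

End Semantics.

(** * Input and output of a k-sink program *)

Definition ord_array (A : Type) (d : A) (m : nat) (f : 'I_m -> A) : nat -> A :=
  fun i => oapp f d (insub i).

(* Natural variables 0 and 1 hold [n] and [k], real variable 0 holds [tau], and
   real arrays 0, 1, 2 hold the weights, lengths and capacities; the rest of the
   memory is zero. *)
Definition input_state (R : realType) (n : nat) (P : path_network R n)
    (k : nat) : state R :=
  State
    (nth 0%N [:: n; k])
    (nth 0 [:: tau P])
    (fun _ _ => 0%N)
    (nth (fun _ => 0)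
       [:: ord_array 0 (fun i => (weight P i)%:R);
           ord_array 0 (len P);
           ord_array 0 (cap P)]).

(* Natural variable 0 holds the number of sinks and natural array 0 the cuts.
   Entry [q] of natural array 1 and of real array 0 encodes sink [q]: [(i, 0)]
   for vertex [i], [(e, t)] for [Inner e t]. *)
Definition outputs (R : realType) (n : nat) (s : state R) (S : ksink R n) :
    Prop :=
  [/\ nvar s 0 = nsinks S,
      forall q, (q <= nsinks S)%N -> narr s 0 q = cut_index S q
    & forall q : 'I_(nsinks S),
        narr s 1 q = lvertex (sink q) /\
        rarr s 0 q = (if sink q is Inner _ t then t else 0)].

(* Main.v *)
(* With a common capacity, the cost of serving a subpath [[i, j]] by one sink is
   governed by two functions of the sink vertex [s]: a left cost that increases
   and a right cost that decreases with [s].  An optimal sink lies on the edge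
   where they cross, which gives a closed form for [cost i j]; this is monotone
   in the subpath, so a bound is feasible for [k] sinks iff [k] greedy jumps
   reach the end of the path.  The crossing vertex only moves to the right when
   [i] and [j] do, and range maxima read off a sparse table give the left and
   right costs in constant time, so a two-pointer sweep tests a bound, or
   evaluates one cost in every row [i], in linear time.

   The optimum is one of the values [cost i j].  The search keeps an infeasible
   bound and a feasible one; the candidates strictly between form one interval
   of [j]'s in each row [i].  Only rows whose index is a multiple of a stride
   [2 ^ r] are considered.  A round sorts the costs of the middle candidates of
   these rows and tests their weighted median, which removes a quarter of the
   candidates.  Once at most [4 n] candidates remain the stride is halved, and by
   monotonicity at most [9 n] candidates are then left in the finer grid.  So
   each stride takes at most three rounds on lists of length [n / 2 ^ r], and the
   last one takes [O (log n)] rounds on lists whose lengths decrease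
   geometrically: the sorting time adds up to [O (n log n)], and so do the
   [O (log n)] linear sweeps. *)

Require Import Defs.
From mathcomp Require Import all_boot all_order all_algebra.
From mathcomp Require Import all_classical all_reals all_analysis.
From mathcomp Require Import zify ring lra.
Import Order.TTheory GRing.Theory Num.Theory.
Import numFieldNormedType.Exports.

Set Implicit Arguments.
Unset Strict Implicit.
Unset Printing Implicit Defensive.

Local Open Scope ring_scope.

(** * The cost of a subpath *)

(** A sink at a vertex receives that vertex's own supply at once, whereas a sink just beside it must
    draw this supply through an edge. So the left cost can jump up just to the right of a vertex,
    and the right cost just to the left of one. On the crossing edge the best sink may therefore be
    either end or the inner point that balances the two costs, and [cost] is a minimum of three
    values.

    Sorting one key for every row in each of [O(log n)] rounds would take [O(n log^2 n)] time;
    coarse strides keep the lists short while the candidates are many. Halving the stride inserts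
    rows squeezed between two old ones, which at most doubles the candidates and adds a telescoping
    [n]: hence [2 * 4n + n = 9n]. As [(3/4)^3 * 9 < 4], three rounds lead back to [4n].

    Optimality is read off from the moment the search stops. When no cost lies strictly between the
    infeasible [lo] and the feasible [hi], greedy jumps reach equally far under costs [<= lo] and
    under costs [< hi]; every bound below [hi] then fails, whatever the origin of [hi]. *)

Section WindowMax.
Variable R : realDomainType.
Implicit Types (f : nat -> R) (x : R).

(** The window has [k + 1] entries, so it is never empty and needs no neutral element; hence the
    [.-1] wherever a length is passed. *)
Fixpoint wmax f (i k : nat) : R :=
  if k is k'.+1 then Num.max (wmax f i k') (f (i + k)%N) else f i.

Lemma wmax_leP f i k x :
  (wmax f i k <= x) <-> (forall g, (i <= g <= i + k)%N -> f g <= x).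
Proof.
elim: k => [|k IHk] /=.
  split=> [fx g|fx]; first by rewrite addn0 -eqn_leq => /eqP <-.
  by apply: fx; rewrite addn0 leqnn.
rewrite ge_max; split=> [/andP[/IHk le_k le_x] g|fx].
  case: (ltngtP g (i + k.+1)) => [lt_g|gt_g|-> //]; last by lia.
  by move=> gi; apply: le_k; lia.
apply/andP; split; first by apply/IHk => g gi; apply: fx; lia.
by apply: fx; lia.
Qed.

Lemma le_wmax f i k g : (i <= g <= i + k)%N -> f g <= wmax f i k.
Proof. by move=> gi; move/wmax_leP: (lexx (wmax f i k)); apply. Qed.

Lemma wmax_cover f i k i1 k1 i2 k2 :
  (forall g, (i <= g <= i + k)%N =
     (i1 <= g <= i1 + k1)%N || (i2 <= g <= i2 + k2)%N) ->
  wmax f i k = Num.max (wmax f i1 k1) (wmax f i2 k2).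
Proof.
move=> cover; apply/eqP; rewrite eq_le ge_max; apply/and3P; split.
- apply/wmax_leP => g; rewrite cover le_max => /orP[] /le_wmax -> //.
  by rewrite orbT.
- by apply/wmax_leP => g gi; apply: le_wmax; rewrite cover gi.
- by apply/wmax_leP => g gi; apply: le_wmax; rewrite cover gi orbT.
Qed.

End WindowMax.

Section LineCost.
Variable R : realFieldType.
(* [X i] is [tau] times the position of vertex [i], and [Y i] the time needed
   to send the first [i] vertices' supply through an edge. *)
Variables X Y : nat -> R.
Hypothesis X_le : forall i, X i <= X i.+1.
Hypothesis Y_le : forall i, Y i <= Y i.+1.

Let X_mono i j : (i <= j)%N -> X i <= X j.
Proof. exact: (homo_leq lexx le_trans X_le). Qed.

Let Y_mono i j : (i <= j)%N -> Y i <= Y j.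
Proof. exact: (homo_leq lexx le_trans Y_le). Qed.

(** The terms of the two maxima, with their dependence on the sink and on the ends of the subpath
    factored out: range maxima over two fixed arrays then serve every subpath. *)
Definition lkey g := Y g.+1 - X g.
Definition rkey g := X g - Y g.

(* The evacuation time from the left (right) of a sink at vertex [s] for the
   subpath that begins at [i] (ends at [j]). *)
Definition lcost i s : R :=
  if (s <= i)%N then 0 else X s - Y i + wmax lkey i (s - i).-1.
Definition rcost_of s j : R :=
  if (j <= s)%N then 0 else Y j.+1 - X s + wmax rkey s.+1 (j - s).-1.

Lemma lcost_leP i s x : (i < s)%N ->
  (lcost i s <= x) <->
  (forall g, (i <= g < s)%N -> X s - X g + (Y g.+1 - Y i) <= x).
Proof.
move=> lt_is; rewrite /lcost leqNgt lt_is /= -lerBrDl wmax_leP /lkey.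
split=> H g gi.
  have {}gi : (i <= g <= i + (s - i).-1)%N by lia.
  by have := H g gi; lra.
have {}gi : (i <= g < s)%N by lia.
by have := H g gi; lra.
Qed.

Lemma rcost_leP s j x : (s < j)%N ->
  (rcost_of s j <= x) <->
  (forall g, (s < g <= j)%N -> X g - X s + (Y j.+1 - Y g) <= x).
Proof.
move=> lt_sj; rewrite /rcost_of leqNgt lt_sj /= -lerBrDl wmax_leP /rkey.
split=> H g gi.
  have {}gi : (s < g <= s.+1 + (j - s).-1)%N by lia.
  by have := H g gi; lra.
have {}gi : (s < g <= j)%N by lia.
by have := H g gi; lra.
Qed.

Lemma lcost_ge i s g : (i <= g < s)%N ->
  X s - X g + (Y g.+1 - Y i) <= lcost i s.
Proof.
move=> gi; have lt_is : (i < s)%N by lia.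
by move/(lcost_leP _ lt_is): (lexx (lcost i s)); apply.
Qed.

Lemma rcost_ge s j g : (s < g <= j)%N ->
  X g - X s + (Y j.+1 - Y g) <= rcost_of s j.
Proof.
move=> gi; have lt_sj : (s < j)%N by lia.
by move/(rcost_leP _ lt_sj): (lexx (rcost_of s j)); apply.
Qed.

Lemma lcost_nn i : lcost i i = 0. Proof. by rewrite /lcost leqnn. Qed.
Lemma rcost_nn i : rcost_of i i = 0. Proof. by rewrite /rcost_of leqnn. Qed.

Lemma lcost_ge0 i s : 0 <= lcost i s.
Proof.
case: (leqP s i) => [le_si|lt_is]; first by rewrite /lcost le_si.
have gi : (i <= i < s)%N by rewrite leqnn.
have := lcost_ge gi; have := X_mono (ltnW lt_is); have := Y_le i; lra.
Qed.

Lemma rcost_ge0 s j : 0 <= rcost_of s j.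
Proof.
case: (leqP j s) => [le_js|lt_sj]; first by rewrite /rcost_of le_js.
have gi : (s < j <= j)%N by rewrite lt_sj leqnn.
have := rcost_ge gi; have := X_mono (ltnW lt_sj); have := Y_le j; lra.
Qed.

(** Crossing an edge delays every supply by the whole edge. This makes the left cost inside an edge,
    which is measured back from its right end, comparable with the cost at its left end. *)
Lemma lcost_step i s : (i <= s)%N -> lcost i s + (X s.+1 - X s) <= lcost i s.+1.
Proof.
rewrite leq_eqVlt => /predU1P[<-|lt_is].
  rewrite lcost_nn; have gi : (i <= i < i.+1)%N by rewrite !leqnn.
  by have := lcost_ge gi; have := Y_le i; lra.
rewrite -lerBrDr; apply/lcost_leP => // g gi.
have {}gi : (i <= g < s.+1)%N by lia.
by have := lcost_ge gi; lra.
Qed.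

Lemma rcost_step s j : (s < j)%N ->
  rcost_of s.+1 j + (X s.+1 - X s) <= rcost_of s j.
Proof.
rewrite leq_eqVlt => /predU1P[<-|lt_sj].
  rewrite rcost_nn; have gi : (s < s.+1 <= s.+1)%N by rewrite !leqnn.
  by have := rcost_ge gi; have := Y_le s.+1; lra.
rewrite -lerBrDr; apply/rcost_leP => // g gi.
have {}gi : (s < g <= j)%N by lia.
by have := rcost_ge gi; lra.
Qed.

Lemma lcost_mono i s s' : (s <= s')%N -> lcost i s <= lcost i s'.
Proof.
apply: (homo_leq lexx le_trans) => {s s'} s.
case: (leqP i s) => [/lcost_step|lt_si]; first by have := X_le s; lra.
by rewrite {1}/lcost (ltnW lt_si) lcost_ge0.
Qed.

Lemma lcost_anti i i' s : (i <= i')%N -> lcost i' s <= lcost i s.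
Proof.
move=> le_ii'; case: (leqP s i') => [le_si|lt_is].
  by rewrite {1}/lcost le_si lcost_ge0.
apply/lcost_leP => // g gi; have {}gi : (i <= g < s)%N by lia.
by have := lcost_ge gi; have := Y_mono le_ii'; lra.
Qed.

Lemma rcost_anti s s' j : (s <= s')%N -> rcost_of s' j <= rcost_of s j.
Proof.
move=> le_ss'; case: (leqP j s') => [le_js|lt_sj].
  by rewrite {1}/rcost_of le_js rcost_ge0.
apply/rcost_leP => // g gi; have {}gi : (s < g <= j)%N by lia.
by have := rcost_ge gi; have := X_mono le_ss'; lra.
Qed.

Lemma rcost_mono s j j' : (j <= j')%N -> rcost_of s j <= rcost_of s j'.
Proof.
move=> le_jj'; case: (leqP j s) => [le_js|lt_sj].
  by rewrite {1}/rcost_of le_js rcost_ge0.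
apply/rcost_leP => // g gi; have {}gi : (s < g <= j')%N by lia.
have := rcost_ge gi.
have : Y j.+1 <= Y j'.+1 by apply: Y_mono.
lra.
Qed.

(* A sink at vertex [v], or at distance [t / tau] from the left end of edge
   [e], evacuates [[i, j]] in time [x]. *)
Definition feasible_at_vertex i j x v :=
  [/\ (i <= v <= j)%N, lcost i v <= x & rcost_of v j <= x].
Definition feasible_inside i j x e t :=
  [/\ (i <= e < j)%N, 0 < t < X e.+1 - X e,
      lcost i e.+1 - (X e.+1 - X e) + t <= x & rcost_of e j - t <= x].
Definition feasible i j x :=
  (exists v, feasible_at_vertex i j x v) \/
  (exists e t, feasible_inside i j x e t).

Lemma feasible_ge0 i j x : feasible i j x -> 0 <= x.
Proof.
case=> [[v [_ + _]]|[e [t [ie te + _]]]]; first by have := lcost_ge0 i v; lra.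
have /lcost_step : (i <= e)%N by lia.
by have := lcost_ge0 i e; lra.
Qed.

(** Only a sink on the dropped vertex or on the first edge has to move. It goes to vertex [i.+1],
    where the left cost is 0 and the right cost has not grown. *)
Lemma feasible_tail i j x : (i < j)%N -> feasible i j x -> feasible i.+1 j x.
Proof.
move=> lt_ij fx; have x_ge0 := feasible_ge0 fx.
have Xi := X_le i; have ri := rcost_step lt_ij.
case: fx => [[v [vij lx rx]]|[e [t [eij tij lx rx]]]].
  left; case: (ltngtP i v) => [lt_iv|?|eq_iv]; last 2 first.
  - by lia.
  - exists i.+1; split=> //; first by lia.
      by rewrite lcost_nn.
    by move: rx; rewrite -eq_iv; lra.
  exists v; split=> //; first by lia.
  by apply: le_trans lx; apply: lcost_anti.
case: (ltngtP i e) => [lt_ie|?|eq_ie]; first 1 last.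
- by lia.
- left; exists i.+1; split; [by lia|by rewrite lcost_nn|].
  by move: tij rx; rewrite -eq_ie; lra.
right; exists e, t; split=> //; first by lia.
by have := @lcost_anti i i.+1 e.+1 (leqnSn i); lra.
Qed.

Lemma feasible_init i j x : (i <= j)%N -> feasible i j.+1 x -> feasible i j x.
Proof.
move=> le_ij fx; have x_ge0 := feasible_ge0 fx.
have Xi := X_le j; have := @lcost_step i j le_ij => li.
case: fx => [[v [vij lx rx]]|[e [t [eij tij lx rx]]]].
  left; case: (leqP v j) => [le_vj|lt_jv].
    exists v; split=> //; first by lia.
    by apply: le_trans rx; apply: rcost_mono.
  have ev : v = j.+1 by lia.
  rewrite ev in lx rx.
  by exists j; split; [lia|lra|rewrite rcost_nn].
case: (ltnP e j) => [lt_ej|le_je].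
  right; exists e, t; split=> //; first by lia.
  by have := @rcost_mono e j j.+1 (leqnSn j); lra.
have ? : e = j by lia.
by subst e; left; exists j; split; [lia|lra|rewrite rcost_nn].
Qed.

Lemma feasible_sub i j i' j' x : (i <= i')%N -> (i' <= j')%N -> (j' <= j)%N ->
  feasible i j x -> feasible i' j' x.
Proof.
move=> le_i le_ij le_j fx.
have {fx} : feasible i j' x.
  have le_ij' := leq_trans le_i le_ij.
  elim: j le_j fx => [|j IHj]; first by rewrite leqn0 => /eqP ->.
  rewrite leq_eqVlt => /predU1P[-> //|le_j] fx.
  by apply: IHj => //; apply: feasible_init fx; lia.
elim: i' le_i le_ij => [|i' IHi]; first by rewrite leqn0 => /eqP ->.
rewrite leq_eqVlt => /predU1P[-> //|le_i] le_ij fx.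
by apply: feasible_tail => //; apply: IHi => //; lia.
Qed.

Definition crossing i j s :=
  [/\ (i <= s)%N, rcost_of s j <= lcost i s &
      forall v, (i <= v < s)%N -> lcost i v < rcost_of v j].

(** If no vertex before [j] qualifies, [find] returns the length of the list and the value is [j],
    where the right cost is 0. *)
Definition cross i j : nat :=
  (i + find (fun s => (rcost_of s j <= lcost i s)%R) (iota i (j - i)))%N.

Lemma crossP i j : crossing i j (cross i j).
Proof.
rewrite /cross.
have := @before_find _ 0%N (fun s => rcost_of s j <= lcost i s) (iota i (j - i)).
have := @nth_find _ 0%N (fun s => rcost_of s j <= lcost i s) (iota i (j - i)).
have := find_size (fun s => rcost_of s j <= lcost i s) (iota i (j - i)).
rewrite has_find size_iota; set f := find _ _ => le_f at_f before_f.
split=> [||v vi]; first exact: leq_addr.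
  case: (ltnP f (j - i)) => [lt_f|ge_f].
    by have := at_f lt_f; rewrite nth_iota.
  rewrite {1}/rcost_of; have -> : (j <= i + f)%N by lia.
  exact: lcost_ge0.
have lt_f : (v - i < f)%N by lia.
have := before_f _ lt_f; rewrite nth_iota; last by lia.
by rewrite subnKC; [move/negbT; rewrite -ltNge|lia].
Qed.

Lemma crossing_uniq i j s : crossing i j s -> s = cross i j.
Proof.
case: (crossP i j) => le_is le_s lt_s [le_is' le_s' lt_s'].
apply/eqP; rewrite eqn_leq leqNgt [X in _ && X]leqNgt; apply/andP; split.
  by apply/negP => lt; have := lt_s' (cross i j); rewrite le_is lt => /(_ isT); lra.
by apply/negP => lt; have := lt_s s; rewrite le_is' lt => /(_ isT); lra.
Qed.

Lemma crossing_le i j s : (i <= j)%N -> crossing i j s -> (s <= j)%N.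
Proof.
move=> le_ij [_ _ lt_s]; rewrite leqNgt; apply/negP => lt_js.
have := lt_s j; rewrite le_ij lt_js => /(_ isT).
by rewrite rcost_nn; have := lcost_ge0 i j; lra.
Qed.

Definition edge_cost i j s : R :=
  (lcost i s + rcost_of s.-1 j - (X s - X s.-1)) / 2.

(* The time of an optimal sink for [[i, j]], which lies on the edge that enters
   the vertex at which the left cost overtakes the right one. *)
Definition cost i j : R :=
  let s := cross i j in
  if s == i then 0
  else Num.min (lcost i s) (Num.min (rcost_of s.-1 j) (edge_cost i j s)).

Lemma cost_at_left i j s : (i < s <= j)%N -> crossing i j s ->
  lcost i s <= rcost_of s.-1 j -> lcost i s <= edge_cost i j s ->
  feasible_at_vertex i j (lcost i s) s.
Proof. by move=> sij [_ le_s _] _ _; split=> //; lia. Qed.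

Lemma cost_at_right i j s : (i < s <= j)%N -> crossing i j s ->
  feasible_at_vertex i j (rcost_of s.-1 j) s.-1.
Proof.
move=> sij [_ _ lt_s]; split=> //; first by lia.
by apply/ltW/lt_s; lia.
Qed.

(** The two costs balance at offset [t = (r - l + len) / 2], with common value [edge_cost]. This is
    below [r] iff [0 < t] and below [l] iff [t < len], so the minimum in [cost] needs no test on
    [t]. *)
Lemma cost_inside i j s : (i < s <= j)%N ->
  edge_cost i j s < lcost i s -> edge_cost i j s < rcost_of s.-1 j ->
  feasible_inside i j (edge_cost i j s) s.-1
    ((rcost_of s.-1 j - lcost i s + (X s - X s.-1)) / 2).
Proof.
move=> sij; rewrite /edge_cost; case: s sij => [|s] //= sij ltl ltr.
by split; [lia|lra|lra|lra].
Qed.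

Lemma feasible_cost i j : (i <= j)%N -> feasible i j (cost i j).
Proof.
move=> le_ij; rewrite /cost; have cr := crossP i j.
have le_sj := crossing_le le_ij cr; move: (cross i j) cr le_sj => s cr le_sj.
case: eqVneq => [eq_si|ne_si].
  left; exists i; case: cr => _ + _; rewrite eq_si lcost_nn => le_r.
  by split; rewrite ?lcost_nn ?leqnn.
have sij : (i < s <= j)%N by case: cr => ? _ _; lia.
case: (leP (rcost_of s.-1 j) (edge_cost i j s)) => [le_re|lt_er].
  case: leP => [le_l|_]; left; last by exists s.-1; apply: cost_at_right.
  by exists s; apply: cost_at_left => //; lra.
case: leP => [le_l|lt_l].
  by left; exists s; apply: cost_at_left => //; lra.
by right; eexists; eexists; apply: cost_inside.
Qed.

(** With [feasible_cost], this makes [cost i j] the least feasible bound, so that monotonicity can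
    be inherited from [feasible_sub]. A sink beyond the crossing is compared by its left cost, one
    before it by its right cost. *)
Lemma cost_le i j x : feasible i j x -> cost i j <= x.
Proof.
move=> fx; have x_ge0 := feasible_ge0 fx; rewrite /cost.
have := crossP i j; move: (cross i j) => s cr.
case: eqVneq => [//|ne_si]; case: cr => le_is _ _.
rewrite !ge_min; apply/orP.
case: fx => [[v [vij lx rx]]|[e [t [eij tij lx rx]]]].
  case: (leqP s v) => [le_sv|lt_vs]; [left|right].
    exact: le_trans (lcost_mono _ le_sv) lx.
  apply/orP; left; apply: le_trans rx; apply: rcost_anti; lia.
case: (ltngtP e.+1 s) => [lt_es|lt_se|eq_es].
- right; apply/orP; left; have := @rcost_step e j; have -> : (e < j)%N by lia.
  move=> /(_ isT) rs; have : rcost_of s.-1 j <= rcost_of e.+1 j.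
    by apply: rcost_anti; lia.
  by lra.
- left; have le_ie : (i <= e)%N by lia.
  have := lcost_step le_ie; have : lcost i s <= lcost i e by apply: lcost_mono.
  by lra.
(* On the crossing edge itself, averaging the two bounds cancels [t]. *)
- by right; apply/orP; right; rewrite /edge_cost -eq_es /=; lra.
Qed.

Lemma cost_ge0 i j : (i <= j)%N -> 0 <= cost i j.
Proof. by move/feasible_cost/feasible_ge0. Qed.

Lemma cost_sub i j i' j' : (i <= i')%N -> (i' <= j')%N -> (j' <= j)%N ->
  cost i' j' <= cost i j.
Proof.
move=> le_i le_ij le_j; apply: cost_le.
by apply: feasible_sub (feasible_cost _) => //; lia.
Qed.

(** With a sink at the last vertex, travel takes at most [X j] and waiting at most [Y j]. This
    supplies the initial feasible bound of the search. *)
Lemma cost_whole j : X 0%N = 0 -> Y 0%N = 0 -> cost 0%N j <= X j + Y j.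
Proof.
move=> X0 Y0; apply: cost_le; left; exists j.
have ge0 : 0 <= X j + Y j.
  by have := X_mono (leq0n j); have := Y_mono (leq0n j); lra.
split; rewrite ?rcost_nn ?leqnn //.
case: (posnP j) => [j0|j_gt0]; first by rewrite {1}j0 lcost_nn.
apply/lcost_leP => // g /andP[_ lt_gj]; have := X_mono (leq0n g).
by have := Y_mono lt_gj; lra.
Qed.

End LineCost.

(** * Greedy placement *)

Section Greedy.
Variables (R : realDomainType) (n : nat) (cst : nat -> nat -> R).
Hypothesis cst_sub : forall i j i' j',
  (i <= i')%N -> (i' <= j')%N -> (j' <= j)%N -> cst i' j' <= cst i j.
Implicit Types P Q : pred R.

(* The end of the longest subpath from [i] whose cost satisfies [P]. *)
Definition reach P i : nat :=
  if (i < n)%N then (i + find (fun j => ~~ P (cst i j)) (iota i (n - i)))%N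
  else n.

Lemma reach_le P i : (reach P i <= n)%N.
Proof.
rewrite /reach; case: ltnP => // lt_in.
have := find_size (fun j => ~~ P (cst i j)) (iota i (n - i)).
by rewrite size_iota; lia.
Qed.

Lemma reach_ge P i : (i <= n)%N -> (i <= reach P i)%N.
Proof. by rewrite /reach; case: ltnP => // *; lia. Qed.

Lemma reach_n P : reach P n = n.
Proof. by rewrite /reach ltnn. Qed.

Lemma reach_in P i j : (i <= j < reach P i)%N -> P (cst i j).
Proof.
rewrite /reach; case: (ltnP i n) => [lt_in|le_ni]; last by lia.
have := find_size (fun j => ~~ P (cst i j)) (iota i (n - i)).
have := @before_find _ 0%N (fun j => ~~ P (cst i j)) (iota i (n - i)) (j - i).
rewrite size_iota; set f := find _ _ => not_f le_f ij.

have lt_f : (j - i < f)%N by lia.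
have := not_f lt_f; rewrite nth_iota; last by lia.
by rewrite subnKC; [move/negbFE|lia].
Qed.

Lemma reach_out P i : (i < n)%N -> (reach P i < n)%N -> ~~ P (cst i (reach P i)).
Proof.
rewrite /reach => lt_in; rewrite lt_in.
have := @nth_find _ 0%N (fun j => ~~ P (cst i j)) (iota i (n - i)).
rewrite has_find size_iota; set f := find _ _ => f_out lt_rn.
have lt_f : (f < n - i)%N by lia.
by have := f_out lt_f; rewrite nth_iota.
Qed.

Lemma reach_uniq P i r : (i < n)%N -> (i <= r <= n)%N ->
  (forall j, (i <= j < r)%N -> P (cst i j)) ->
  ((r < n)%N -> ~~ P (cst i r)) -> reach P i = r.
Proof.
move=> lt_in ir Pr Pr'; apply/eqP; rewrite eqn_leq leqNgt [X in _ && X]leqNgt.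
have ge_i := reach_ge P (ltnW lt_in); have le_n := reach_le P i.
apply/andP; split; apply/negP => lt.
  have : P (cst i r) by apply: reach_in; lia.
  by apply/negP/Pr'; lia.
have : P (cst i (reach P i)) by apply: Pr; lia.
by apply/negP/reach_out; lia.
Qed.

Definition down P := forall x y, x <= y -> P y -> P x.

Lemma reach_max P i j : down P -> (i <= j < n)%N -> P (cst i j) ->
  (j < reach P i)%N.
Proof.
move=> dP ij Pij; rewrite ltnNge; apply/negP => le_rj.
have ge_i : (i <= reach P i)%N by apply: reach_ge; lia.
have : ~~ P (cst i (reach P i)) by apply: reach_out; lia.
by rewrite (dP _ _ _ Pij) //; apply: cst_sub; lia.
Qed.

Lemma reach_mono P i i' : down P -> (i <= i')%N -> (reach P i <= reach P i')%N.
Proof.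
move=> dP le_ii'; case: (ltnP i' n) => [lt_in|le_ni].
  rewrite leqNgt; apply/negP => lt; have ge_i' := reach_ge P (ltnW lt_in).
  have le_n := reach_le P i.
  have Pi : P (cst i (reach P i')) by apply: reach_in; lia.
  have : (reach P i' < reach P i')%N.
    apply: reach_max => //; first by lia.
    by apply: dP Pi; apply: cst_sub; lia.
  by lia.
by rewrite {2}/reach ltnNge le_ni /= reach_le.
Qed.

Lemma reach_sub P Q i : (forall x, P x -> Q x) -> down Q ->
  (reach P i <= reach Q i)%N.
Proof.
move=> PQ dQ; case: (ltnP i n) => [lt_in|le_ni]; last first.
  by rewrite /reach ltnNge le_ni.
have := reach_ge P (ltnW lt_in); have := reach_le P i.
case: (posnP (reach P i)) => [-> //|r_gt0] le_n.
rewrite leq_eqVlt => /predU1P[<-|lt_i]; first exact: reach_ge (ltnW _).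
suff : ((reach P i).-1 < reach Q i)%N by lia.
apply: reach_max => //; first by lia.
by apply/PQ/reach_in; lia.
Qed.

Lemma iter_reach_le P q : (iter q (reach P) 0 <= n)%N.
Proof. by case: q => //= q; apply: reach_le. Qed.

Lemma iter_reach_mono P q q' : (q <= q')%N ->
  (iter q (reach P) 0 <= iter q' (reach P) 0)%N.
Proof.
apply: (@homo_leq _ (fun q => iter q (reach P) 0) leq leqnn leq_trans).
by move=> {}q; apply/reach_ge/iter_reach_le.
Qed.

(* Jumping greedily stays ahead of any partition. *)
Lemma greedy_cover P k m (c : nat -> nat) : down P -> (m <= k)%N ->
  c 0 = 0 -> c m = n -> (forall q, (q < m)%N -> (c q < c q.+1)%N) ->
  (forall q, (q < m)%N -> P (cst (c q) (c q.+1).-1)) ->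
  iter k (reach P) 0 = n.
Proof.
move=> dP le_mk c0 cm c_lt Pc.
have c_le q q' : (q <= q' <= m)%N -> (c q <= c q')%N.
  move=> /andP[]; elim: q' => [|q' IHq]; first by rewrite leqn0 => /eqP ->.
  rewrite leq_eqVlt => /predU1P[-> //|le_q] lt_m.
  apply: leq_trans (IHq _ _) (ltnW (c_lt _ _)) => //; exact: ltnW.
have ahead q : (q <= m)%N -> (c q <= iter q (reach P) 0)%N.
  elim: q => [|q IHq] lt_qm; first by rewrite c0.
  have lt_c := c_lt _ lt_qm; rewrite /=.
  have le_c := IHq (ltnW lt_qm).
  apply: leq_trans (reach_mono dP le_c).
  suff : ((c q.+1).-1 < reach P (c q))%N by lia.
  apply: reach_max => //; last exact: Pc.
  by have := @c_le q.+1 m; rewrite lt_qm leqnn cm; lia.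
apply/eqP; rewrite eqn_leq iter_reach_le /= -{1}cm.
exact: leq_trans (ahead m (leqnn m)) (iter_reach_mono _ le_mk).
Qed.

(** The candidates of row [i] strictly between [lo] and [hi] are the ends from [reach (atmost lo) i]
    up to, but excluding, [reach (below hi) i]; this is why both kinds of bound occur. *)
Definition atmost (x : R) : pred R := fun y => y <= x.
Definition below (x : R) : pred R := fun y => y < x.

Lemma down_atmost x : down (atmost x).
Proof. by move=> y z; apply: le_trans. Qed.

Lemma down_below x : down (below x).
Proof. by move=> y z; apply: le_lt_trans. Qed.

(** Equal reaches leave no cost strictly between the two bounds, so a bound [x < hi] never jumps
    farther than [lo] does. *)
Lemma infeasible_below k lo hi :
  (forall i, (i < n)%N -> reach (atmost lo) i = reach (below hi) i) ->
  (iter k (reach (atmost lo)) 0 < n)%N ->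
  forall x, x < hi -> (iter k (reach (atmost x)) 0 < n)%N.
Proof.
move=> eq_r lt_lo x lt_x; apply: leq_ltn_trans lt_lo.
elim: k => [//|k IHk] /=; apply: leq_trans (reach_mono (@down_atmost lo) IHk).
set i := iter k _ 0; case: (ltnP i n) => [lt_in|le_ni].
  rewrite eq_r //; apply: reach_sub (@down_below hi) => y le_y.
  exact: le_lt_trans lt_x.
by rewrite /reach !ltnNge le_ni.
Qed.

End Greedy.

(** * Counting candidates when the stride is halved and after a median round *)

Section Candidates.
Variable n : nat.

(* The number of candidates in the rows whose index is a multiple of [d]. *)
Definition total (w : nat -> nat) d := (\sum_(q < n) w (q * d))%N.

Lemma sum_double (f : nat -> nat) m :
  (\sum_(q < m.*2) f q = \sum_(q < m) (f q.*2 + f q.*2.+1))%N.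
Proof.
elim: m => [|m IHm]; first by rewrite !big_ord0.
by rewrite doubleS !big_ord_recr /= IHm addnA.
Qed.

Lemma sum_telescope (h : nat -> nat) m : (forall q, h q <= h q.+1)%N ->
  (\sum_(q < m) (h q.+1 - h q) <= h m)%N.
Proof.
move=> h_le; elim: m => [|m IHm]; first by rewrite big_ord0.
rewrite big_ord_recr /=; apply: leq_trans (leq_add IHm (leqnn _)) _.
by rewrite subnKC.
Qed.

(** The interval of the row halfway between rows [a] and [a + 2d] starts no earlier than [lo a] and
    ends no later than [hi (a + 2d)]. Its excess over row [a] is at most [hi (a + 2d) - hi a], and
    these differences telescope. *)
Lemma total_refine (lo hi : nat -> nat) d :
  (forall i j, (i <= j)%N -> (lo i <= lo j)%N) ->
  (forall i j, (i <= j)%N -> (hi i <= hi j)%N) ->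
  (forall i, hi i <= n)%N -> (forall i, lo i <= hi i)%N ->
  (total (fun i => hi i - lo i) d
     <= (total (fun i => hi i - lo i) (d + d)).*2 + n)%N.
Proof.
move=> lo_mono hi_mono hi_n lo_hi; rewrite /total; set w := fun i : nat => (hi i - lo i)%N.
(* Doubling the range pairs each coarse row with the fine row that follows it. *)
have : (\sum_(q < n) w (q * d) <= \sum_(q < n.*2) w (q * d))%N.
  by rewrite -addnn big_split_ord /=; apply: leq_addr.
move/leq_trans; apply; rewrite (sum_double (fun q => w (q * d)%N)).
  apply: leq_trans (_ : \sum_(q < n) ((w (q * (d + d))).*2 +
    (hi (q.+1 * (d + d)) - hi (q * (d + d)))) <= _)%N.
    apply: leq_sum => q _; have -> : (q.*2 * d = q * (d + d))%N by lia.
    rewrite /w; set a := (q * (d + d))%N.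
    have := @lo_mono a (q.*2.+1 * d)%N; have := @hi_mono (q.*2.+1 * d)%N (q.+1 * (d + d))%N.
    have := @hi_mono a (q.+1 * (d + d))%N.
    have -> : (a <= q.*2.+1 * d)%N by rewrite /a; lia.
    have -> : (q.*2.+1 * d <= q.+1 * (d + d))%N by lia.
    have -> : (a <= q.+1 * (d + d))%N by rewrite /a; lia.
    have := lo_hi a; move=> ? /(_ isT) ? /(_ isT) ? /(_ isT) ?; lia.
  rewrite big_split /= leq_add //.
    by rewrite -mul2n big_distrr /=; apply: leq_sum => q _; rewrite mul2n.
  apply: leq_trans (@sum_telescope (fun q => hi (q * (d + d))%N) n _) (hi_n _).
  by move=> q; apply: hi_mono; lia.
Qed.

(** At least half of the weight lies in rows that lose at least half of theirs, so a quarter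
    disappears. *)
Lemma total_shrink (w w' : nat -> nat) (a : pred nat) d :
  (forall i, w' i <= w i)%N -> (forall i, a i -> (w' i).*2 <= w i)%N ->
  (total w d <= (\sum_(q < n | a (q * d)%N) w (q * d)).*2)%N ->
  (4 * total w' d <= 3 * total w d)%N.
Proof.
move=> le_w half_w le_tot.
have : ((total w' d).*2 + \sum_(q < n | a (q * d)%N) w (q * d)
   <= (total w d).*2)%N.
  rewrite /total -!muln2 !big_distrl /= [X in (_ + X)%N]big_mkcond /= -big_split /=.
  apply: leq_sum => q _; have := le_w (q * d)%N.
  by case: ifP => [/half_w|_]; lia.
by lia.
Qed.

End Candidates.

(** * Evacuation times on a network *)

Section NetworkCost.
Variables (R : realType) (n : nat) (P : path_network R n) (c : R).
Hypotheses (c_gt0 : 0 < c) (cap_c : forall e, cap P e = c).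

(** Padding by 0 agrees with the input arrays and makes [xpos] and [ysup] monotone on all of
    [nat]. *)
Definition xpos i : R := \sum_(e < i) ord_array 0 (len P) e * tau P.
Definition ysup i : R :=
  \sum_(h < i) ord_array 0 (fun h => (weight P h)%:R) h / c.

Lemma ord_array_ge0 m (f : 'I_m -> R) i :
  (forall j, 0 <= f j) -> 0 <= ord_array 0 f i.
Proof. by move=> f_ge0; rewrite /ord_array; case: insubP => //= *. Qed.

Lemma ord_arrayE m (f : 'I_m -> R) (i : 'I_m) : ord_array 0 f i = f i.
Proof. by rewrite /ord_array valK. Qed.

Lemma xposS i : xpos i.+1 = xpos i + ord_array 0 (len P) i * tau P.
Proof. by rewrite /xpos big_ord_recr. Qed.

Lemma ysupS i :
  ysup i.+1 = ysup i + ord_array 0 (fun h => (weight P h)%:R) i / c.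
Proof. by rewrite /ysup big_ord_recr. Qed.

Lemma xpos_le i : xpos i <= xpos i.+1.
Proof.
rewrite xposS lerDl mulr_ge0 ?(ltW (tau_gt0 P)) // ord_array_ge0 // => e.
exact: len_ge0.
Qed.

Lemma ysup_le i : ysup i <= ysup i.+1.
Proof.
by rewrite ysupS lerDl divr_ge0 ?(ltW c_gt0) // ord_array_ge0.
Qed.

Lemma xpos0 : xpos 0 = 0. Proof. by rewrite /xpos big_ord0. Qed.
Lemma ysup0 : ysup 0 = 0. Proof. by rewrite /ysup big_ord0. Qed.

Lemma xpos_edge (e : 'I_n.-1) : xpos e.+1 - xpos e = len P e * tau P.
Proof. by rewrite xposS ord_arrayE addrC addKr. Qed.

Lemma prefix_sum m (f : 'I_m -> R) i : (i <= m)%N ->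
  \sum_(e < m | (e < i)%N) f e = \sum_(e < i) ord_array 0 f e.
Proof.
move=> le_im; rewrite (big_ord_widen _ (ord_array 0 f) le_im).
by apply: eq_bigr => e _; rewrite ord_arrayE.
Qed.

Lemma positionE a : (lvertex a < n)%N ->
  position P a * tau P =
    xpos (lvertex a) + (if a is Inner _ t then t else 0) * tau P.
Proof.
move=> lt_an; rewrite /position mulrDl prefix_sum; last by lia.
by rewrite mulr_suml.
Qed.

Lemma total_weightE i j : (i <= j < n)%N ->
  total_weight P i j / c = ysup j.+1 - ysup i.
Proof.
move=> ij; rewrite /total_weight natr_sum /ysup -!mulr_suml -mulrBl.
congr (_ / _); rewrite -!prefix_sum; [|lia|lia].
apply/eqP; rewrite eq_sym subr_eq; apply/eqP.
rewrite (bigID (fun h : 'I_n => (i <= h)%N)) /=; congr (_ + _).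
  by apply: eq_bigl => h; lia.
by apply: eq_bigl => h; lia.
Qed.

Lemma capacityE (a b : net_point R n) : a <> b ->
  (lvertex a < rvertex b)%N -> (lvertex a < n.-1)%N -> capacity P a b = c%:E.
Proof.
move=> ne_ab lt_ab lt_an; rewrite /capacity; case: asboolP => // _.
apply/eqP; rewrite eq_le; apply/andP; split.
  have ae : (lvertex a <= Ordinal lt_an < rvertex b)%N by rewrite leqnn.
  rewrite -(cap_c (Ordinal lt_an)).
  exact: (bigmin_le_cond _ (fun e => (cap P e)%:E) ae).
by apply: le_bigmin => [|e _]; rewrite ?leey // cap_c.
Qed.

Lemma capacity_self (a : net_point R n) : capacity P a a = +oo%E.
Proof. by rewrite /capacity; case: asboolP. Qed.

Lemma distE (a b : net_point R n) : position P a * tau P <= position P b * tau P ->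
  dist P a b * tau P = position P b * tau P - position P a * tau P.
Proof.
move=> le_ab; rewrite /dist -mulrBl ger0_norm // subr_ge0.
by move: le_ab; rewrite ler_pM2r // tau_gt0.
Qed.

Definition offset (s : net_point R n) : R :=
  (if s is Inner _ t then t else 0) * tau P.

Lemma offset_ge0 s : is_point P s -> 0 <= offset s.
Proof.
rewrite /offset; case: s => [v|e t] /=; first by rewrite mul0r.
by case/andP=> t0 _; rewrite mulr_ge0 // ltW // tau_gt0.
Qed.

Lemma offset_le s : is_point P s -> xpos (lvertex s) + offset s <= xpos (rvertex s).
Proof.
rewrite /offset; case: s => [v|e t] /=; first by rewrite mul0r addr0.
by case/andP=> _ /ltW t_le; rewrite -lerBrDl xpos_edge ler_wpM2r // ltW // tau_gt0.
Qed.

Lemma xpos_mono i j : (i <= j)%N -> xpos i <= xpos j.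
Proof. exact: (homo_leq lexx le_trans xpos_le). Qed.

Lemma lvertex_le (s : net_point R n) : (lvertex s <= rvertex s)%N.
Proof. by case: s => //= e t. Qed.

Lemma left_term i (h : 'I_n) (s : net_point R n) : Vertex h <> s ->
  (i <= h <= lvertex s)%N -> (h < rvertex s)%N -> (rvertex s < n)%N ->
  is_point P s ->
  ((dist P (Vertex h) s * tau P)%:E
     + (total_weight P i h)%:E / capacity P (Vertex h) s =
   (xpos (lvertex s) - xpos h + (ysup h.+1 - ysup i) + offset s)%:E)%E.
Proof.
move=> ne_hs his lt_hs lt_sn ps; have lt_hn := ltn_ord h.
have le_lr := lvertex_le s.
have pos_h : position P (Vertex h) * tau P = xpos h.
  by rewrite positionE //= mul0r addr0.
have pos_s : position P s * tau P = xpos (lvertex s) + offset s.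
  by rewrite positionE //; lia.
have le_h : xpos h <= xpos (lvertex s) by apply: xpos_mono; lia.
rewrite capacityE //=; last by lia.
rewrite inver gt_eqF // -EFinM -EFinD distE; last first.
  by rewrite pos_h pos_s; have := offset_ge0 ps; lra.
by rewrite pos_h pos_s total_weightE; [congr (_%:E); ring|lia].
Qed.

Lemma right_term j (h : 'I_n) (s : net_point R n) : s <> Vertex h ->
  (rvertex s <= h <= j)%N -> (lvertex s < h)%N -> (j < n)%N ->
  is_point P s ->
  ((dist P s (Vertex h) * tau P)%:E
     + (total_weight P h j)%:E / capacity P s (Vertex h) =
   (xpos h - xpos (lvertex s) + (ysup j.+1 - ysup h) - offset s)%:E)%E.
Proof.
move=> ne_sh shj lt_sh lt_jn ps; have lt_hn := ltn_ord h.
have le_lr := lvertex_le s.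
have pos_h : position P (Vertex h) * tau P = xpos h.
  by rewrite positionE //= mul0r addr0.
have pos_s : position P s * tau P = xpos (lvertex s) + offset s.
  by rewrite positionE //; lia.
have le_h : xpos (rvertex s) <= xpos h by apply: xpos_mono; lia.
rewrite capacityE //=; last by lia.
rewrite inver gt_eqF // -EFinM -EFinD distE; last first.
  by rewrite pos_h pos_s; have := offset_le ps; lra.
by rewrite pos_h pos_s total_weightE; [congr (_%:E); ring|lia].
Qed.

(** The capacity from a point to itself is infinite, so any supply located at the sink arrives at
    once. *)
Lemma self_term (h : 'I_n) w : ((dist P (Vertex h) (Vertex h) * tau P)%:E
  + w%:E / capacity P (Vertex h) (Vertex h) = 0)%E.
Proof. by rewrite capacity_self invey mule0 /dist subrr normr0 mul0r adde0. Qed.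

Let evac_left i s x := forall h : 'I_n, (i <= h <= lvertex s)%N ->
  ((dist P (Vertex h) s * tau P)%:E
     + (total_weight P i h)%:E / capacity P (Vertex h) s <= x%:E)%E.
Let evac_right s j x := forall h : 'I_n, (rvertex s <= h <= j)%N ->
  ((dist P s (Vertex h) * tau P)%:E
     + (total_weight P h j)%:E / capacity P s (Vertex h) <= x%:E)%E.

Let evac_timeE s i j x :
  (evac_time P s i j <= x%:E)%E <-> evac_left i s x /\ evac_right s j x.
Proof.
rewrite /evac_time ge_max; split=> [/andP[/bigmax_leP[_ l] /bigmax_leP[_ r]]//|].
by case=> l r; apply/andP; split; apply/bigmax_leP; split=> //; apply: leNye.
Qed.

Local Notation lc := (lcost xpos ysup).
Local Notation rc := (rcost_of xpos ysup).

Lemma evac_vertexP (v : 'I_n) i j x : (i <= v <= j)%N -> (j < n)%N ->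
  (evac_time P (Vertex v) i j <= x%:E)%E <-> lc i v <= x /\ rc v j <= x.
Proof.
move=> vij lt_jn; rewrite evac_timeE.
have off0 : offset (Vertex v) = 0 by rewrite /offset mul0r.
have lge0 := lcost_ge0 xpos_le ysup_le i v.
have rge0 := rcost_ge0 xpos_le ysup_le v j.
split=> [[l r]|[l r]]; split.
(* The vanishing term of the sink's own vertex yields [0 <= x], which settles the case of an empty
   side. *)
- have x_ge0 : 0 <= x.
    by have := l v; rewrite /= leqnn self_term lee_fin andbT; apply; lia.
  case: (leqP v i) => [le_vi|lt_iv]; first by rewrite /lcost le_vi.
  apply/lcost_leP => // g gi; have lt_gn : (g < n)%N by lia.
  have := l (Ordinal lt_gn); rewrite left_term //=; try lia.
    by rewrite off0 addr0 lee_fin; apply; lia.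
  by case=> E; move: gi; rewrite -E /=; lia.
- have x_ge0 : 0 <= x.
    by have := r v; rewrite /= leqnn self_term lee_fin; apply; lia.
  case: (leqP j v) => [le_jv|lt_vj]; first by rewrite /rcost_of le_jv.
  apply/rcost_leP => // g gi; have lt_gn : (g < n)%N by lia.
  have := r (Ordinal lt_gn); rewrite right_term //=; try lia.
    by rewrite off0 subr0 lee_fin; apply; lia.
  by case=> E; move: gi; rewrite E /=; lia.
- move=> h /= hi; case: (eqVneq h v) => [->|ne_hv].
    by rewrite self_term lee_fin; lra.
  have {}hi : (i <= h < v)%N by have := ltn_ord h; move: ne_hv; rewrite -val_eqE /=; lia.
  have vn := ltn_ord v.
  rewrite left_term //=; try lia; last by case=> E; move: ne_hv; rewrite E eqxx.
  by rewrite off0 addr0 lee_fin; apply: le_trans l; apply: lcost_ge.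
- move=> h /= hi; case: (eqVneq h v) => [->|ne_hv].
    by rewrite self_term lee_fin; lra.
  have {}hi : (v < h <= j)%N by have := ltn_ord h; move: ne_hv; rewrite -val_eqE /=; lia.
  rewrite right_term //=; try lia; last by case=> E; move: ne_hv; rewrite E eqxx.
  by rewrite off0 subr0 lee_fin; apply: le_trans r; apply: rcost_ge.
Qed.

(** Vertex [e] now sends its own supply through the edge as well. So the left cost is obtained from
    the one at [e.+1] by shortening the way, not from the one at [e] by lengthening it; the right
    cost starts from [e] for the same reason. *)
Lemma evac_innerP (e : 'I_n.-1) t i j x : (i <= e < j)%N -> (j < n)%N ->
  0 < t < len P e ->
  (evac_time P (Inner e t) i j <= x%:E)%E <->
  lc i e.+1 - (xpos e.+1 - xpos e) + t * tau P <= x /\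
  rc e j - t * tau P <= x.
Proof.
move=> eij lt_jn te; rewrite evac_timeE.
split=> [[l r]|[l r]]; split.
- rewrite -lerBrDr lerBlDr; apply/lcost_leP; first by lia.
  move=> g gi; have lt_gn : (g < n)%N by lia.
  have := l (Ordinal lt_gn); rewrite left_term //=; try lia.
  rewrite lee_fin /offset => le_x; have : (i <= g <= e)%N by lia.
  by move/le_x; lra.
- rewrite lerBlDr; apply/rcost_leP; first by lia.
  move=> g gi; have lt_gn : (g < n)%N by lia.
  have := r (Ordinal lt_gn); rewrite right_term //=; try lia.
  by rewrite lee_fin /offset => le_x; move/le_x: gi; lra.
- move=> h /= hi; rewrite left_term //=; try lia.
  rewrite lee_fin /offset; have {}hi : (i <= h < e.+1)%N by lia.
  by have := lcost_ge xpos ysup hi; lra.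
- move=> h /= hi; rewrite right_term //=; try lia.
  by rewrite lee_fin /offset; have := rcost_ge xpos ysup hi; lra.
Qed.

Lemma evac_feasible s i j x : (j < n)%N -> in_subpath P i j s ->
  (evac_time P s i j <= x%:E)%E -> feasible xpos ysup i j x.
Proof.
case: s => [v|e t] lt_jn [/= ps [le_i le_j]].
  by move/evac_vertexP => [|//|l r]; [lia|left; exists v; split=> //; lia].
move/evac_innerP => [|//|//|l r]; first by lia.
right; exists e, (t * tau P); split=> //; first by lia.
case/andP: ps => t_gt0 lt_t.
by rewrite mulr_gt0 ?tau_gt0 //= xpos_edge ltr_pM2r // tau_gt0.
Qed.

Local Notation cst := (cost xpos ysup).

Lemma cst_sub i j i' j' : (i <= i')%N -> (i' <= j')%N -> (j' <= j)%N ->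
  cst i' j' <= cst i j.
Proof. exact: (cost_sub xpos_le ysup_le). Qed.

Lemma ksink_feasible k (S : ksink R n) x : is_ksink P k S ->
  (ksink_cost P S <= x%:E)%E -> iter k (reach n cst (atmost x)) 0%N = n.
Proof.
case=> le_k c0 cm c_lt sub /bigmax_leP[_ le_x].
apply: (greedy_cover cst_sub (@down_atmost _ x) le_k c0 cm c_lt) => q lt_q.
apply: (cost_le xpos_le ysup_le).
have le_n : (cut_index S q.+1 <= n)%N.
  apply: leq_trans (eq_leq cm); move: lt_q.
  elim: (nsinks S) c_lt => // m IHm c_lt.
  rewrite ltnS leq_eqVlt => /predU1P[-> //|lt_qm].
  apply: leq_trans (IHm _ lt_qm) (ltnW (c_lt _ _)) => // q' lt_q'.
  by apply: c_lt; apply: ltnW.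
have lt_c := c_lt _ lt_q.
apply: evac_feasible (sub (Ordinal lt_q)) (le_x (Ordinal lt_q) isT).
by rewrite /=; lia.
Qed.

(** A cheaper placement would have some real [x < lam] as a bound, and [k] greedy jumps under [x]
    would then cover the path. *)
Lemma greedy_optimal k lam (S : ksink R n) : is_ksink P k S ->
  (forall q : 'I_(nsinks S), (evac_time P (sink q) (cut_index S q)
     (cut_index S q.+1).-1 <= lam%:E)%E) ->
  (forall x, x < lam -> (iter k (reach n cst (atmost x)) 0 < n)%N) ->
  optimal_ksink P k S.
Proof.
move=> kS le_lam inf; split=> // S' kS'.
apply: le_trans (_ : (lam%:E <= _)%E).
  by apply/bigmax_leP; split=> [|q _]; [apply: leNye|apply: le_lam].
rewrite leNgt; apply/negP => lt_lam.
suff [x lt_x le_x] : exists2 x, x < lam & (ksink_cost P S' <= x%:E)%E.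
  by have := inf _ lt_x; rewrite (ksink_feasible kS' le_x) ltnn.
(* Costs are extended reals: [+oo] is not below [lam], and for [-oo] any real below [lam] will
   do. *)
move: lt_lam; case: (ksink_cost P S') => [y|//|_]; first by exists y.
by exists (lam - 1); [lra|apply: leNye].
Qed.

End NetworkCost.

(** * Programs and their running time *)

Section MachineLogic.
Variable R : realType.
Implicit Types (s : state R) (c : cmd).

(* For a loop-free command the final state is a function, and [maxcost] bounds
   the time. *)
Fixpoint loopfree c : bool :=
  match c with
  | Seq c1 c2 | If _ c1 c2 => loopfree c1 && loopfree c2
  | While _ _ => false
  | _ => true
  end.

Fixpoint maxcost c : nat :=
  match c with
  | Skip => 1
  | NSet _ e => (ncost e).+1
  | NPut _ i e => (ncost i + ncost e).+1
  | RSet _ e => (rcost e).+1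
  | RPut _ i e => (ncost i + rcost e).+1
  | Seq c1 c2 => maxcost c1 + maxcost c2
  | If b c1 c2 => (bcost b + maxn (maxcost c1) (maxcost c2)).+1
  | While _ _ => 0
  end.

Fixpoint run c s : state R :=
  match c with
  | Skip | While _ _ => s
  | NSet x e => set_nvar s x (neval s e)
  | NPut a i e => set_narr s a (neval s i) (neval s e)
  | RSet x e => set_rvar s x (reval s e)
  | RPut a i e => set_rarr s a (neval s i) (reval s e)
  | Seq c1 c2 => run c2 (run c1 s)
  | If b c1 c2 => if beval s b then run c1 s else run c2 s
  end.

Lemma exec_run c s : loopfree c ->
  exists2 t, exec c s t (run c s) & (t <= maxcost c)%N.
Proof.
elim: c s => //=.
- by move=> s _; exists 1%N => //; apply: exec_skip.
- by move=> x e s _; eexists; first exact: exec_nset.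
- by move=> a i e s _; eexists; first exact: exec_nput.
- by move=> x e s _; eexists; first exact: exec_rset.
- by move=> a i e s _; eexists; first exact: exec_rput.
- move=> c1 IH1 c2 IH2 s /andP[lf1 lf2].
  have [t1 e1 le1] := IH1 s lf1; have [t2 e2 le2] := IH2 (run c1 s) lf2.
  by exists (t1 + t2)%N; [apply: exec_seq e1 e2|apply: leq_add].
- move=> b c1 IH1 c2 IH2 s /andP[lf1 lf2].
  have [t1 e1 le1] := IH1 s lf1; have [t2 e2 le2] := IH2 s lf2.
  exists (bcost b + (if beval s b then t1 else t2)).+1.
    by apply: exec_if; case: ifP.
  by rewrite ltnS leq_add2l; case: ifP; lia.
Qed.

Fixpoint writes_nvar c x : bool :=
  match c with
  | NSet y _ => x == y
  | Seq c1 c2 | If _ c1 c2 => writes_nvar c1 x || writes_nvar c2 x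
  | While _ c1 => writes_nvar c1 x
  | _ => false
  end.
Fixpoint writes_rvar c x : bool :=
  match c with
  | RSet y _ => x == y
  | Seq c1 c2 | If _ c1 c2 => writes_rvar c1 x || writes_rvar c2 x
  | While _ c1 => writes_rvar c1 x
  | _ => false
  end.
Fixpoint writes_narr c x : bool :=
  match c with
  | NPut y _ _ => x == y
  | Seq c1 c2 | If _ c1 c2 => writes_narr c1 x || writes_narr c2 x
  | While _ c1 => writes_narr c1 x
  | _ => false
  end.
Fixpoint writes_rarr c x : bool :=
  match c with
  | RPut y _ _ => x == y
  | Seq c1 c2 | If _ c1 c2 => writes_rarr c1 x || writes_rarr c2 x
  | While _ c1 => writes_rarr c1 x
  | _ => false
  end.

(** A frame condition read off the text of the program, so that its side conditions are decided by
    computation. *)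
Record unchanged c s s' : Prop := Unchanged {
  same_nvar : forall x, ~~ writes_nvar c x -> nvar s' x = nvar s x;
  same_rvar : forall x, ~~ writes_rvar c x -> rvar s' x = rvar s x;
  same_narr : forall x, ~~ writes_narr c x -> narr s' x = narr s x;
  same_rarr : forall x, ~~ writes_rarr c x -> rarr s' x = rarr s x }.

Lemma unchanged_sub c1 c s1 s2 :
  (forall x, writes_nvar c1 x -> writes_nvar c x) ->
  (forall x, writes_rvar c1 x -> writes_rvar c x) ->
  (forall x, writes_narr c1 x -> writes_narr c x) ->
  (forall x, writes_rarr c1 x -> writes_rarr c x) ->
  unchanged c1 s1 s2 -> unchanged c s1 s2.
Proof.
move=> wn wr wna wra [n1 r1 na1 ra1].
by split=> x; [move/(contra (wn x))|move/(contra (wr x))|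
  move/(contra (wna x))|move/(contra (wra x))]; auto.
Qed.

Lemma unchanged_trans c s1 s2 s3 :
  unchanged c s1 s2 -> unchanged c s2 s3 -> unchanged c s1 s3.
Proof.
move=> [n1 r1 na1 ra1] [n2 r2 na2 ra2].
by split=> x wx; rewrite ?n2 ?r2 ?na2 ?ra2 ?n1 ?r1 ?na1 ?ra1.
Qed.

Lemma exec_unchanged c s t s' : exec c s t s' -> unchanged c s s'.
Proof.
move=> ex; elim: ex => {c s t s'}.
- by move=> s; split.
- by move=> s x e; split=> y //= /negbTE ne; rewrite /upd ne.
- by move=> s a i e; split=> y //= /negbTE ne; rewrite /upd ne.
- by move=> s x e; split=> y //= /negbTE ne; rewrite /upd ne.
- by move=> s a i e; split=> y //= /negbTE ne; rewrite /upd ne.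
- move=> c1 c2 s s1 s2 t1 t2 _ u1 _ u2; apply: (@unchanged_trans _ _ s1).
    by apply: unchanged_sub u1 => x /= ->.
  by apply: unchanged_sub u2 => x /= ->; rewrite orbT.
- move=> b c1 c2 s t s1 _; case: (beval s b); apply: unchanged_sub => x /= -> //;
  by rewrite orbT.
- by move=> b c s _; split.
- move=> b c s s1 s2 t1 t2 _ _ u1 _; apply: unchanged_trans.
  exact: unchanged_sub u1.
Qed.

Definition runs c s (T : nat) (Q : state R -> Prop) :=
  exists t s', [/\ exec c s t s', (t <= T)%N & Q s'].

(** This rule of consequence also supplies the frame, so that a specification lists only what its
    command computes. *)
Lemma runs_sub c s T T' (Q Q' : state R -> Prop) : (T <= T')%N ->
  (forall s', unchanged c s s' -> Q s' -> Q' s') -> runs c s T Q ->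
  runs c s T' Q'.
Proof.
move=> le_T QQ' [t [s' [ex le_t Qs']]]; exists t, s'; split=> //.
  exact: leq_trans le_T.
by apply: QQ' => //; apply: exec_unchanged ex.
Qed.

Lemma runs_seq c1 c2 s T1 T2 (Q1 Q : state R -> Prop) :
  runs c1 s T1 Q1 ->
  (forall s1, unchanged c1 s s1 -> Q1 s1 -> runs c2 s1 T2 Q) ->
  runs (Seq c1 c2) s (T1 + T2) Q.
Proof.
move=> [t1 [s1 [e1 le1 q1]]] H; have u1 := exec_unchanged e1.
have [t2 [s2 [e2 le2 q2]]] := H _ u1 q1.
by exists (t1 + t2)%N, s2; split=> //; [apply: exec_seq e1 e2|apply: leq_add].
Qed.

Lemma runs_run c s (Q : state R -> Prop) : loopfree c -> Q (run c s) ->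
  runs c s (maxcost c) Q.
Proof. by move=> lf q; have [t e le] := exec_run s lf; exists t, (run c s). Qed.

Lemma runs_if b c1 c2 s T (Q : state R -> Prop) :
  (beval s b -> runs c1 s T Q) -> (~~ beval s b -> runs c2 s T Q) ->
  runs (If b c1 c2) s (bcost b + T).+1 Q.
Proof.
move=> H1 H2; have [t [s' [e le q]]] :
    runs (if beval s b then c1 else c2) s T Q.
  by case: ifP => [/H1|/negbT/H2].
by exists (bcost b + t).+1, s'; split=> //; [apply: exec_if|lia].
Qed.

(* [I m s]: the invariant holds in [s] and [m] units of time suffice. *)
Lemma runs_while b c (I : nat -> state R -> Prop) :
  (forall m s, I m s -> ~~ beval s b -> (bcost b < m)%N) ->
  (forall m s, I m s -> beval s b -> exists T m',
     runs c s T (I m') /\ ((bcost b + T + m').+1 <= m)%N) ->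
  forall m s, I m s ->
  runs (While b c) s m (fun s' => (exists m', I m' s') /\ ~~ beval s' b).
Proof.
move=> I0 I1 m; elim/ltn_ind: m => m IH s Ims.
case: (boolP (beval s b)) => [bs|nbs]; last first.
  exists (bcost b).+1, s; split; [|exact: I0 Ims nbs|by split=> //; exists m].
  by apply: exec_while_false; apply: negbTE.
have [T [m' [[t [s1 [e1 le1 I'1]]] le_m]]] := I1 _ _ Ims bs.
have lt_m : (m' < m)%N by lia.
have [t2 [s2 [e2 le2 q2]]] := IH _ lt_m _ I'1.
exists (bcost b + t + t2).+1, s2; split=> //; last by lia.
exact: exec_while_true bs e1 e2.
Qed.

Lemma runs_loop b c (I : state R -> Prop) (mu : state R -> nat) s :
  loopfree c ->
  (forall s, I s -> beval s b -> I (run c s) /\ (mu (run c s) < mu s)%N) ->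
  I s -> runs (While b c) s ((bcost b + maxcost c).+1 * (mu s).+1)
    (fun s' => I s' /\ ~~ beval s' b).
Proof.
move=> lf step Is; set K := (bcost b + maxcost c).+1.
have := @runs_while b c (fun m s => I s /\ (K * (mu s).+1 <= m)%N).
move=> /(_ _ _ (K * (mu s).+1)%N s (conj Is (leqnn _))) H.
apply: runs_sub (leqnn _) _ (H _ _) => {H}.
- by move=> s' _ [[m' []]].
- by move=> m s1 [_ le_m] _; move: le_m; rewrite /K mulnS; lia.
move=> m s1 [I1 le_m] b1; have [I2 lt_mu] := step _ I1 b1.
exists (maxcost c), (K * (mu (run c s1)).+1)%N; split.
  by apply: runs_run lf _; split.
apply: leq_trans le_m; rewrite [X in (_ <= X)%N]mulnS.
have : (K * (mu (run c s1)).+1 <= K * mu s1)%N by rewrite leq_mul2l lt_mu orbT.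
by rewrite {2}/K; lia.
Qed.

(** The number of remaining iterations is a ghost parameter here, for loops whose measure involves
    an exponent that no variable holds. *)
Lemma runs_loop_ghost b c (I : nat -> state R -> Prop) m s :
  loopfree c ->
  (forall m s, I m s -> beval s b -> exists2 m', (m' < m)%N & I m' (run c s)) ->
  I m s -> runs (While b c) s ((bcost b + maxcost c).+1 * m.+1)
    (fun s' => (exists m', I m' s') /\ ~~ beval s' b).
Proof.
move=> lf step Is; set K := (bcost b + maxcost c).+1.
have := @runs_while b c (fun T s => exists2 m, I m s & (K * m.+1 <= T)%N).
move=> /(_ _ _ (K * m.+1)%N s (ex_intro2 _ _ m Is (leqnn _))) H.
apply: runs_sub (leqnn _) _ (H _ _) => {H}.
- by move=> s' _ [[T [m' Im' _]] nb]; split=> //; exists m'.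
- by move=> T s1 [m1 _ le_m] _; move: le_m; rewrite /K mulnS; lia.
move=> T s1 [m1 I1 le_m] b1; have [m2 lt_m I2] := step _ _ I1 b1.
exists (maxcost c), (K * m2.+1)%N; split; first by apply: runs_run lf _; exists m2.
apply: leq_trans le_m; rewrite [X in (_ <= X)%N]mulnS.
have : (K * m2.+1 <= K * m1)%N by rewrite leq_mul2l lt_m orbT.
by rewrite {2}/K; lia.
Qed.

Lemma run_seq c1 c2 s : run (Seq c1 c2) s = run c2 (run c1 s).
Proof. by []. Qed.

Lemma run_if b c1 c2 s :
  run (If b c1 c2) s = if beval s b then run c1 s else run c2 s.
Proof. by []. Qed.

Lemma run_rset x e s : run (RSet x e) s = set_rvar s x (reval s e).
Proof. by []. Qed.

Lemma run_nset x e s : run (NSet x e) s = set_nvar s x (neval s e).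
Proof. by []. Qed.

Lemma neval_set_rvar s x v e : neval (set_rvar s x v) e = neval s e.
Proof.
by elim: e => //= [a e -> //|e1 -> e2 -> //|e1 -> e2 -> //|e -> //].
Qed.

End MachineLogic.

Local Notation "c1 ;; c2" := (Seq c1 c2) (at level 60, right associativity).
(* Names beginning with [v] and [r] are those of natural and real variables, and
   those beginning with [a] are array names; natural and real arrays are
   numbered separately. *)
Local Notation vN := 0%N (only parsing).
Local Notation vK := 1%N (only parsing).
Local Notation vI := 2%N (only parsing).
Local Notation vS := 3%N (only parsing).
Local Notation vJ := 4%N (only parsing).
Local Notation rTau := 0%N (only parsing).
Local Notation rC := 1%N (only parsing).
Local Notation rMax := 2%N (only parsing).
Local Notation rTmp := 3%N (only parsing).
Local Notation rL := 4%N (only parsing).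
Local Notation rR := 5%N (only parsing).
Local Notation rR1 := 6%N (only parsing).
Local Notation rCost := 7%N (only parsing).
Local Notation rLam := 8%N (only parsing).
Local Notation aX := 3%N (only parsing).
Local Notation aY := 4%N (only parsing).
Local Notation aU := 5%N (only parsing).
Local Notation aD := 6%N (only parsing).
Local Notation aPow := 2%N (only parsing).
Local Notation aOff := 3%N (only parsing).

Local Notation vD := 5%N (only parsing).
Local Notation vM := 6%N (only parsing).
Local Notation vC := 7%N (only parsing).
Local Notation vQ := 8%N (only parsing).
Local Notation aLo := 4%N (only parsing).
Local Notation aHi := 5%N (only parsing).
Local Notation aReach := 6%N (only parsing).
Local Notation aList := 7%N (only parsing).
Local Notation aKey := 7%N (only parsing).
Local Notation vA := 9%N (only parsing).
Local Notation vB := 10%N (only parsing).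
Local Notation vMid := 11%N (only parsing).
Local Notation vEnd := 12%N (only parsing).
Local Notation vO := 13%N (only parsing).
Local Notation vW := 14%N (only parsing).
Local Notation vBase := 15%N (only parsing).
Local Notation vTop := 16%N (only parsing).
Local Notation rHi := 9%N (only parsing).

(** * Range maxima and subpath costs *)

Definition nsucc x := NAdd (NVar x) (NCst 1).

(* Sets [rMax] to the maximum of the window [[lo, hi[], read off the sparse
   table [tab]. *)
Definition query tab lo hi :=
  RSet rMax (RGet tab (NAdd (NGet aOff (NSub hi lo)) lo)) ;;
  RSet rTmp (RGet tab (NAdd (NGet aOff (NSub hi lo))
                            (NSub hi (NGet aPow (NSub hi lo))))) ;;
  If (RLe (RVar rMax) (RVar rTmp)) (RSet rMax (RVar rTmp)) Skip.

Definition get_lcost :=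
  If (NLe (NVar vS) (NVar vI)) (RSet rL (RCst 0))
    (query aU (NVar vI) (NVar vS) ;;
     RSet rL (RAdd (RSub (RGet aX (NVar vS)) (RGet aY (NVar vI))) (RVar rMax))).

Definition get_rcost :=
  If (NLe (NVar vJ) (NVar vS)) (RSet rR (RCst 0))
    (query aD (nsucc vS) (nsucc vJ) ;;
     RSet rR (RAdd (RSub (RGet aY (nsucc vJ)) (RGet aX (NVar vS))) (RVar rMax))).

Definition nprev x := NSub (NVar x) (NCst 1).

Definition get_cost :=
  If (NLe (NVar vS) (NVar vI)) (RSet rCost (RCst 0))
    (query aD (NVar vS) (nsucc vJ) ;;
     RSet rR1 (RAdd (RSub (RGet aY (nsucc vJ)) (RGet aX (nprev vS))) (RVar rMax)) ;;
     RSet rCost (RDiv (RSub (RAdd (RVar rL) (RVar rR1))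
       (RSub (RGet aX (NVar vS)) (RGet aX (nprev vS)))) (RCst 2)) ;;
     If (RLe (RVar rR1) (RVar rCost)) (RSet rCost (RVar rR1)) Skip ;;
     If (RLe (RVar rL) (RVar rCost)) (RSet rCost (RVar rL)) Skip).

Definition probe := get_lcost ;; get_rcost ;; get_cost.

Section Probe.
Variables (R : realType) (n : nat) (X Y : nat -> R).

Hypothesis X_le : forall i, X i <= X i.+1.
Hypothesis Y_le : forall i, Y i <= Y i.+1.

(** Two-dimensional tables are flattened with row length [n]. The machine neither multiplies
    naturals nor takes logarithms, so [aPow] and [aOff] record [2 ^ l] and [l * n] for every window
    length. *)
Record tables (na : nat -> nat -> nat) (ra : nat -> nat -> R) : Prop := Tables {
  tab_X : forall i, (i <= n)%N -> ra aX i = X i;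
  tab_Y : forall i, (i <= n)%N -> ra aY i = Y i;
  tab_pow : forall m, (0 < m <= n)%N -> exists l,
    [/\ na aPow m = 2 ^ l, na aOff m = l * n & 2 ^ l <= m < 2 ^ l.+1]%N;
  tab_U : forall l i, (i + 2 ^ l <= n)%N ->
    ra aU (l * n + i)%N = wmax (lkey X Y) i (2 ^ l).-1;
  tab_D : forall l i, (i + 2 ^ l <= n)%N ->
    ra aD (l * n + i)%N = wmax (rkey X Y) i (2 ^ l).-1 }.

Definition with_rvar (s : state R) rv := State (nvar s) rv (narr s) (rarr s).

Lemma with_rvar_set s rv x v :
  set_rvar (with_rvar s rv) x v = with_rvar s (upd rv x v).
Proof. by []. Qed.

Lemma run_query (s : state R) tab lo hi (f : nat -> R) :
  tables (narr s) (rarr s) ->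
  (forall l i, (i + 2 ^ l <= n)%N ->
     rarr s tab (l * n + i)%N = wmax f i (2 ^ l).-1) ->
  (neval s lo < neval s hi <= n)%N ->
  exists rv, [/\ run (query tab lo hi) s = with_rvar s rv,
    rv rMax = wmax f (neval s lo) (neval s hi - neval s lo).-1 &
    forall x, (x != rMax) && (x != rTmp) -> rv x = rvar s x].
Proof.
move=> tb tabf lohi; rewrite /query.
have len : (0 < neval s hi - neval s lo <= n)%N by lia.
have [l [ep eo pl]] := tab_pow tb len.
set a := rarr s tab (l * n + neval s lo)%N.
set b := rarr s tab (l * n + (neval s hi - 2 ^ l))%N.
(* Two windows of length [2 ^ l], flush with the two ends, cover the range because it is shorter
   than [2 ^ l.+1]; their overlap does not affect a maximum. *)
have maxE : Num.max a b = wmax f (neval s lo) (neval s hi - neval s lo).-1.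
  rewrite /a /b !tabf; try lia; apply/esym/wmax_cover => g.
  have : (0 < 2 ^ l)%N by rewrite expn_gt0.
  move: pl; rewrite expnS; move: (2 ^ l)%N => p. lia.
exists (if a <= b then upd (upd (upd (rvar s) rMax a) rTmp b) rMax b
        else upd (upd (rvar s) rMax a) rTmp b).
rewrite /= !neval_set_rvar eo ep -/a -/b -maxE.
rewrite ![upd _ _ _ 2%N]/upd ![upd _ _ _ 3%N]/upd /=.
by case: leP => ab; split=> // x /andP[/negbTE n1 /negbTE n2];
  rewrite /upd ?n1 ?n2.
Qed.

Opaque query.

(** [rCost] is specified only at the crossing. The loops use it after the test [rR <= rL], when
    their pointer invariants make [vS] the crossing vertex. *)
Lemma run_probe (s : state R) :
  let i := nvar s vI in let v := nvar s vS in let j := nvar s vJ in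
  tables (narr s) (rarr s) -> (i <= v <= j)%N -> (j < n)%N ->
  exists rv, [/\ run probe s = with_rvar s rv,
    [/\ rv rL = lcost X Y i v, rv rR = rcost_of X Y v j,
        (i < v)%N -> rv rR1 = rcost_of X Y v.-1 j &
        crossing X Y i j v -> rv rCost = cost X Y i j] &
    forall x, (x < 2)%N || (8 <= x)%N -> rv x = rvar s x].
Proof.
move=> i v j tb iv jn; rewrite /probe 2!run_seq.
have [rv1 [e1 l1 f1]] : exists rv, [/\ run get_lcost s = with_rvar s rv,
    rv rL = lcost X Y i v & forall x, (x < 2)%N || (5 <= x)%N -> rv x = rvar s x].
  rewrite /get_lcost /= -/i -/v /lcost; case: (leqP v i) => vi.
    exists (upd (rvar s) rL 0); split=> // x hx; rewrite /upd.
    by case: eqP hx => [->|].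
  have lohi : (neval s (NVar vI) < neval s (NVar vS) <= n)%N by rewrite /= -/i -/v; lia.
  have [rv [-> rvm rvx]] := run_query tb (tab_U tb) lohi.
  eexists; split; first by rewrite with_rvar_set.
    rewrite /= /upd /= rvm -/i -/v (tab_X tb) ?(tab_Y tb) //; lia.
  move=> x hx; rewrite /upd; case: eqP hx => [->|_ hx] //.
  by rewrite rvx //; lia.
rewrite e1.
have [rv2 [e2 l2 f2]] : exists rv, [/\ run get_rcost (with_rvar s rv1) = with_rvar s rv,
    rv rR = rcost_of X Y v j &
    forall x, (x < 2)%N || (4 <= x < 5)%N || (6 <= x)%N -> rv x = rv1 x].
  rewrite /get_rcost /= -/j -/v /rcost_of; case: (leqP j v) => vj.
    exists (upd rv1 rR 0); split=> // x hx; rewrite /upd.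
    by case: eqP hx => [->|].
  have lohi : (neval (with_rvar s rv1) (nsucc vS) <
               neval (with_rvar s rv1) (nsucc vJ) <= n)%N.
    by rewrite /= -/j -/v; lia.
  have [rv [-> rvm rvx]] := @run_query (with_rvar s rv1) _ _ _ _ tb (tab_D tb) lohi.
  exists (upd rv rR (Y j.+1 - X v + rv rMax)); split=> //.
  - rewrite /= /set_rvar /with_rvar /= -/v -/j !addn1 (tab_X tb) ?(tab_Y tb) //; lia.
  - rewrite /upd /= rvm /= -/v -/j !addn1; congr (_ + wmax _ _ _); lia.
  move=> x hx; rewrite /upd; case: eqP hx => [->|_ hx] //.
  by rewrite rvx //; lia.
rewrite e2.
have [rv3 [e3 l3 c3 f3]] : exists rv,
  [/\ run get_cost (with_rvar s rv2) = with_rvar s rv,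
    (i < v)%N -> rv rR1 = rcost_of X Y v.-1 j,
    crossing X Y i j v -> rv rCost = cost X Y i j &
    forall x, (x < 2)%N || (4 <= x < 6)%N || (8 <= x)%N -> rv x = rv2 x].
  rewrite /get_cost run_if [beval _ _]/= -/i -/v; case: (leqP v i) => vi.
    exists (upd rv2 rCost 0); split=> // [cr|x hx].
    - rewrite /upd /= /cost -(crossing_uniq X_le Y_le cr).
      by case: cr => le_iv _ _; rewrite (_ : v == i) //; lia.
    - by rewrite /upd; case: eqP hx => [->|].
  have lohi : (neval (with_rvar s rv2) (NVar vS) <
               neval (with_rvar s rv2) (nsucc vJ) <= n)%N.
    by rewrite /= -/j -/v; lia.
  have [rv [E rvm rvx]] := @run_query (with_rvar s rv2) _ _ _ _ tb (tab_D tb) lohi.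
  rewrite run_seq E 3!run_seq.
  have {}rvm : rv rMax = wmax (rkey X Y) v (j.+1 - v).-1.
    by rewrite rvm /= -/v -/j addn1.
  have r1E : Y j.+1 - X v.-1 + rv rMax = rcost_of X Y v.-1 j.
    rewrite rvm /rcost_of leqNgt (_ : (v.-1 < j)%N) /=; last by lia.
    by congr (_ + wmax _ _ _); lia.
  have rvL : rv rL = lcost X Y i v by rewrite rvx //= f2 // l1.
  have get : (rarr s aY (j + 1)%N = Y j.+1) * (rarr s aX v = X v) *
      (rarr s aX (v - 1)%N = X v.-1).
    by rewrite !addn1 subn1 !(tab_X tb) ?(tab_Y tb) //; lia.
  set z := RDiv _ _; set a := RAdd _ _.
  have lE : rv rL = lcost X Y i v by rewrite rvx //= f2 // l1.
  have aE : reval (with_rvar s rv) a = rcost_of X Y v.-1 j by rewrite /with_rvar /= -/v -/j !get.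
  set rv' := upd rv rR1 (rcost_of X Y v.-1 j).
  have zE : reval (with_rvar s rv') z = edge_cost X Y i j v.
    by rewrite /with_rvar /= -/v !get /rv' /upd /= lE.
  rewrite [run (RSet rR1 a) _]run_rset aE -/rv' [set_rvar _ _ _](_ : _ = with_rvar s rv') //.
  rewrite [run (RSet rCost z) _]run_rset zE.
  set rv'' := upd rv' rCost (edge_cost X Y i j v).
  rewrite [set_rvar _ _ _](_ : _ = with_rvar s rv'') //.
  have costE : crossing X Y i j v -> cost X Y i j =
      Num.min (lcost X Y i v) (Num.min (rcost_of X Y v.-1 j) (edge_cost X Y i j v)).
    by move=> cr; rewrite /cost -(crossing_uniq X_le Y_le cr) gtn_eqF.
  rewrite [run (If (RLe (RVar rR1) _) _ _) _]run_if.
  rewrite [beval _ _](_ : _ = (rcost_of X Y v.-1 j <= edge_cost X Y i j v)) //.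
  have others x : (x < 2)%N || (4 <= x < 6)%N || (8 <= x)%N -> rv'' x = rv2 x.
    move=> hx; rewrite /rv'' /upd; case: eqP hx => [-> //|_ hx].
    by rewrite /rv' /upd; case: eqP hx => [-> //|_ hx]; rewrite rvx //; lia.
  case: leP costE => le1 costE; rewrite run_if.
    rewrite [beval _ _](_ : _ = (rv rL <= rcost_of X Y v.-1 j)) // lE.
    case: leP costE => le2 costE; (eexists; split;
      [by []|by []|by move=> /costE ->|move=> x hx;
       (have /negbTE ne : x != rCost by apply/eqP; lia);
       by rewrite /= /upd ?ne; apply: others]).
  rewrite [beval _ _](_ : _ = (rv rL <= edge_cost X Y i j v)) // lE.
  case: leP costE => le2 costE; (eexists; split;
      [by []|by []|by move=> /costE ->|move=> x hx;
       (have /negbTE ne : x != rCost by apply/eqP; lia);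
       by rewrite /= /upd ?ne; apply: others]).
exists rv3; split=> //.
  by split=> //; rewrite f3 ?l2 // f2 // l1.
by move=> x hx; rewrite f3 ?f2 ?f1 //; lia.
Qed.

End Probe.

(** * The two-pointer sweep *)

Definition nmax x y := NAdd (NVar x) (NSub (NVar y) (NVar x)).

Definition finish_row target :=
  NPut target (NVar vI) (NVar vJ) ;;
  NSet vI (nsucc vI) ;; NSet vS (nmax vS vI) ;; NSet vJ (nmax vJ vI).

Definition accepts strict :=
  if strict then BNot (RLe (RVar rLam) (RVar rCost))
  else RLe (RVar rCost) (RVar rLam).

Definition sweep_body strict target :=
  If (NLe (NVar vN) (NVar vJ)) (finish_row target)
    (probe ;;
     If (RLe (RVar rR) (RVar rL))
       (If (accepts strict) (NSet vJ (nsucc vJ)) (finish_row target))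
       (NSet vS (nsucc vS))).

Definition sweep_init := NSet vI (NCst 0) ;; NSet vS (NCst 0) ;; NSet vJ (NCst 0).

(* Stores in [target] the reach of every vertex under the bound [rLam]. *)
Definition sweep strict target :=
  sweep_init ;; While (NLe (nsucc vI) (NVar vN)) (sweep_body strict target).

(** The factor 3 stands for the three pointers of the sweep, each of which advances at most [n]
    times; it also covers the other linear loops. *)
Definition linear_const init b body :=
  (maxcost init + 3 * (bcost b + maxcost body).+1)%N.

Lemma linear_constP init b body n m : (m <= 3 * n)%N ->
  (maxcost init + (bcost b + maxcost body).+1 * m.+1
     <= linear_const init b body * n.+1)%N.
Proof.
rewrite /linear_const; move: (maxcost init) (bcost b + maxcost body).+1 => a K.
by move=> /(leq_mul (leqnn K)); rewrite mulnDl !mulnS; lia.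
Qed.

Definition admissible (R : realType) (strict : bool) (x : R) : pred R :=
  if strict then below x else atmost x.

Lemma down_admissible (R : realType) strict (x : R) : down (admissible strict x).
Proof. by case: strict; [apply: down_below|apply: down_atmost]. Qed.

Section Sweep.
Variables (R : realType) (n : nat) (X Y : nat -> R).
Hypothesis X_le : forall i, X i <= X i.+1.
Hypothesis Y_le : forall i, Y i <= Y i.+1.

Local Notation cst := (cost X Y).

Lemma tables_put na (ra : nat -> nat -> R) a f : (3 < a)%N ->
  tables n X Y na ra -> tables n X Y (upd na a f) ra.
Proof.
move=> a3 [tX tY tP tU tD]; split=> // m /tP[l [e1 e2 e3]]; exists l.
have [/negbTE a_2 /negbTE a_3] : (2 != a)%N /\ (3 != a)%N by lia.
by rewrite /upd a_2 a_3.
Qed.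

Variables (strict : bool) (target : nat) (lam : R).
Hypothesis target_gt : (3 < target)%N.

Local Notation P := (admissible strict lam).

Record sweep_inv (s : state R) : Prop := SweepInv {
  sw_tables : tables n X Y (narr s) (rarr s);
  sw_n : nvar s vN = n;
  sw_lam : rvar s rLam = lam;
  sw_order : (nvar s vI <= nvar s vS <= nvar s vJ)%N && (nvar s vJ <= n)%N;
  sw_rows : forall i, (i < nvar s vI)%N -> narr s target i = reach n cst P i;
  sw_prefix : forall j, (nvar s vI <= j < nvar s vJ)%N -> P (cst (nvar s vI) j);
  sw_ptr : forall v, (nvar s vI <= v < nvar s vS)%N ->
    lcost X Y (nvar s vI) v < rcost_of X Y v (nvar s vJ) }.

Definition sweep_measure (s : state R) : nat :=
  (n - nvar s vI) + (n - nvar s vS) + (n - nvar s vJ).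

Lemma cst_tail i j : (i < j)%N -> cst i.+1 j <= cst i j.
Proof. by move=> lt_ij; apply: (cost_sub X_le Y_le). Qed.

Lemma sweep_inv_finish s : sweep_inv s -> (nvar s vI < n)%N ->
  ((nvar s vJ < n)%N -> ~~ P (cst (nvar s vI) (nvar s vJ))) ->
  let s' := run (finish_row target) s in
  sweep_inv s' /\ (sweep_measure s' < sweep_measure s)%N.
Proof.
move=> [tb en el ord rows pre ptr] lt_in out s'.
have eI : nvar s' vI = (nvar s vI).+1 by rewrite /s' /= addn1.
have eS : nvar s' vS = maxn (nvar s vS) (nvar s vI).+1.
  by rewrite /s' /= /upd /= addn1 maxnE.
have eJ : nvar s' vJ = maxn (nvar s vJ) (nvar s vI).+1.
  by rewrite /s' /= /upd /= addn1 maxnE.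
split; last by rewrite /sweep_measure eI eS eJ; lia.
split; rewrite ?eI ?eS ?eJ.
- exact: tables_put.
- by [].
- by [].
- by lia.
- move=> i; rewrite /s' /= /upd /= eqxx ltnS leq_eqVlt => /predU1P[->|lt_i].
    rewrite eqxx; apply/esym/reach_uniq => //; lia.
  by rewrite ltn_eqF // rows.
- move=> j hj; apply: (@down_admissible _ strict lam _ _ _ (pre j _)); last by lia.
  by apply: cst_tail; lia.
(* Advancing the front lowers the left cost and advancing the end raises the right cost, so [vS]
   never has to go back. *)
- move=> v hv; apply: le_lt_trans (lt_le_trans (ptr v _) _); last 1 first.
  + by apply: rcost_mono => //; lia.
  + by apply: lcost_anti.
  by lia.
Qed.

Lemma sweep_inv_rvar s rv : rv rLam = rvar s rLam -> sweep_inv s ->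
  sweep_inv (with_rvar s rv).
Proof. by move=> erv [tb en el ord rows pre ptr]; split; rewrite //= erv. Qed.

Lemma sweep_inv_next_sink s : sweep_inv s -> (nvar s vJ < n)%N ->
  lcost X Y (nvar s vI) (nvar s vS) < rcost_of X Y (nvar s vS) (nvar s vJ) ->
  let s' := run (NSet vS (nsucc vS)) s in
  sweep_inv s' /\ (sweep_measure s' < sweep_measure s)%N.
Proof.
move=> [tb en el ord rows pre ptr] lt_jn lt_lr s'.
have eS : nvar s' vS = (nvar s vS).+1 by rewrite /s' /= addn1.
(* At the end of the subpath the right cost is 0, so the pointer cannot pass [vJ]. *)
have lt_vj : (nvar s vS < nvar s vJ)%N.
  rewrite ltnNge; apply/negP => le_jv; move: lt_lr.
  by rewrite {1}/rcost_of le_jv ltNge (lcost_ge0 X_le Y_le).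
split; last by rewrite /sweep_measure eS /s' /= /upd /=; lia.
split=> //; rewrite ?eS; first by rewrite /s' /= /upd /=; lia.
move=> v; rewrite -[nvar s' vI]/(nvar s vI) -[nvar s' vJ]/(nvar s vJ) => hv.
by case: (ltngtP v (nvar s vS)) => [lt_v|?|->//]; [apply: ptr|]; lia.
Qed.

Lemma sweep_inv_next_vertex s : sweep_inv s -> (nvar s vJ < n)%N ->
  P (cst (nvar s vI) (nvar s vJ)) ->
  let s' := run (NSet vJ (nsucc vJ)) s in
  sweep_inv s' /\ (sweep_measure s' < sweep_measure s)%N.
Proof.
move=> [tb en el ord rows pre ptr] lt_jn Pj s'.
have eJ : nvar s' vJ = (nvar s vJ).+1 by rewrite /s' /= addn1.
split; last by rewrite /sweep_measure eJ /s' /= /upd /=; lia.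
split=> //; rewrite ?eJ; first by rewrite /s' /= /upd /=; lia.
  move=> j; rewrite -[nvar s' vI]/(nvar s vI) => hj.
  by case: (ltngtP j (nvar s vJ)) => [lt_j|?|->//]; [apply: pre|]; lia.
move=> v; rewrite -[nvar s' vI]/(nvar s vI) -[nvar s' vS]/(nvar s vS) => hv.
apply: lt_le_trans (ptr _ hv) _; exact: rcost_mono.
Qed.

Lemma sweep_step s : sweep_inv s -> (nvar s vI < n)%N ->
  sweep_inv (run (sweep_body strict target) s) /\
  (sweep_measure (run (sweep_body strict target) s) < sweep_measure s)%N.
Proof.
move=> inv lt_in; have [tb en el ord rows pre ptr] := inv.
rewrite /sweep_body run_if [beval _ _]/= en; case: (leqP n (nvar s vJ)) => [le_nj|lt_jn].
  by apply: (sweep_inv_finish inv lt_in); lia.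
rewrite run_seq; have vj : (nvar s vI <= nvar s vS <= nvar s vJ)%N by lia.
have [rv [-> [l r _ c] others]] := run_probe X_le Y_le tb vj lt_jn.
have inv' : sweep_inv (with_rvar s rv) by apply: sweep_inv_rvar => //; apply: others.
have -> : sweep_measure s = sweep_measure (with_rvar s rv) by [].
rewrite run_if [beval _ _]/= l r; case: leP => [le_rl|lt_lr]; last first.
  exact: (sweep_inv_next_sink inv').
have {}c : rv rCost = cst (nvar s vI) (nvar s vJ).
  by apply: c; split=> //; lia.
have accE : beval (with_rvar s rv) (accepts strict) =
    P (cst (nvar s vI) (nvar s vJ)).
  have lamE : rv rLam = lam by rewrite others.
  by rewrite /P -c -lamE; case: strict => //=; rewrite -ltNge.
rewrite run_if accE; case: ifPn => Pc; first exact: (sweep_inv_next_vertex inv').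
exact: (sweep_inv_finish inv').
Qed.

Lemma runs_sweep s : tables n X Y (narr s) (rarr s) -> nvar s vN = n ->
  rvar s rLam = lam ->
  runs (sweep strict target) s
    (linear_const sweep_init (NLe (nsucc vI) (NVar vN)) (sweep_body strict target)
      * n.+1)
    (fun s' => forall i, (i < n)%N -> narr s' target i = reach n cst P i).
Proof.
move=> tb en el.
pose mu := sweep_measure (run sweep_init s).
apply: (@runs_sub _ _ _ (maxcost sweep_init + _ * mu.+1)%N _
  (fun s' => sweep_inv s' /\ ~~ beval s' (NLe (nsucc vI) (NVar vN)))).
- by apply: linear_constP; rewrite /mu /sweep_measure /=; lia.
- move=> s' _ [inv]; rewrite /= (sw_n inv) addn1 -ltnNge ltnS => le_n i lt_in.
  by apply: (sw_rows inv); lia.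
apply: runs_seq.
  by apply: (@runs_run _ _ _ (fun s' => s' = run sweep_init s)).
move=> _ _ ->; apply: runs_loop.
- by case: strict.
- by move=> s' inv; rewrite [beval _ _]/= (sw_n inv) addn1; apply: sweep_step.
by split.
Qed.

End Sweep.

(** * Feasibility test and candidate lists *)

Definition jump_init := NSet vI (NCst 0) ;; NSet vQ (NCst 0).
(** The last test stops at a vertex from which no progress is possible. Each remaining iteration
    advances the position, so their number is bounded by [n], however large [k] is. *)
Definition jump_guard :=
  BAnd (NLe (nsucc vI) (NVar vN))
    (BAnd (NLe (nsucc vQ) (NVar vK)) (NLe (nsucc vI) (NGet aReach (NVar vI)))).
Definition jump_body := NSet vI (NGet aReach (NVar vI)) ;; NSet vQ (nsucc vQ).

(* Follows the reach from vertex 0 for at most [vK] jumps; the position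
   reached is at least [vN] iff [vK] sinks suffice. *)
Definition jump := jump_init ;; While jump_guard jump_body.

Lemma runs_jump (R : realType) (n k : nat) (r : nat -> nat) (s : state R) :
  nvar s vN = n -> nvar s vK = k -> r n = n ->
  (forall i, (i <= n)%N -> (i <= r i <= n)%N) ->
  (forall i, (i < n)%N -> narr s aReach i = r i) ->
  runs jump s (linear_const jump_init jump_guard jump_body * n.+1)
    (fun s' => (n <= nvar s' vI)%N = (iter k r 0%N == n)).
Proof.
move=> en ek rn r_ge arr.
pose inv (s' : state R) := [/\ nvar s' vN = n, nvar s' vK = k,
  narr s' aReach = narr s aReach, (nvar s' vQ <= k)%N &
  nvar s' vI = iter (nvar s' vQ) r 0%N /\ (nvar s' vI <= n)%N].
pose mu (s' : state R) := (n - nvar s' vI)%N.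
apply: (@runs_sub _ _ _ (maxcost jump_init + _ * (mu (run jump_init s)).+1)%N _
  (fun s' => inv s' /\ ~~ beval s' jump_guard)).
- by apply: linear_constP; rewrite /mu /=; lia.
- move=> s' _ [[en' ek' arr' le_q [eI le_n]]] /=; rewrite en' ek' arr' !addn1.
  (* The loop may stop before [k] jumps at a fixed point of [r]; the missing jumps would stay
     there. *)
  have fixed i m : r i = i -> iter m r i = i by move=> ri; elim: m => //= m ->.
  have split_k : iter k r 0%N = iter (k - nvar s' vQ) r (nvar s' vI).
    by rewrite eI -iterD subnK.
  case: (ltnP (nvar s' vI) n) => [lt_in|le_ni]; last first.
    have eIn : nvar s' vI = n by lia.
    by rewrite split_k eIn fixed ?eqxx.
  rewrite andTb arr //; case: (ltnP (nvar s' vQ) k) => [lt_q|ge_q].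
    rewrite andTb -leqNgt => le_r.
    have r_n := r_ge _ le_n; rewrite split_k fixed; last by lia.
    by apply/esym/negbTE; rewrite neq_ltn lt_in.
  move=> _; have -> : iter k r 0%N = nvar s' vI.
    rewrite split_k; have -> : (k - nvar s' vQ = 0)%N by lia.
    by [].
  by apply/esym/negbTE; rewrite neq_ltn lt_in.
apply: runs_seq.
  by apply: (@runs_run _ _ _ (fun s' => s' = run jump_init s)).
move=> _ _ ->; apply: runs_loop => //.
move=> s' [en' ek' arr' le_q [eI le_n]].
rewrite [beval _ _]/= en' ek' arr' !addn1 => /and3P[lt_in lt_q].
have r_n := r_ge _ le_n; rewrite arr // => lt_r.
have eI1 : nvar (run jump_body s') vI = r (nvar s' vI) by rewrite /= arr' arr.
have eQ1 : nvar (run jump_body s') vQ = (nvar s' vQ).+1 by rewrite /= /upd /= addn1.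
suff : inv (run jump_body s') by split; rewrite // /mu eI1; lia.
split; [exact: en'|exact: ek'|exact: arr'|by rewrite eQ1|].
by rewrite eI1 eQ1 iterS -eI; split=> //; lia.
Qed.

Definition next_row := NSet vI (NAdd (NVar vI) (NVar vD)) ;; NSet vS (nmax vS vI).
Definition keep_row :=
  RPut aKey (NVar vI) (RVar rCost) ;; NPut aList (NVar vM) (NVar vI) ;;
  NSet vC (NAdd (NVar vC) (NSub (NGet aHi (NVar vI)) (NGet aLo (NVar vI)))) ;;
  NSet vM (nsucc vM).
Definition gather_body :=
  NSet vJ (NHalf (NAdd (NGet aLo (NVar vI)) (NGet aHi (NVar vI)))) ;;
  If (NLe (NGet aHi (NVar vI)) (NGet aLo (NVar vI))) next_row
    (probe ;;
     If (RLe (RVar rR) (RVar rL)) (keep_row ;; next_row)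
       (NSet vS (nsucc vS))).
Definition gather_init :=
  NSet vI (NCst 0) ;; NSet vS (NCst 0) ;; NSet vM (NCst 0) ;; NSet vC (NCst 0).

(* Lists the multiples of [vD] that still have candidates, together with the
   cost of the middle candidate of each. *)
Definition gather := gather_init ;; While (NLe (nsucc vI) (NVar vN)) gather_body.

Section Gather.
Variables (R : realType) (n : nat) (X Y : nat -> R).
Hypothesis X_le : forall i, X i <= X i.+1.
Hypothesis Y_le : forall i, Y i <= Y i.+1.
Variables (lo hi : nat -> nat) (d : nat).
Hypothesis d_gt0 : (0 < d)%N.
Hypothesis lo_mono : forall i j, (i <= j)%N -> (lo i <= lo j)%N.
Hypothesis hi_mono : forall i j, (i <= j)%N -> (hi i <= hi j)%N.
Hypothesis lo_hi : forall i, (lo i <= hi i)%N.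
Hypothesis lo_ge : forall i, (i < n)%N -> (i <= lo i)%N.
Hypothesis hi_le : forall i, (hi i <= n)%N.
Hypothesis lo_out : forall i, (n <= i)%N -> lo i = n.

Local Notation cst := (cost X Y).

Definition middle i := ((lo i + hi i)./2).
Definition on_active (f : nat -> nat) i := if (lo i < hi i)%N then f i else 0%N.

(** The list is described up to order: equal sums for every [f] mean equal multisets, a form that
    sorting preserves. As listed rows lie below [bound], storing the key of a later row does not
    overwrite theirs. *)
Record gathered (s : state R) (bound rows : nat) : Prop := Gathered {
  gt_sum : forall f, (\sum_(x < nvar s vM) f (narr s aList x) =
    \sum_(q < rows) on_active f (q * d))%N;
  gt_total : nvar s vC = (\sum_(q < rows) (hi (q * d) - lo (q * d)))%N;
  gt_item : forall x, (x < nvar s vM)%N -> let i := narr s aList x in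
    [/\ (i < bound)%N, (i < n)%N, (lo i < hi i)%N &
        rarr s aKey i = cst i (middle i)] }.

Record gather_inv (s : state R) : Prop := GatherInv {
  ga_tables : tables n X Y (narr s) (rarr s);
  ga_n : nvar s vN = n;
  ga_d : nvar s vD = d;
  ga_lo : forall i, (i < n)%N -> narr s aLo i = lo i;
  ga_hi : forall i, (i < n)%N -> narr s aHi i = hi i;
  ga_rows : exists q, [/\ nvar s vI = (q * d)%N, (q.-1 * d < n)%N &
    gathered s (nvar s vI) q];
  ga_order : (nvar s vI < n)%N ->
    (nvar s vI <= nvar s vS <= middle (nvar s vI))%N;
  ga_ptr : (nvar s vI < n)%N -> forall v, (nvar s vI <= v < nvar s vS)%N ->
    lcost X Y (nvar s vI) v < rcost_of X Y v (middle (nvar s vI)) }.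

Definition gather_measure (s : state R) : nat := (n - nvar s vI) + (n - nvar s vS).

(** Both ends of the candidate intervals move right with the row, hence so do the middles; this is
    what lets one sweep of the crossing pointer evaluate a cost in every row. *)
Lemma middle_mono i j : (i <= j)%N -> (middle i <= middle j)%N.
Proof.
by move=> le_ij; rewrite /middle half_leq // leq_add ?lo_mono ?hi_mono.
Qed.

Lemma middle_ge i : (i < n)%N -> (i <= middle i)%N.
Proof. by move=> lt_in; have := lo_ge lt_in; have := lo_hi i; rewrite /middle; lia. Qed.

Lemma gathered_next s q : nvar s vI = (q * d)%N -> (nvar s vI < n)%N ->
  gathered s (nvar s vI) q ->
  let s' := if (lo (nvar s vI) < hi (nvar s vI))%N then run keep_row s else s in
  ((lo (nvar s vI) < hi (nvar s vI))%N -> rvar s rCost = cst (nvar s vI) (middle (nvar s vI))) ->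
  narr s aLo (nvar s vI) = lo (nvar s vI) ->
  narr s aHi (nvar s vI) = hi (nvar s vI) ->
  gathered s' (nvar s vI + d) q.+1.
Proof.
move=> eI lt_in [gs gt gi]; case: ifPn => act /=; last first.
  move=> _ elo ehi; split.
  - move=> f; rewrite big_ord_recr /= -gs /on_active -eI (negbTE act) addn0.
    by [].
  - rewrite big_ord_recr /= gt -eI.
    have /eqP -> : (hi (nvar s vI) - lo (nvar s vI) == 0)%N by rewrite subn_eq0 leqNgt.
    by rewrite addn0.
  - by move=> x /gi[lt_x ? ? ?]; split=> //; lia.
move=> /(_ isT) costE elo ehi.
have list_old x : (x < nvar s vM)%N ->
    narr (run keep_row s) aList x = narr s aList x.
  by move=> lt_x; rewrite /= /upd /= ltn_eqF.
split.
- move=> f; rewrite /= addn1 !big_ord_recr /= -gs /on_active -eI act.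
  congr (_ + _)%N; last by rewrite /upd /= eqxx.
  by apply: eq_bigr => x _; rewrite -list_old.
- by rewrite big_ord_recr /= /upd /= gt -eI elo ehi.
- move=> x; rewrite /= /upd /= addn1 ltnS leq_eqVlt => /predU1P[->|lt_x].
    by rewrite !eqxx; split=> //; lia.
  have [lt_xi ? ? eK] := gi _ lt_x.
  by rewrite ltn_eqF // ltn_eqF //; split=> //; lia.
Qed.

Lemma gather_inv_next s : gather_inv s -> (nvar s vI < n)%N ->
  nvar s vJ = middle (nvar s vI) ->
  ((lo (nvar s vI) < hi (nvar s vI))%N -> rvar s rCost = cst (nvar s vI) (middle (nvar s vI))) ->
  let s1 := if (lo (nvar s vI) < hi (nvar s vI))%N then run keep_row s else s in
  let s' := run next_row s1 in
  gather_inv s' /\ (gather_measure s' < gather_measure s)%N.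
Proof.
move=> [tb en ed elo ehi [q [eI lt_q gt]] ord ptr] lt_in eJ costE s1 s'.
have := gathered_next eI lt_in gt costE (elo _ lt_in) (ehi _ lt_in).
rewrite -/s1 => gt1.
have s1E : [/\ nvar s1 vI = nvar s vI, nvar s1 vS = nvar s vS, nvar s1 vD = d,
    nvar s1 vN = n & nvar s1 vJ = nvar s vJ].
  by rewrite /s1; case: ifP.
have [eI1 eS1 eD1 eN1 eJ1] := s1E.
have eI' : nvar s' vI = (nvar s vI + d)%N by rewrite /s' /= eI1 eD1.
have eS' : nvar s' vS = maxn (nvar s vS) (nvar s vI + d).
  by rewrite /s' /= /upd /= eI1 eS1 eD1 maxnE.
split; last by rewrite /gather_measure eI' eS'; lia.
split; rewrite ?eI' ?eS' //.
- rewrite /s' /= /s1; case: ifP => // _.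
  apply: tables_put => //; case: tb => tX tY tP tU tD; split=> //=.
- by move=> i lt_i; rewrite /s' /= /s1; case: ifP => _; rewrite /= -?elo.
- by move=> i lt_i; rewrite /s' /= /s1; case: ifP => _; rewrite /= -?ehi.
- exists q.+1; split; [by rewrite mulSn -eI addnC|by rewrite /= -eI|].
  by case: gt1 => gs1 gt1 gi1; split.
- move=> lt_i; have := ord lt_in; have := middle_ge lt_i.
  by have := middle_mono (leq_addr d (nvar s vI)); lia.
- move=> lt_i v hv.
  have lt_v : (nvar s vI <= v < nvar s vS)%N by lia.
  apply: le_lt_trans (lt_le_trans (ptr lt_in v lt_v) _).
    by apply: lcost_anti; rewrite // leq_addr.
  by apply: rcost_mono => //; apply/middle_mono/leq_addr.
Qed.

Lemma gather_inv_rvar s rv : gather_inv s -> gather_inv (with_rvar s rv).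
Proof.
case=> tb en ed elo ehi [q [eI lt_q [gs gt gi]]] ord ptr; split=> //.
by exists q; split=> //; split.
Qed.

Lemma gather_inv_next_sink s : gather_inv s -> (nvar s vI < n)%N ->
  nvar s vJ = middle (nvar s vI) ->
  lcost X Y (nvar s vI) (nvar s vS) < rcost_of X Y (nvar s vS) (nvar s vJ) ->
  let s' := run (NSet vS (nsucc vS)) s in
  gather_inv s' /\ (gather_measure s' < gather_measure s)%N.
Proof.
move=> [tb en ed elo ehi rows ord ptr] lt_in eJ lt_lr s'.
have eS : nvar s' vS = (nvar s vS).+1 by rewrite /s' /= addn1.
have eI : nvar s' vI = nvar s vI by [].
have lt_vj : (nvar s vS < nvar s vJ)%N.
  rewrite ltnNge; apply/negP => le_jv; move: lt_lr.
  by rewrite {1}/rcost_of le_jv ltNge (lcost_ge0 X_le Y_le).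
have le_mid : (middle (nvar s vI) <= n)%N.
  by have := lo_hi (nvar s vI); have := hi_le (nvar s vI); rewrite /middle; lia.
have ord_s := ord lt_in.
split; last by rewrite /gather_measure eS eI; lia.
split=> //; rewrite ?eS ?eI //.
- by case: rows => q [eIq lt_q [gs gt gi]]; exists q; split=> //; split.
- by move=> _; lia.
- move=> _ v hv; case: (ltngtP v (nvar s vS)) => [lt_v|?|->]; last by rewrite -eJ.
    by apply: ptr => //; lia.
  by lia.
Qed.

Lemma gather_step s : gather_inv s -> (nvar s vI < n)%N ->
  gather_inv (run gather_body s) /\
  (gather_measure (run gather_body s) < gather_measure s)%N.
Proof.
move=> inv0 lt_in; rewrite /gather_body run_seq run_nset.
have -> : gather_measure s = gather_measure (set_nvar s vJ (neval s
  (NHalf (NAdd (NGet aLo (NVar vI)) (NGet aHi (NVar vI)))))) by [].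
have eJ : neval s (NHalf (NAdd (NGet aLo (NVar vI)) (NGet aHi (NVar vI)))) =
    middle (nvar s vI).
  by rewrite /= (ga_lo inv0) // (ga_hi inv0).
rewrite {}eJ; set s1 := set_nvar s _ _.
have inv : gather_inv s1.
  case: inv0 => tb en ed elo ehi [q [eI lt_q [gs gt gi]]] ord ptr; split=> //.
  by exists q; split=> //; split.
have {lt_in} lt_in : (nvar s1 vI < n)%N by [].
have eJ : nvar s1 vJ = middle (nvar s1 vI) by [].
move: s1 inv lt_in eJ => {inv0} {}s inv lt_in eJ.
rewrite run_if [beval _ _]/= (ga_lo inv) // (ga_hi inv) //.
case: (leqP (hi (nvar s vI)) (lo (nvar s vI))) => [le_hl|lt_lh].
  have /negbTE inact : ~~ (lo (nvar s vI) < hi (nvar s vI))%N by rewrite -leqNgt.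
  by have := gather_inv_next inv lt_in eJ; rewrite inact; apply.
rewrite run_seq; have ord := ga_order inv lt_in; have := hi_le (nvar s vI) => hin.
have lt_jn : (nvar s vJ < n)%N by rewrite eJ /middle; lia.
have vj : (nvar s vI <= nvar s vS <= nvar s vJ)%N by rewrite eJ.
have [rv [-> [l r _ c] others]] := run_probe X_le Y_le (ga_tables inv) vj lt_jn.
have inv' := gather_inv_rvar rv inv.
have -> : gather_measure s = gather_measure (with_rvar s rv) by [].
rewrite run_if [beval _ _]/= l r; case: leP => [le_rl|lt_lr]; last first.
  exact: (gather_inv_next_sink inv').
rewrite run_seq.
have costE : rvar (with_rvar s rv) rCost = cst (nvar s vI) (middle (nvar s vI)).
  rewrite -eJ; apply: c; split=> //; first by lia.
  by move=> v hv; rewrite eJ; apply: (ga_ptr inv).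
have := gather_inv_next inv' lt_in eJ; rewrite [nvar (with_rvar s rv) vI]/= lt_lh.
by apply=> _.
Qed.

Lemma sum_rows q (f : nat -> nat) : (q.-1 * d < n)%N -> (n <= q * d)%N ->
  (forall i, (n <= i)%N -> f i = 0%N) ->
  (\sum_(p < q) f (p * d) = \sum_(p < n) f (p * d))%N.
Proof.
move=> lt_q le_n f0; have le_qn : (q <= n)%N by nia.
rewrite (big_ord_widen n (fun p => f (p * d)%N) le_qn) big_mkcond /=.
apply: eq_bigr => p _; case: ltnP => // le_qp; rewrite f0 //.
by apply: leq_trans le_n _; rewrite leq_mul2r le_qp orbT.
Qed.

Lemma sum_le_const (f : nat -> nat) m c : (forall x, f x <= c)%N ->
  (\sum_(x < m) f x <= c * m)%N.
Proof.
move=> f_le; elim: m => [|m IHm]; first by rewrite big_ord0.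
by rewrite big_ord_recr mulnS addnC leq_add.
Qed.

Lemma runs_gather s : (0 < n)%N -> tables n X Y (narr s) (rarr s) ->
  nvar s vN = n -> nvar s vD = d ->
  (forall i, (i < n)%N -> narr s aLo i = lo i) ->
  (forall i, (i < n)%N -> narr s aHi i = hi i) ->
  runs gather s
    (linear_const gather_init (NLe (nsucc vI) (NVar vN)) gather_body * n.+1)
    (fun s' => [/\ tables n X Y (narr s') (rarr s'), gathered s' n n,
       (nvar s' vM <= nvar s' vC)%N,
       nvar s' vC = total n (fun i => hi i - lo i)%N d &
       forall q, (n <= q * d)%N -> (nvar s' vM <= q)%N]).
Proof.
move=> n_gt0 tb en ed elo ehi.
pose mu := gather_measure (run gather_init s).
apply: (@runs_sub _ _ _ (maxcost gather_init + _ * mu.+1)%N _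
  (fun s' => gather_inv s' /\ ~~ beval s' (NLe (nsucc vI) (NVar vN)))).
- by apply: linear_constP; rewrite /mu /gather_measure /=; lia.
- move=> s' _ [inv]; rewrite [beval _ _]/= (ga_n inv) addn1 -leqNgt => le_n.
  have [q [eI lt_q [gs gt gi]]] := ga_rows inv.
  have M_le_q : (nvar s' vM <= q)%N.
    have := gs (fun=> 1%N); rewrite sum_nat_const card_ord muln1 => ->.
    rewrite -[X in (_ <= X)%N]mul1n; apply: (@sum_le_const (fun p => on_active (fun=> 1%N) (p * d))).
    by move=> x; rewrite /on_active; case: ifP.
  have lo_out' i : (n <= i)%N -> (hi i - lo i = 0)%N.
    by move=> le_ni; have := hi_le i; rewrite lo_out //; lia.
  have eC : nvar s' vC = total n (fun i => hi i - lo i)%N d.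
    by rewrite gt (@sum_rows q (fun i => hi i - lo i)%N) // -eI.
  split=> //; first exact: ga_tables.
  + split=> //.
    * move=> f; rewrite gs (@sum_rows q (on_active f)) // -?eI // => i le_ni.
      by rewrite /on_active; have := lo_out' _ le_ni; case: ltnP => //; lia.
    * by move=> x /gi[_ ? ? ?]; split.
  + have := gs (fun=> 1%N); rewrite sum_nat_const card_ord muln1 => ->.
    rewrite gt; apply: leq_sum => p _; rewrite /on_active; case: ltnP => //; lia.
  + move=> q0 le_q0; apply: leq_trans M_le_q _.
    have : (q.-1 < q0)%N by rewrite -(ltn_pmul2r d_gt0); apply: leq_trans le_q0.
    by lia.
apply: runs_seq.
  by apply: (@runs_run _ _ _ (fun s' => s' = run gather_init s)).
move=> _ _ ->; apply: runs_loop => //.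
  by move=> s' inv; rewrite [beval _ _]/= (ga_n inv) addn1; apply: gather_step.
split=> //.
exists 0%N; split=> //; split=> //=.
- by move=> f; rewrite !big_ord0.
- by rewrite big_ord0.
Qed.

End Gather.

(** * Sorting *)

Definition nmin e1 e2 := NSub e1 (NSub e1 e2).

Definition new_block :=
  NSet vA (NVar vEnd) ;;
  NSet vMid (nmin (NAdd (NVar vA) (NVar vW)) (NVar vTop)) ;;
  NSet vB (NVar vMid) ;;
  NSet vEnd (nmin (NAdd (NVar vMid) (NVar vW)) (NVar vTop)).

Definition copy_from v :=
  NPut aList (NVar vO) (NGet aList (NVar v)) ;; NSet v (nsucc v) ;;
  NSet vO (nsucc vO).

Definition key_at v := RGet aKey (NGet aList (NVar v)).

Definition take_left :=
  BAnd (NLe (nsucc vA) (NVar vMid))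
    (BNot (BAnd (NLe (nsucc vB) (NVar vEnd)) (BNot (RLe (key_at vA) (key_at vB))))).

Definition block_done := BAnd (NLe (NVar vMid) (NVar vA)) (NLe (NVar vEnd) (NVar vB)).

Definition merge_body :=
  If block_done new_block Skip ;;
  If take_left (copy_from vA) (copy_from vB).

(** Runs of length [w] start at multiples of [w] counted from [origin]. Order is claimed only
    between neighbours that no boundary separates. *)
Definition boundary (w origin x : nat) : bool := (w %| x - origin)%N.

Section Merge.
Variables (R : realType) (b w m : nat) (L : nat -> nat) (key : nat -> R).
Hypotheses (w_gt0 : (0 < w)%N).
Local Notation e := (b + m)%N.

Definition src_sorted := forall x, (b <= x)%N -> (x.+1 < e)%N ->
  ~~ boundary w b x.+1 -> key (L x) <= key (L x.+1).

(* [z] is the start of the current pair of runs. *)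
Record merge_inv (z : nat) (s : state R) : Prop := MergeInv {
  ms_top : nvar s vTop = e;
  ms_w : nvar s vW = w;
  ms_m : nvar s vM = m;
  ms_base : nvar s vBase = b;
  ms_key : rarr s aKey = key;
  ms_src : forall x, (x < e)%N -> narr s aList x = L x;
  ms_order : [&& b <= z, z <= nvar s vA, nvar s vA <= nvar s vMid,
    nvar s vMid <= nvar s vB, nvar s vB <= nvar s vEnd & nvar s vEnd <= e]%N;
  ms_start : boundary w.*2 b z;
  ms_left : (nvar s vMid <= z + w)%N;
  ms_right : (nvar s vEnd <= nvar s vMid + w)%N;
  ms_mid : (nvar s vMid < nvar s vEnd)%N -> nvar s vMid = (z + w)%N;
  ms_end : (nvar s vEnd < e)%N -> boundary w.*2 b (nvar s vEnd);
  ms_out : nvar s vO = (e + (nvar s vA - b) + (nvar s vB - nvar s vMid))%N;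
  ms_sum : forall f, (\sum_(e <= x < nvar s vO) f (narr s aList x) =
    \sum_(b <= x < nvar s vA) f (L x) +
    \sum_(nvar s vMid <= x < nvar s vB) f (L x))%N;
  ms_sorted : forall x, (e <= x)%N -> (x.+1 < nvar s vO)%N ->
    ~~ boundary w.*2 e x.+1 ->
    key (narr s aList x) <= key (narr s aList x.+1);
  ms_last : (z < nvar s vA)%N || (nvar s vMid < nvar s vB)%N ->
    ((nvar s vA < nvar s vMid)%N ->
       key (narr s aList (nvar s vO).-1) <= key (L (nvar s vA))) /\
    ((nvar s vB < nvar s vEnd)%N ->
       key (narr s aList (nvar s vO).-1) <= key (L (nvar s vB))) }.

Lemma merge_new_block z s : merge_inv z s -> (nvar s vO < e + m)%N ->
  beval s block_done ->
  let s' := run new_block s in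
  [/\ merge_inv (nvar s vEnd) s', nvar s' vO = nvar s vO &
      (nvar s' vA < nvar s' vMid)%N].
Proof.
move=> [top ew em eb ekey src ord start left right mid end_ out sums sorted last].
move=> lt_O; rewrite [beval _ _]/= => /andP[le_mA le_eB] s'.
have eA : nvar s vA = nvar s vMid by lia.
have eB : nvar s vB = nvar s vEnd by lia.
have lt_end : (nvar s vEnd < e)%N by lia.
have eA' : nvar s' vA = nvar s vEnd by [].
have eM' : nvar s' vMid = minn (nvar s vEnd + w) e.
  by rewrite /s' /= /upd /= ew top minnE.
have eB' : nvar s' vB = minn (nvar s vEnd + w) e.
  by rewrite /s' /= /upd /= ew top minnE.
have eE' : nvar s' vEnd = minn (nvar s' vMid + w) e.
  by rewrite eM' /s' /= /upd /= ew top !minnE.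
have eO' : nvar s' vO = nvar s vO by [].
have [same_n same_l same_k] : [/\ [/\ nvar s' vTop = nvar s vTop, nvar s' vW = nvar s vW,
    nvar s' vM = nvar s vM & nvar s' vBase = nvar s vBase],
    narr s' = narr s & rarr s' = rarr s] by [].
clearbody s'; case: same_n => sT sW sM sB.
have lt_AM : (nvar s' vA < nvar s' vMid)%N.
  by rewrite eA' eM' leq_min lt_end andbT -[X in (X < _)%N]addn0 ltn_add2l.
split=> //; split; rewrite ?sT ?sW ?sM ?sB ?same_l ?same_k //; try lia.
- move=> lt_e; have := end_ lt_end; rewrite /boundary.
  have -> : (nvar s' vEnd - b = (nvar s vEnd - b) + w.*2)%N by lia.
  by rewrite dvdn_addl ?dvdnn.
- by move=> f; rewrite eO' sums eA' eA eB eM' eB' [X in (_ = _ + X)%N]big_geq // addn0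
  -big_cat_nat //=; lia.
- by move=> x; rewrite eO'; apply: sorted.
Qed.

Lemma merge_copy_left z s : merge_inv z s -> (nvar s vA < nvar s vMid)%N ->
  src_sorted ->
  ((nvar s vB < nvar s vEnd)%N -> key (L (nvar s vA)) <= key (L (nvar s vB))) ->
  let s' := run (copy_from vA) s in
  merge_inv z s' /\ nvar s' vO = (nvar s vO).+1.
Proof.
move=> [top ew em eb ekey src ord start left right mid end_ out sums sorted last].
move=> lt_A srcs le_AB s'.
have lt_Ae : (nvar s vA < e)%N by lia.
have eA : nvar s' vA = (nvar s vA).+1 by rewrite /s' /= addn1.
have eO : nvar s' vO = (nvar s vO).+1 by rewrite /s' /= /upd /= addn1.
have [sT [sW sM sB] [sMid sVB sE] sk] : [/\ nvar s' vTop = nvar s vTop,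
    [/\ nvar s' vW = nvar s vW, nvar s' vM = nvar s vM & nvar s' vBase = nvar s vBase],
    [/\ nvar s' vMid = nvar s vMid, nvar s' vB = nvar s vB & nvar s' vEnd = nvar s vEnd]
    & rarr s' = rarr s] by [].
have new : narr s' aList (nvar s vO) = L (nvar s vA).
  by rewrite /s' /= /upd /= eqxx src.
have old x : (x < nvar s vO)%N -> narr s' aList x = narr s aList x.
  by move=> lt_x; rewrite /s' /= /upd /= ltn_eqF.
clearbody s'; split=> //.
split; rewrite ?sT ?sW ?sM ?sB ?sMid ?sVB ?sE ?sk ?eA ?eO //; try lia.
- by move=> x lt_x; rewrite old ?src //; lia.
- move=> f; rewrite big_nat_recr /=; last by lia.
  rewrite new [in RHS]big_nat_recr /=; last by lia.
  rewrite addnAC -sums; congr (_ + _)%N.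
  by apply: eq_big_nat => x hx; rewrite old //; lia.
- move=> x le_x lt_x ndvd; case: (ltngtP x.+1 (nvar s vO)) => [lt_xO|?|eqx].
  + by rewrite !old ?(ltnW lt_xO) //; apply: sorted.
  + by lia.
  rewrite eqx new old -?eqx // -[x]/(x.+1).-1 eqx.
  (* Otherwise the new entry is the first of its pair of runs, and [x.+1] is a boundary of the
     output. *)
  have : (z < nvar s vA)%N || (nvar s vMid < nvar s vB)%N.
    rewrite -[_ || _]negbK; apply/negP => /norP[zA MB]; move/negP: ndvd; apply.
    by rewrite /boundary (_ : (x.+1 - e = z - b)%N) //; lia.
  by case/last => /(_ lt_A).
- move=> _; rewrite new; split=> [lt_A1|lt_B]; last exact: le_AB.
  apply: srcs; [lia|lia|].
  rewrite /boundary.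
  (* [z] starts a run, and [vA.+1] exceeds it by a positive amount below [w], so both entries belong
     to the same left run. *)
  have -> : ((nvar s vA).+1 - b = (z - b) + ((nvar s vA).+1 - z))%N by lia.
  rewrite dvdn_addr; last by apply: dvdn_trans start; rewrite -muln2 dvdn_mulr.
  by apply/negP => /dvdn_leq; lia.
Qed.

Lemma merge_copy_right z s : merge_inv z s -> (nvar s vB < nvar s vEnd)%N ->
  src_sorted ->
  ((nvar s vA < nvar s vMid)%N -> key (L (nvar s vB)) <= key (L (nvar s vA))) ->
  let s' := run (copy_from vB) s in
  merge_inv z s' /\ nvar s' vO = (nvar s vO).+1.
Proof.
move=> [top ew em eb ekey src ord start left right mid end_ out sums sorted last].
move=> lt_B srcs le_BA s'.
have lt_Be : (nvar s vB < e)%N by lia.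
have eB : nvar s' vB = (nvar s vB).+1 by rewrite /s' /= addn1.
have eO : nvar s' vO = (nvar s vO).+1 by rewrite /s' /= /upd /= addn1.
have [sT [sW sM sB] [sMid sVA sE] sk] : [/\ nvar s' vTop = nvar s vTop,
    [/\ nvar s' vW = nvar s vW, nvar s' vM = nvar s vM & nvar s' vBase = nvar s vBase],
    [/\ nvar s' vMid = nvar s vMid, nvar s' vA = nvar s vA & nvar s' vEnd = nvar s vEnd]
    & rarr s' = rarr s] by [].
have new : narr s' aList (nvar s vO) = L (nvar s vB).
  by rewrite /s' /= /upd /= eqxx src.
have old x : (x < nvar s vO)%N -> narr s' aList x = narr s aList x.
  by move=> lt_x; rewrite /s' /= /upd /= ltn_eqF.
clearbody s'; split=> //.
split; rewrite ?sT ?sW ?sM ?sB ?sMid ?sVA ?sE ?sk ?eB ?eO //; try lia.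
- by move=> x lt_x; rewrite old ?src //; lia.
- move=> f; rewrite big_nat_recr /=; last by lia.
  rewrite new [X in (_ = _ + X)%N]big_nat_recr /=; last by lia.
  rewrite addnA -sums; congr (_ + _)%N.
  by apply: eq_big_nat => x hx; rewrite old //; lia.
- move=> x le_x lt_x ndvd; case: (ltngtP x.+1 (nvar s vO)) => [lt_xO|?|eqx].
  + by rewrite !old ?(ltnW lt_xO) //; apply: sorted.
  + by lia.
  rewrite eqx new old -?eqx // -[x]/(x.+1).-1 eqx.
  have : (z < nvar s vA)%N || (nvar s vMid < nvar s vB)%N.
    rewrite -[_ || _]negbK; apply/negP => /norP[zA MB]; move/negP: ndvd; apply.
    by rewrite /boundary (_ : (x.+1 - e = z - b)%N) //; lia.
  by case/last => _ /(_ lt_B).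
- move=> _; rewrite new; split=> [lt_A|lt_B1]; first exact: le_BA.
  (* A nonempty right run comes after a full left run, so it starts at [z + w]. *)
  have eMid := mid (leq_ltn_trans _ lt_B).
  apply: srcs; [lia|lia|].
  rewrite /boundary.
  have -> : ((nvar s vB).+1 - b = (z - b) + w + ((nvar s vB).+1 - nvar s vMid))%N.
    by rewrite eMid; lia.
  rewrite dvdn_addr; last first.
    by rewrite dvdn_addl ?dvdnn //; apply: dvdn_trans start; rewrite -muln2 dvdn_mulr.
  by apply/negP => /dvdn_leq; lia.
Qed.

Lemma merge_step z s : merge_inv z s -> (nvar s vO < e + m)%N -> src_sorted ->
  (exists z', merge_inv z' (run merge_body s)) /\
  nvar (run merge_body s) vO = (nvar s vO).+1.
Proof.
move=> inv lt_O srcs; rewrite /merge_body run_seq.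
set s1 := run _ s.
have [z1 [inv1 eO lt]] : exists z1, [/\ merge_inv z1 s1, nvar s1 vO = nvar s vO &
    (nvar s1 vA < nvar s1 vMid)%N || (nvar s1 vB < nvar s1 vEnd)%N].
  rewrite /s1 run_if; case: ifPn => [done_|ndone].
    have [inv1 eO lt] := merge_new_block inv lt_O done_.
    by exists (nvar s vEnd); split=> //; rewrite lt.
  exists z; split=> //; move: ndone; rewrite [beval _ _]/= negb_and -!ltnNge.
  by [].
clearbody s1; rewrite -eO.
suff [? ?] : merge_inv z1 (run (If take_left (copy_from vA) (copy_from vB)) s1) /\
   nvar (run (If take_left (copy_from vA) (copy_from vB)) s1) vO = (nvar s1 vO).+1.
  by split=> //; exists z1.
have keyE v : (v < e)%N -> rarr s1 aKey (narr s1 aList v) = key (L v).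
  by move=> lt_v; rewrite (ms_key inv1) (ms_src inv1).
have ord := ms_order inv1.
rewrite run_if [beval _ _]/= !addn1; case: ifPn => [/andP[ltA nB]|].
  apply: (merge_copy_left inv1 ltA srcs) => ltB; move: nB.
  by rewrite ltB /= negbK !keyE //; lia.
rewrite negb_and negbK => ntake.
have ltB : (nvar s1 vB < nvar s1 vEnd)%N.
  by case/orP: ntake lt => [/negbTE -> //|/andP[]].
apply: (merge_copy_right inv1 ltB srcs) => ltA; move: ntake.
by rewrite ltA ltB /= -ltNge !keyE; [move/ltW|lia|lia].
Qed.

End Merge.

Definition pass_init :=
  NSet vTop (NAdd (NVar vBase) (NVar vM)) ;; NSet vA (NVar vBase) ;;
  NSet vMid (NVar vBase) ;; NSet vB (NVar vBase) ;; NSet vEnd (NVar vBase) ;;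
  NSet vO (NVar vTop).
Definition pass_guard := NLe (nsucc vO) (NAdd (NVar vTop) (NVar vM)).
Definition pass_end := NSet vBase (NVar vTop) ;; NSet vW (NAdd (NVar vW) (NVar vW)).
(* Merges the runs of length [vW] of the segment at [vBase] in pairs, into a
   fresh segment right after it. *)
Definition pass := pass_init ;; (While pass_guard merge_body ;; pass_end).

Definition pass_const :=
  (maxcost pass_init + (bcost pass_guard + maxcost merge_body).+1 + maxcost pass_end)%N.

Lemma runs_pass (R : realType) (s : state R) b w m key :
  nvar s vBase = b -> nvar s vW = w -> nvar s vM = m -> rarr s aKey = key ->
  (0 < w)%N -> src_sorted b w m (narr s aList) key ->
  runs pass s (pass_const * m.+1)
    (fun s' => [/\ nvar s' vBase = (b + m)%N, nvar s' vW = (w + w)%N,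
       rarr s' aKey = key,
       forall f, (\sum_(b + m <= x < b + m + m) f (narr s' aList x) =
                  \sum_(b <= x < b + m) f (narr s aList x))%N &
       src_sorted (b + m) w.*2 m (narr s' aList) key]).
Proof.
move=> eb ew em ek w_gt0 srcs; set L := narr s aList.
set K := (bcost pass_guard + maxcost merge_body).+1.
apply: (@runs_sub _ _ _ (maxcost pass_init + (K * m.+1 + maxcost pass_end))%N _ _ _ _
  (fun _ _ q => q)).
  rewrite /pass_const -/K; move: (maxcost _) (maxcost _) K => a c K.
  by rewrite !mulnS !mulnDl; lia.
apply: runs_seq.
  by apply: (@runs_run _ _ _ (fun s' => s' = run pass_init s)).
move=> _ _ ->; set s0 := run pass_init s.
have inv0 : merge_inv b w m L key b s0.
  have [[e1 e2 e3 e4] [e5 e6 e7 e8] [e9 e10 e11]] :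
    [/\ [/\ nvar s0 vTop = (b + m)%N, nvar s0 vW = w, nvar s0 vM = m & nvar s0 vBase = b],
      [/\ rarr s0 aKey = key, narr s0 aList = L, nvar s0 vA = b & nvar s0 vMid = b] &
      [/\ nvar s0 vB = b, nvar s0 vEnd = b & nvar s0 vO = (b + m)%N]].
    by rewrite -eb -ew -em -ek.
  split; rewrite ?e1 ?e2 ?e3 ?e4 ?e5 ?e6 ?e7 ?e8 ?e9 ?e10 ?e11 //; try lia.
  - by rewrite /boundary subnn dvdn0.
  - by rewrite /boundary subnn dvdn0.
  - by move=> f; rewrite !big_geq.
have mu0 : (nvar s0 vTop + nvar s0 vM - nvar s0 vO = m)%N.
  by rewrite /s0 /= /upd /= eb em; lia.
apply: (@runs_seq _ _ _ _ (K * m.+1)%N (maxcost pass_end)).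
  have := @runs_loop _ pass_guard merge_body
    (fun s => exists z, merge_inv b w m L key z s)
    (fun s => nvar s vTop + nvar s vM - nvar s vO)%N s0.
  rewrite -/K mu0; apply => //; last by exists b.
  move=> s1 [z inv]; rewrite [beval _ _]/= addn1 (ms_top inv) (ms_m inv) => lt_O.
  have [[z' inv'] eO] := merge_step w_gt0 inv lt_O srcs.
  by split; [exists z'|rewrite eO (ms_top inv') (ms_m inv'); lia].
move=> s1 _ [[z inv]]; rewrite [beval _ _]/= addn1 (ms_top inv) (ms_m inv) -leqNgt => le_O.
have [eA eB eM eE] : [/\ nvar s1 vA = nvar s1 vMid, nvar s1 vB = (b + m)%N,
    (b <= nvar s1 vMid <= b + m)%N & nvar s1 vO = (b + m + m)%N].
  have := ms_order inv; have out := ms_out inv.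
  by clear -le_O out; split; lia.
apply: runs_run => //; split=> /=.
- by rewrite /upd /= (ms_top inv).
- by rewrite /upd /= (ms_w inv).
- exact: ms_key inv.
- by move=> f; rewrite -eE (ms_sum inv) eA eB -big_cat_nat //=; lia.
- by move=> x le_x lt_x; apply: (ms_sorted inv) => //; rewrite eE; lia.
Qed.

Definition sort_init := NSet vBase (NCst 0) ;; NSet vW (NCst 1).
Definition sort_guard := NLe (nsucc vW) (NVar vM).
Definition merge_sort := sort_init ;; While sort_guard pass.

Definition sort_const := (maxcost sort_init + (bcost sort_guard).+1 + pass_const)%N.

Lemma up_log_gt p l : (2 ^ l < p)%N -> (l < up_log 2 p)%N.
Proof.
move=> lt_p; rewrite ltnNge; apply/negP => le_l.
have := up_logP p (isT : (1 < 2)%N); have : (2 ^ up_log 2 p <= 2 ^ l)%N by rewrite leq_exp2l.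
by move: (2 ^ up_log 2 p)%N lt_p => q; lia.
Qed.

Lemma sorted_le (R : realType) (key : nat -> R) b e :
  (forall x, (b <= x)%N -> (x.+1 < e)%N -> key x <= key x.+1) ->
  forall x y, (b <= x <= y)%N -> (y < e)%N -> key x <= key y.
Proof.
move=> adj x y /andP[le_bx]; elim: y => [|y IHy]; first by rewrite leqn0 => /eqP ->.
rewrite leq_eqVlt => /predU1P[<- //|le_xy] lt_y.
apply: le_trans (IHy _ _) (adj _ _ _) => //; lia.
Qed.

Lemma runs_sort (R : realType) (s : state R) m :
  nvar s vM = m ->
  runs merge_sort s (sort_const * m.+1 * (up_log 2 m).+1)
    (fun s' => [/\ rarr s' aKey = rarr s aKey,
       forall f, (\sum_(nvar s' vBase <= x < nvar s' vBase + m) f (narr s' aList x) =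
                  \sum_(0 <= x < m) f (narr s aList x))%N &
       forall x y, (nvar s' vBase <= x <= y)%N -> (y < nvar s' vBase + m)%N ->
         rarr s aKey (narr s' aList x) <= rarr s aKey (narr s' aList y)]).
Proof.
move=> em; set key := rarr s aKey; set L := narr s aList.
set T1 := ((bcost sort_guard).+1 + pass_const * m.+1)%N.
pose inv (T : nat) (s' : state R) := exists l,
  [/\ nvar s' vW = (2 ^ l)%N, nvar s' vM = m, rarr s' aKey = key,
    (forall f, (\sum_(nvar s' vBase <= x < nvar s' vBase + m) f (narr s' aList x) =
                  \sum_(0 <= x < m) f (L x))%N) &
    src_sorted (nvar s' vBase) (2 ^ l) m (narr s' aList) key /\
    (T1 * (up_log 2 m - l).+1 <= T)%N].
apply: (@runs_sub _ _ _ (maxcost sort_init + T1 * (up_log 2 m).+1)%N _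
  (fun s' => (exists T, inv T s') /\ ~~ beval s' sort_guard)).
- rewrite -mulnA; set q := (m.+1 * _)%N.
  have -> : (T1 * (up_log 2 m).+1 = (bcost sort_guard).+1 * (up_log 2 m).+1 + pass_const * q)%N.
    by rewrite /T1 /q mulnDl mulnA.
  have q_gt0 : (0 < q)%N by rewrite /q muln_gt0.
  have le_q : (((bcost sort_guard).+1 * (up_log 2 m).+1) <= (bcost sort_guard).+1 * q)%N.
    by rewrite leq_mul2l /q mulSn leq_addr orbT.
  rewrite /sort_const 2!mulnDl addnA; apply: leq_add; last by [].
  by apply: leq_add; [apply: leq_pmulr|exact: le_q].
- move=> s' _ [[T [l [ew em' ek sums [srcs _]]]]].
  rewrite [beval _ _]/= ew em' addn1 -leqNgt => le_m; split=> // x y hx hy.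
  apply: (@sorted_le _ (fun x => key (narr s' aList x)) (nvar s' vBase) (nvar s' vBase + m)) => //.
  (* One run now spans the whole segment, as [m <= 2 ^ l], so no boundary is left inside it. *)
  move=> x0 le_x lt_x; apply: srcs => //; rewrite /boundary; apply/negP => /dvdn_leq.
  by clear -le_m le_x lt_x; lia.
apply: runs_seq.
  by apply: (@runs_run _ _ _ (fun s' => s' = run sort_init s)).
move=> _ _ ->; apply: runs_while; last first.
- exists 0%N; split=> //; split; last by rewrite subn0.
  by move=> x _ _; rewrite /boundary dvd1n.
- move=> T s1 [l [ew em1 ek sums [srcs le_T]]]; rewrite [beval _ _]/= ew em1 addn1 => lt_m.
  have lt_l := up_log_gt lt_m.
  exists (pass_const * m.+1)%N, (T1 * (up_log 2 m - l.+1).+1)%N; split; last first.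
    apply: leq_trans le_T.
    have -> : (up_log 2 m - l = (up_log 2 m - l.+1).+1)%N by lia.
    rewrite [X in (_ <= X)%N]mulnS; move: (T1 * _)%N => Z.
    by rewrite /T1; move: (bcost _) (pass_const * _)%N => u v; lia.
  apply: runs_sub (leqnn _) _ (runs_pass (erefl _) ew em1 ek _ srcs); last first.
    by rewrite expn_gt0.
  move=> s2 u [eb2 ew2 ek2 sums2 srcs2]; exists l.+1; split=> //.
  + by rewrite ew2 expnS; lia.
  + by rewrite (same_nvar u).
  + by move=> f; rewrite eb2 sums2 sums.
  + by rewrite eb2 expnS mul2n; split.
- move=> T s1 [l [_ _ _ _ [_ le_T]]] _; apply: leq_trans le_T.
  rewrite mulnS; move: (T1 * _)%N => Z.
  by rewrite /T1; move: (bcost _) (pass_const * _)%N => u v; lia.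
Qed.

(** * The weighted median of the sorted keys *)

Definition weight_at v :=
  NSub (NGet aHi (NGet aList (NVar v))) (NGet aLo (NGet aList (NVar v))).
Definition median_init := NSet vA (NVar vBase) ;; NSet vO (weight_at vA).
(** In truncated arithmetic this is [2 * vO < vC]. *)
Definition median_guard := NLe (nsucc vO) (NSub (NVar vC) (NVar vO)).
Definition median_body := NSet vA (nsucc vA) ;; NSet vO (NAdd (NVar vO) (weight_at vA)).
(* Sets [rLam] to the weighted median of the sorted keys. *)
Definition median :=
  median_init ;; (While median_guard median_body ;; RSet rLam (key_at vA)).

Definition median_const :=
  (maxcost median_init + (bcost median_guard + maxcost median_body).+1
     + maxcost (RSet rLam (key_at vA)))%N.

(** The scan stops at the first entry whose prefix holds half of the weight. What precedes that
    entry is less than half, so the suffix from it also holds at least half. *)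
Lemma runs_median (R : realType) (s : state R) b m wt :
  nvar s vBase = b -> (0 < m)%N ->
  (forall x, wt x = narr s aHi (narr s aList x) - narr s aLo (narr s aList x))%N ->
  nvar s vC = (\sum_(b <= x < b + m) wt x)%N ->
  runs median s (median_const * m.+1)
    (fun s' => exists a, [/\ (b <= a < b + m)%N,
       rvar s' rLam = rarr s aKey (narr s aList a),
       (nvar s vC <= (\sum_(b <= x < a.+1) wt x).*2)%N &
       (nvar s vC <= (\sum_(a <= x < b + m) wt x).*2)%N]).
Proof.
move=> eb m_gt0 wtE eC; set C := nvar s vC in eC *.
set K := (bcost median_guard + maxcost median_body).+1.
apply: (@runs_sub _ _ _ (maxcost median_init + (K * m.+1
    + maxcost (RSet rLam (key_at vA))))%N _ _ _ _ (fun _ _ q => q)).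
  rewrite /median_const -/K; move: (maxcost _) (maxcost _) K => a c K'.
  by rewrite !mulnS !mulnDl; lia.
apply: runs_seq.
  by apply: (@runs_run _ _ _ (fun s' => s' = run median_init s)).
move=> _ _ ->; set s0 := run median_init s.
pose inv (s' : state R) := [/\ nvar s' vC = C,
  [/\ narr s' aHi = narr s aHi, narr s' aLo = narr s aLo, narr s' aList = narr s aList &
    rarr s' aKey = rarr s aKey],
  (b <= nvar s' vA < b + m)%N, nvar s' vO = (\sum_(b <= x < (nvar s' vA).+1) wt x)%N &
  (C <= (\sum_(nvar s' vA <= x < b + m) wt x).*2)%N].
apply: (@runs_seq _ _ _ _ (K * m.+1)%N (maxcost (RSet rLam (key_at vA)))
   (fun s' => inv s' /\ ~~ beval s' median_guard)).
  have mu0 : (b + m - nvar s0 vA = m)%N by rewrite /s0 /= /upd /= eb addKn.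
  have := @runs_loop _ median_guard median_body inv
    (fun s' => b + m - nvar s' vA)%N s0.
  rewrite mu0 -/K; apply => //; last first.
    split=> //; rewrite /s0 /= /upd /= eb; first by lia.
      by rewrite big_nat1 wtE.
    by rewrite -eC -addnn leq_addr.
  move=> s1 [eC1 [eh el eL ek] hA eO le_C].
  rewrite [beval _ _]/= addn1 eC1 => lt_O.
  have lt2 : ((\sum_(b <= x < (nvar s1 vA).+1) wt x).*2 < C)%N by rewrite -eO; lia.
  have split_C : C = (\sum_(b <= x < (nvar s1 vA).+1) wt x +
      \sum_((nvar s1 vA).+1 <= x < b + m) wt x)%N.
    by rewrite eC -big_cat_nat //=; lia.
  have lt_A : ((nvar s1 vA).+1 < b + m)%N.
    rewrite ltnNge; apply/negP => le_A; move: split_C lt2.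
    by rewrite [X in (_ + X)%N]big_geq // addn0 => <-; lia.
  have eA' : nvar (run median_body s1) vA = (nvar s1 vA).+1 by rewrite /= addn1.
  have eO' : nvar (run median_body s1) vO =
      (\sum_(b <= x < (nvar s1 vA).+2) wt x)%N.
    rewrite big_nat_recr /=; last by lia.
    by rewrite -eO wtE /= /upd /= !addn1 eh el eL.
  split; last by rewrite eA'; lia.
  split; rewrite ?eA' ?eO' //; first by lia.
  by move: split_C lt2; move: (\sum_(_ <= _ < _) _)%N (\sum_(_ <= _ < _) _)%N => u v; lia.
move=> s1 _ [[eC1 [eh el eL ek] hA eO le_C]].
rewrite [beval _ _]/= addn1 eC1 -leqNgt => le_O.
apply: runs_run => //; exists (nvar s1 vA); split=> //.
  by rewrite /= /upd /= ek eL.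
by rewrite -eO; lia.
Qed.

(** * Preprocessing *)

(** A single vertex has no edge to read from; 1 then serves as the common capacity. *)
Definition get_capacity :=
  If (NLe (NVar vN) (NCst 1)) (RSet rC (RCst 1)) (RSet rC (RGet 2 (NCst 0))).

Definition prefix_init :=
  RPut aX (NCst 0) (RCst 0) ;; RPut aY (NCst 0) (RCst 0) ;; NSet vI (NCst 0).
Definition prefix_guard := NLe (nsucc vI) (NVar vN).
Definition prefix_body :=
  RPut aX (nsucc vI) (RAdd (RGet aX (NVar vI)) (RMul (RGet 1 (NVar vI)) (RVar rTau))) ;;
  RPut aY (nsucc vI) (RAdd (RGet aY (NVar vI)) (RDiv (RGet 0 (NVar vI)) (RVar rC))) ;;
  RPut aU (NVar vI) (RSub (RGet aY (nsucc vI)) (RGet aX (NVar vI))) ;;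
  RPut aD (NVar vI) (RSub (RGet aX (NVar vI)) (RGet aY (NVar vI))) ;;
  NSet vI (nsucc vI).
Definition prefix_sums := prefix_init ;; While prefix_guard prefix_body.

Definition powers_init :=
  NPut aPow (NCst 1) (NCst 1) ;; NPut aOff (NCst 1) (NCst 0) ;; NSet vI (NCst 2).
Definition powers_guard := NLe (NVar vI) (NVar vN).
Definition powers_body :=
  NPut aPow (NVar vI)
    (NAdd (NGet aPow (NHalf (NVar vI))) (NGet aPow (NHalf (NVar vI)))) ;;
  NPut aOff (NVar vI) (NAdd (NGet aOff (NHalf (NVar vI))) (NVar vN)) ;;
  NSet vI (nsucc vI).
(* For every length [m], the largest power of two [2 ^ l] up to [m] and the
   start [l * n] of row [l] of the sparse tables. *)
Definition powers := powers_init ;; While powers_guard powers_body.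

Section Prefix.
Variables (R : realType) (n : nat) (X Y : nat -> R) (tau c : R) (wt ln : nat -> R).
Hypotheses (X0 : X 0%N = 0) (Y0 : Y 0%N = 0).
Hypothesis XS : forall i, X i.+1 = X i + ln i * tau.
Hypothesis YS : forall i, Y i.+1 = Y i + wt i / c.

Record prefix_inv (s : state R) : Prop := PrefixInv {
  pf_n : nvar s vN = n;
  pf_le : (nvar s vI <= n)%N;
  pf_tau : rvar s rTau = tau;
  pf_c : rvar s rC = c;
  pf_wt : rarr s 0 = wt;
  pf_ln : rarr s 1 = ln;
  pf_X : forall i, (i <= nvar s vI)%N -> rarr s aX i = X i;
  pf_Y : forall i, (i <= nvar s vI)%N -> rarr s aY i = Y i;
  pf_U : forall i, (i < nvar s vI)%N -> rarr s aU i = lkey X Y i;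
  pf_D : forall i, (i < nvar s vI)%N -> rarr s aD i = rkey X Y i }.

Lemma runs_prefix s : nvar s vN = n -> rvar s rTau = tau -> rvar s rC = c ->
  rarr s 0 = wt -> rarr s 1 = ln ->
  runs prefix_sums s (linear_const prefix_init prefix_guard prefix_body * n.+1)
    (fun s' => [/\ forall i, (i <= n)%N -> rarr s' aX i = X i,
                   forall i, (i <= n)%N -> rarr s' aY i = Y i,
                   forall i, (i < n)%N -> rarr s' aU i = lkey X Y i &
                   forall i, (i < n)%N -> rarr s' aD i = rkey X Y i]).
Proof.
move=> en et ec ew el.
pose mu (s' : state R) := (n - nvar s' vI)%N.
apply: (@runs_sub _ _ _ (maxcost prefix_init + _ * (mu (run prefix_init s)).+1)%N _
  (fun s' => prefix_inv s' /\ ~~ beval s' prefix_guard)).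
- by apply: linear_constP; rewrite /mu /= ?/upd /=; lia.
- move=> s' _ [[en' le_n _ _ _ _ pX pY pU pD]].
  rewrite [beval _ _]/= en' addn1 -leqNgt => ge_n.
  have eI : nvar s' vI = n by lia.
  by rewrite eI in pX pY pU pD.
apply: runs_seq.
  by apply: (@runs_run _ _ _ (fun s' => s' = run prefix_init s)).
move=> _ _ ->; apply: runs_loop => //; last first.
  by split=> //= i; rewrite leqn0 => /eqP ->; rewrite /upd /= ?X0 ?Y0.
move=> s1 [en1 le_n1 et1 ec1 ew1 el1 pX pY pU pD].
rewrite [beval _ _]/= en1 addn1 => lt_in; set s2 := run prefix_body s1.
have eI : nvar s2 vI = (nvar s1 vI).+1 by rewrite /s2 /= addn1.
have newX : rarr s2 aX (nvar s1 vI).+1 = X (nvar s1 vI).+1.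
  by rewrite /s2 /= /upd /= addn1 eqxx pX // et1 el1 XS.
have newY : rarr s2 aY (nvar s1 vI).+1 = Y (nvar s1 vI).+1.
  by rewrite /s2 /= /upd /= addn1 eqxx pY // ec1 ew1 YS.
have ne_I : (nvar s1 vI == (nvar s1 vI).+1) = false by apply/negbTE; rewrite neq_ltn ltnSn.
have newU : rarr s2 aU (nvar s1 vI) = lkey X Y (nvar s1 vI).
  by rewrite /s2 /= /upd /= addn1 !eqxx ne_I pX // pY // ec1 ew1 /lkey YS.
have newD : rarr s2 aD (nvar s1 vI) = rkey X Y (nvar s1 vI).
  by rewrite /s2 /= /upd /= addn1 !eqxx ne_I pX // pY.
have oldX i : (i <= nvar s1 vI)%N -> rarr s2 aX i = X i.
  by move=> le_i; rewrite /s2 /= /upd /= addn1 ltn_eqF ?pX // ltnS.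
have oldY i : (i <= nvar s1 vI)%N -> rarr s2 aY i = Y i.
  by move=> le_i; rewrite /s2 /= /upd /= addn1 ltn_eqF ?pY // ltnS.
have oldU i : (i < nvar s1 vI)%N -> rarr s2 aU i = lkey X Y i.
  by move=> le_i; rewrite /s2 /= /upd /= ltn_eqF ?pU.
have oldD i : (i < nvar s1 vI)%N -> rarr s2 aD i = rkey X Y i.
  by move=> le_i; rewrite /s2 /= /upd /= ltn_eqF ?pD.
have [e1 [e2 e3] [e4 e5]] : [/\ nvar s2 vN = n, rvar s2 rTau = tau /\ rvar s2 rC = c &
  rarr s2 0 = wt /\ rarr s2 1 = ln] by [].
clearbody s2; split; last by rewrite /mu eI; lia.
split; rewrite ?eI // => i; rewrite leq_eqVlt => /predU1P[].
- by move=> ->.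
- by rewrite ltnS; apply: oldX.
- by move=> ->.
- by rewrite ltnS; apply: oldY.
- by case=> ->.
- by rewrite ltnS; apply: oldU.
- by case=> ->.
- by rewrite ltnS; apply: oldD.
Qed.

End Prefix.

Lemma runs_powers (R : realType) (n : nat) (s : state R) : nvar s vN = n ->
  runs powers s (linear_const powers_init powers_guard powers_body * n.+1)
    (fun s' => forall m, (0 < m <= n)%N -> exists l,
      [/\ narr s' aPow m = 2 ^ l, narr s' aOff m = l * n & 2 ^ l <= m < 2 ^ l.+1]%N).
Proof.
move=> en.
pose ok (s' : state R) m := exists l,
  [/\ narr s' aPow m = 2 ^ l, narr s' aOff m = l * n & 2 ^ l <= m < 2 ^ l.+1]%N.
pose inv (s' : state R) := [/\ nvar s' vN = n, (1 < nvar s' vI)%N &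
  forall m, (0 < m < nvar s' vI)%N -> ok s' m].
pose mu (s' : state R) := (n.+1 - nvar s' vI)%N.
apply: (@runs_sub _ _ _ (maxcost powers_init + _ * (mu (run powers_init s)).+1)%N _
  (fun s' => inv s' /\ ~~ beval s' powers_guard)).
- by apply: linear_constP; rewrite /mu /= ?/upd /=; lia.
- move=> s' _ [[en' _ oks]]; rewrite [beval _ _]/= en' -ltnNge => lt_n m hm.
  by apply: oks; lia.
apply: runs_seq.
  by apply: (@runs_run _ _ _ (fun s' => s' = run powers_init s)).
move=> _ _ ->; apply: runs_loop => //; last first.
  split=> // m; rewrite /= /upd /= => hm; have -> : m = 1%N by lia.
  by exists 0%N.
move=> s1 [en1 gt1 oks]; rewrite [beval _ _]/= en1 => le_n; set s2 := run powers_body s1.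
have eI : nvar s2 vI = (nvar s1 vI).+1 by rewrite /s2 /= addn1.
have half_ne : ((nvar s1 vI)./2 == nvar s1 vI) = false by apply/negbTE; lia.
have new : ok s2 (nvar s1 vI).
  have [|l [ep eo hl]] := oks (nvar s1 vI)./2; first by lia.
  (* Halving a length lowers its binary logarithm by one. *)
  exists l.+1; rewrite /s2 /= /upd /= !eqxx ep eo en1 !expnS.
  by split; [lia|rewrite mulSn addnC|move: hl; rewrite expnS; move: (2 ^ l)%N => p; lia].
have old m : (0 < m < nvar s1 vI)%N -> ok s2 m.
  move=> hm; have [l [ep eo hl]] := oks _ hm; exists l.
  by rewrite /s2 /= /upd /= ltn_eqF //; case/andP: hm.
have e1 : nvar s2 vN = n by [].
clearbody s2; split; last by rewrite /mu eI; lia.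
split; rewrite ?eI //; first by lia.
move=> m hm; case: (ltngtP m (nvar s1 vI)) => [lt_m|?|->//]; [apply: old|]; lia.
Qed.

Definition table_max a :=
  RSet rMax (RGet a (NSub (NVar vO) (NVar vN))) ;;
  RSet rTmp (RGet a (NAdd (NSub (NVar vO) (NVar vN)) (NVar vW))) ;;
  If (RLe (RVar rMax) (RVar rTmp)) (RSet rMax (RVar rTmp)) Skip ;;
  RPut a (NVar vO) (RVar rMax).
Definition next_column :=
  NSet vO (nsucc vO) ;; NSet vI (nsucc vI) ;;
  If (NLe (NVar vN) (NVar vI))
    (NSet vI (NCst 0) ;; NSet vW (NAdd (NVar vW) (NVar vW))) Skip.
Definition sparse_init := NSet vW (NCst 1) ;; NSet vO (NVar vN) ;; NSet vI (NCst 0).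
Definition sparse_guard := NLe (nsucc vW) (NVar vN).
Definition sparse_body := table_max aU ;; table_max aD ;; next_column.
(* Entry [l * n + i] of [aU] and [aD] receives the maximum of the keys with
   indices from [i] to [i + 2 ^ l - 1]. *)
Definition sparse := sparse_init ;; While sparse_guard sparse_body.

Lemma run_table_max (R : realType) (s : state R) a :
  exists rv, run (table_max a) s = State (nvar s) rv (narr s)
    (upd (rarr s) a (upd (rarr s a) (nvar s vO)
      (Num.max (rarr s a (nvar s vO - nvar s vN))
               (rarr s a (nvar s vO - nvar s vN + nvar s vW)))))%N
    /\ forall x, (x != rMax)%N && (x != rTmp)%N -> rv x = rvar s x.
Proof.
set u := rarr s a (nvar s vO - nvar s vN)%N.
set v := rarr s a (nvar s vO - nvar s vN + nvar s vW)%N.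
exists (if u <= v then upd (upd (upd (rvar s) rMax u) rTmp v) rMax v
        else upd (upd (rvar s) rMax u) rTmp v).
rewrite /table_max 3!run_seq run_if [run (RSet rMax _) _]/= [run (RSet rTmp _) _]/=.
rewrite -/u -/v [beval _ _]/= [upd _ _ _ 2%N]/upd [upd _ _ _ 3%N]/upd /= [upd _ _ _ 2%N]/upd /=.
by case: leP => uv; split=> // x /andP[/negbTE n1 /negbTE n2]; rewrite /upd n1 n2.
Qed.

Section Sparse.
Variables (R : realType) (n : nat) (f g : nat -> R).
Hypothesis n_gt0 : (0 < n)%N.

Definition row_ok (ra : nat -> nat -> R) l i :=
  ra aU (l * n + i)%N = wmax f i (2 ^ l).-1 /\
  ra aD (l * n + i)%N = wmax g i (2 ^ l).-1.

Definition sparse_inv (budget : nat) (s : state R) : Prop := exists l,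
  [/\ nvar s vN = n /\ nvar s vW = (2 ^ l)%N,
    nvar s vO = (l.+1 * n + nvar s vI)%N, (nvar s vI < n)%N,
    budget = ((up_log 2 n - l) * n - nvar s vI)%N &
    (forall l' i, (l' <= l)%N -> (i + 2 ^ l' <= n)%N -> row_ok (rarr s) l' i) /\
    (forall i, (i < nvar s vI)%N -> (i + 2 ^ l.+1 <= n)%N -> row_ok (rarr s) l.+1 i)].

Lemma wmax_double (h : nat -> R) l i :
  Num.max (wmax h i (2 ^ l).-1) (wmax h (i + 2 ^ l)%N (2 ^ l).-1) =
  wmax h i (2 ^ l.+1).-1.
Proof.
apply/esym/wmax_cover => x; have : (0 < 2 ^ l)%N by rewrite expn_gt0.
by rewrite expnS; move: (2 ^ l)%N => p; lia.
Qed.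

Lemma sparse_step budget s : sparse_inv budget s -> beval s sparse_guard ->
  exists2 budget', (budget' < budget)%N & sparse_inv budget' (run sparse_body s).
Proof.
case=> l [[en ew] eo lt_I eb [rows part]].
rewrite [beval _ _]/= en ew addn1 => lt_l; have lt_up := up_log_gt lt_l.
rewrite /sparse_body 2!run_seq.
have [rv1 [-> _]] := run_table_max s aU; set s1 := State _ _ _ _.
have [rv2 [-> _]] := run_table_max s1 aD; set s2 := State _ _ _ _.
have eO : (nvar s vO - nvar s vN = l * n + nvar s vI)%N by rewrite eo en mulSn; lia.
have p_gt0 : (0 < 2 ^ l)%N by rewrite expn_gt0.
have old a l' i : (a == aU) || (a == aD) -> (l' * n + i < nvar s vO)%N ->
    rarr s2 a (l' * n + i)%N = rarr s a (l' * n + i)%N.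
  by move=> /orP[] /eqP -> lt_O; rewrite /s2 /s1 /= /upd /= ltn_eqF.
have new : (nvar s vI + 2 ^ l.+1 <= n)%N -> row_ok (rarr s2) l.+1 (nvar s vI).
  move=> le_n; have [||u1 d1] := rows l (nvar s vI).
    by []. by rewrite expnS in le_n; lia.
  have [||u2 d2] := rows l (nvar s vI + 2 ^ l)%N.
    by []. by rewrite expnS in le_n; lia.
  rewrite /row_ok -eo; split.
    by rewrite /s2 /s1 /= /upd /= eqxx eO ew u1 -addnA u2 wmax_double.
  by rewrite /s2 /s1 /= /upd /= eqxx eO ew d1 -addnA d2 wmax_double.
have rows2 l' i : (l' <= l)%N -> (i + 2 ^ l' <= n)%N -> row_ok (rarr s2) l' i.
  move=> le_l le_n; have [u d] := rows l' i le_l le_n.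
  have lt_O : (l' * n + i < nvar s vO)%N.
    have : (0 < 2 ^ l')%N by rewrite expn_gt0.
    have : (l' * n <= l * n)%N by rewrite leq_mul2r le_l orbT.
    by rewrite eo mulSn; lia.
  by rewrite /row_ok !old.
have part2 i : (i < (nvar s vI).+1)%N -> (i + 2 ^ l.+1 <= n)%N -> row_ok (rarr s2) l.+1 i.
  rewrite ltnS leq_eqVlt => /predU1P[-> //|lt_i] le_n.
  have [u d] := part i lt_i le_n.
  have lt_O : (l.+1 * n + i < nvar s vO)%N by rewrite eo; lia.
  by rewrite /row_ok !old.
have [e1 [e2 e3] e4] : [/\ nvar s2 vN = n, nvar s2 vW = (2 ^ l)%N /\
  nvar s2 vO = (l.+1 * n + nvar s vI)%N & nvar s2 vI = nvar s vI] by [].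
clearbody s2; rewrite /next_column !run_seq !run_nset run_if.
rewrite [beval _ _]/= /upd /= e1 e4 addn1; case: (leqP n (nvar s vI).+1) => [ge_n|lt_n].
  exists ((up_log 2 n - l.+1) * n)%N; first by nia.
  exists l.+1; split=> //=.
  - by rewrite /upd /= e1 e2 expnS; split=> //; lia.
  - by rewrite /upd /= e3 addn1 !mulSn; lia.
  - by rewrite subn0.
  split=> // l' i; rewrite leq_eqVlt => /predU1P[-> le_n|]; last exact: rows2.
  have q_gt0 : (0 < 2 ^ l.+1)%N by rewrite expn_gt0.
  by apply: part2 => //; move: (2 ^ l.+1)%N q_gt0 le_n => q; lia.
exists ((up_log 2 n - l) * n - (nvar s vI).+1)%N; first by nia.
exists l; rewrite /= /upd /= e4 !addn1; split=> //.
by rewrite e3 addnS.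
Qed.

Lemma runs_sparse s : nvar s vN = n ->
  (forall i, (i < n)%N -> rarr s aU i = f i /\ rarr s aD i = g i) ->
  runs sparse s
    (maxcost sparse_init +
       (bcost sparse_guard + maxcost sparse_body).+1 * (up_log 2 n * n).+1)
    (fun s' => forall l i, (i + 2 ^ l <= n)%N -> row_ok (rarr s') l i).
Proof.
move=> en base.
apply: runs_seq.
  by apply: (@runs_run _ _ _ (fun s' => s' = run sparse_init s)).
move=> _ _ ->.
have inv0 : sparse_inv (up_log 2 n * n) (run sparse_init s).
  exists 0%N; rewrite /= /upd /= en mul1n addn0 !subn0; split=> //; split=> // l i.
  rewrite leqn0 => /eqP -> /=; rewrite expn0 addn1 => lt_i.
  by have [? ?] := base i lt_i; rewrite /row_ok mul0n add0n.
apply: runs_sub (leqnn _) _ (runs_loop_ghost _ sparse_step inv0) => //.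
move=> s' _ [[budget [l [[en' ew] _ _ _ [rows _]]]]].
rewrite [beval _ _]/= en' ew addn1 -leqNgt => le_n l' i le_i; apply: rows => //.
rewrite -(@leq_exp2l 2) //; apply: leq_trans le_n; apply: leq_trans le_i.
exact: leq_addl.
Qed.

End Sparse.

(** * The search for the optimal cost *)

Definition round :=
  merge_sort ;; (median ;; (sweep false aReach ;; (jump ;;
    If (NLe (NVar vN) (NVar vI)) (RSet rHi (RVar rLam) ;; sweep true aHi)
      (sweep false aLo)))).

Definition sweep_const strict target :=
  linear_const sweep_init (NLe (nsucc vI) (NVar vN)) (sweep_body strict target).
Definition jump_const := linear_const jump_init jump_guard jump_body.
Definition gather_const :=
  linear_const gather_init (NLe (nsucc vI) (NVar vN)) gather_body.
Definition round_const :=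
  (median_const + sweep_const false aReach + jump_const +
   (bcost (NLe (NVar vN) (NVar vI)) +
     (maxcost (RSet rHi (RVar rLam)) + sweep_const true aHi + sweep_const false aLo)).+1)%N.

Section CandidateSearch.
Variables (R : realType) (n k : nat) (X Y : nat -> R).
Hypothesis n_gt0 : (0 < n)%N.
Hypothesis X_le : forall i, X i <= X i.+1.
Hypothesis Y_le : forall i, Y i <= Y i.+1.

Local Notation cst := (cost X Y).

Definition lo_reach (x : R) := reach n cst (atmost x).
Definition hi_reach (x : R) := reach n cst (below x).
Definition enough (x : R) : bool := iter k (lo_reach x) 0%N == n.

Definition candidates (x y : R) d :=
  total n (fun i => hi_reach y i - lo_reach x i)%N d.

(** [x] is a ghost: the lower bound survives only through its reaches in [aLo]. The upper bound is
    also kept as a number, for the output. *)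
Record core_inv (x y : R) (r : nat) (s : state R) : Prop := CoreInv {
  ci_tables : tables n X Y (narr s) (rarr s);
  ci_n : nvar s vN = n;
  ci_k : nvar s vK = k;
  ci_d : nvar s vD = (2 ^ r)%N;
  ci_lo : forall i, (i < n)%N -> narr s aLo i = lo_reach x i;
  ci_hi : forall i, (i < n)%N -> narr s aHi i = hi_reach y i;
  ci_rhi : rvar s rHi = y;
  ci_y : 0 <= y;
  ci_lt : x < y;
  ci_inf : ~~ enough x;
  ci_enough : enough y }.

Record search_inv (x y : R) (r : nat) (s : state R) : Prop := SearchInv {
  si_core : core_inv x y r s;
  si_list : gathered n X Y (lo_reach x) (hi_reach y) (2 ^ r) s n n;
  si_MC : (nvar s vM <= nvar s vC)%N;
  si_C : nvar s vC = candidates x y (2 ^ r);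
  si_M : forall q, (n <= q * 2 ^ r)%N -> (nvar s vM <= q)%N }.

Let csub i j i' j' : (i <= i')%N -> (i' <= j')%N -> (j' <= j)%N ->
  cst i' j' <= cst i j.
Proof. exact: (cost_sub X_le Y_le). Qed.

Lemma lo_reach_mono x i j : (i <= j)%N -> (lo_reach x i <= lo_reach x j)%N.
Proof. exact: (@reach_mono _ n _ csub (atmost x) i j (@down_atmost _ x)). Qed.

Lemma hi_reach_mono x i j : (i <= j)%N -> (hi_reach x i <= hi_reach x j)%N.
Proof. exact: (@reach_mono _ n _ csub (below x) i j (@down_below _ x)). Qed.

Lemma lo_hi_reach x y i : x < y -> (lo_reach x i <= hi_reach y i)%N.
Proof.
move=> lt_xy.
apply: (@reach_sub _ n _ csub (atmost x) (below y) i _ (@down_below _ y)) => z le_z.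
exact: le_lt_trans lt_xy.
Qed.

Lemma tables_same na na' (ra ra' : nat -> nat -> R) :
  na' aPow = na aPow -> na' aOff = na aOff -> ra' aX = ra aX -> ra' aY = ra aY ->
  ra' aU = ra aU -> ra' aD = ra aD -> tables n X Y na ra -> tables n X Y na' ra'.
Proof.
move=> e1 e2 e3 e4 e5 e6 [t1 t2 t3 t4 t5].
by split; rewrite ?e1 ?e2 ?e3 ?e4 ?e5 ?e6.
Qed.

Lemma tables_unchanged c s s' : unchanged c s s' ->
  ~~ (writes_narr c aPow || writes_narr c aOff || writes_rarr c aX ||
      writes_rarr c aY || writes_rarr c aU || writes_rarr c aD) ->
  tables n X Y (narr s) (rarr s) -> tables n X Y (narr s') (rarr s').
Proof.
move=> u; rewrite !negb_or => /andP[/andP[/andP[/andP[/andP[w1 w2] w3] w4] w5] w6].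
by apply: tables_same; rewrite ?(same_narr u) ?(same_rarr u).
Qed.

Lemma core_unchanged c x y r s s' : unchanged c s s' ->
  ~~ (writes_narr c aPow || writes_narr c aOff || writes_rarr c aX ||
      writes_rarr c aY || writes_rarr c aU || writes_rarr c aD) ->
  ~~ (writes_nvar c vN || writes_nvar c vK || writes_nvar c vD ||
      writes_narr c aLo || writes_narr c aHi || writes_rvar c rHi) ->
  core_inv x y r s -> core_inv x y r s'.
Proof.
move=> u wt; rewrite !negb_or => /andP[/andP[/andP[/andP[/andP[w1 w2] w3] w4] w5] w6].
case=> tb en ek ed elo ehi erhi y0 xy inf enou.
split=> //; rewrite ?(same_nvar u) ?(same_rvar u) ?(same_narr u) //.
exact: tables_unchanged u wt tb.
Qed.

Lemma runs_gather_search x y r s : core_inv x y r s ->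
  runs gather s
    (linear_const gather_init (NLe (nsucc vI) (NVar vN)) gather_body * n.+1)
    (search_inv x y r).
Proof.
move=> ci; have [tb en ek ed elo ehi erhi y0 xy inf enou] := ci.
have d_gt0 : (0 < 2 ^ r)%N by rewrite expn_gt0.
apply: runs_sub (leqnn _) _ (runs_gather X_le Y_le d_gt0 (@lo_reach_mono x)
  (@hi_reach_mono y) _ _ _ _ n_gt0 tb en ed elo ehi).
- move=> s' u [tb' gt leM eC leq_M]; split=> //.
  apply: core_unchanged u _ _ ci; by vm_compute.
- by move=> i; apply: lo_hi_reach.
- by move=> i lt_i; apply/reach_ge/ltnW.
- by move=> i; apply: reach_le.
- by move=> i le_n; rewrite /lo_reach /reach ltnNge le_n.
Qed.

Local Notation mid x y := (middle (lo_reach x) (hi_reach y)).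
Local Notation weight x y i := (hi_reach y i - lo_reach x i)%N.

Lemma reach_out_of_range P i : (n <= i)%N -> reach n cst P i = n.
Proof. by move=> le_n; rewrite /reach ltnNge le_n. Qed.

(** In a row whose middle cost is at most [v], raising the lower bound to [v] removes the middle
    candidate and all those before it. *)
Lemma shrink_lo x y v d : x < v -> v < y ->
  (candidates x y d <=
     (\sum_(q < n | (cst (q * d)%N (mid x y (q * d)%N) <= v)%R)
        weight x y (q * d)).*2)%N ->
  (4 * candidates v y d <= 3 * candidates x y d)%N.
Proof.
move=> xv vy; apply: (total_shrink (a := fun i => cst i (mid x y i) <= v)) => i.
  rewrite leq_sub2l // /lo_reach.
  apply: (@reach_sub _ n _ csub (atmost x) (atmost v) i _ (@down_atmost _ v)) => z le_z.
  exact: le_trans le_z (ltW xv).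
move=> le_v; case: (ltnP i n) => [lt_in|le_ni]; last first.
  by rewrite /hi_reach reach_out_of_range // /lo_reach reach_out_of_range // subnn.
case: (ltnP (lo_reach x i) (hi_reach y i)) => [act|inact]; last first.
  have : (weight v y i <= weight x y i)%N.
    rewrite leq_sub2l // /lo_reach.
    apply: (@reach_sub _ n _ csub (atmost x) (atmost v) i _ (@down_atmost _ v)) => z le_z.
    exact: le_trans le_z (ltW xv).
  by lia.
have hi_n : (hi_reach y i <= n)%N by apply: reach_le.
have i_lo : (i <= lo_reach x i)%N by apply/reach_ge/ltnW.
have : (mid x y i < lo_reach v i)%N.
  apply: (@reach_max _ n _ csub (atmost v) i _ (@down_atmost _ v)) => //.
  by rewrite /middle; lia.
by rewrite /middle; lia.
Qed.

(** In a row whose middle cost is at least [v], lowering the upper bound to [v] removes the middle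
    candidate and all those after it. Rows with equality count here and in [shrink_lo]. *)
Lemma shrink_hi x y v d : x < v -> v < y ->
  (candidates x y d <=
     (\sum_(q < n | (v <= cst (q * d)%N (mid x y (q * d)%N))%R)
        weight x y (q * d)).*2)%N ->
  (4 * candidates x v d <= 3 * candidates x y d)%N.
Proof.
move=> xv vy; have hi_le i : (hi_reach v i <= hi_reach y i)%N.
  apply: (@reach_sub _ n _ csub (below v) (below y) i _ (@down_below _ y)) => z le_z.
  exact: lt_trans le_z vy.
apply: (total_shrink (a := fun i => v <= cst i (mid x y i))) => i.
  by rewrite leq_sub2r.
move=> le_v; case: (ltnP i n) => [lt_in|le_ni]; last first.
  by rewrite /hi_reach reach_out_of_range // /lo_reach reach_out_of_range // subnn.
case: (ltnP (lo_reach x i) (hi_reach y i)) => [act|inact]; last first.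
  by have := hi_le i; lia.
have i_lo : (i <= lo_reach x i)%N by apply/reach_ge/ltnW.
have : (hi_reach v i <= mid x y i)%N.
  rewrite leqNgt; apply/negP => lt_mid.
  have : below v (cst i (mid x y i)).
    by apply: (@reach_in _ n cst); rewrite lt_mid andbT /middle; lia.
  by rewrite /below ltNge le_v.
by rewrite /middle; lia.
Qed.

Lemma sum_restrict (f : nat -> nat) (p : pred nat) i j i' j' :
  (i <= i')%N -> (i' <= j')%N -> (j' <= j)%N -> (forall x, (i' <= x < j')%N -> p x) ->
  (\sum_(i' <= x < j') f x <= \sum_(i <= x < j) (if p x then f x else 0))%N.
Proof.
move=> le_i le_ij le_j px.
rewrite (@big_cat_nat _ _ _ i' i j) //=; last by lia.
rewrite (@big_cat_nat _ _ _ j' i' j) //=.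
apply: leq_trans (leq_addl _ _); apply: leq_trans (leq_addr _ _).
by rewrite !big_nat; apply: leq_sum => x hx; rewrite px.
Qed.

(** The median is itself the cost of a candidate, hence strictly between the bounds. Its two halves
    of the sorted list become sums over rows because both describe the same multiset. *)
Lemma median_split x y r s (T : nat -> nat) b m a :
  search_inv x y r s -> m = nvar s vM ->
  (forall f, (\sum_(b <= z < b + m) f (T z) = \sum_(0 <= z < m) f (narr s aList z))%N) ->
  (forall z z', (b <= z <= z')%N -> (z' < b + m)%N ->
     rarr s aKey (T z) <= rarr s aKey (T z')) ->
  (b <= a < b + m)%N ->
  let C := candidates x y (2 ^ r) in let v := rarr s aKey (T a) in
  (C <= (\sum_(b <= z < a.+1) weight x y (T z)).*2)%N ->
  (C <= (\sum_(a <= z < b + m) weight x y (T z)).*2)%N ->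
  [/\ x < v < y, 0 <= v,
   (C <= (\sum_(q < n | (cst (q * 2 ^ r)%N (mid x y (q * 2 ^ r)%N) <= v)%R)
        weight x y (q * 2 ^ r)).*2)%N &
   (C <= (\sum_(q < n | (v <= cst (q * 2 ^ r)%N (mid x y (q * 2 ^ r)%N))%R)
        weight x y (q * 2 ^ r)).*2)%N].
Proof.
move=> si em sums sorted ha C v le1 le2.
have [gs gt gi] := si_list si.
pose ok i := [&& (i < n)%N, (lo_reach x i < hi_reach y i)%N &
  rarr s aKey i == cst i (mid x y i)].
have sumE f : (\sum_(b <= z < b + m) f (T z) =
    \sum_(q < n) on_active (lo_reach x) (hi_reach y) f (q * 2 ^ r))%N.
  by rewrite sums em -gs big_mkord.
(* Sorted entries inherit a pointwise property from the original list: the number of violations is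
   one of the preserved sums, and it is 0. *)
have okT z : (b <= z < b + m)%N -> ok (T z).
  move=> hz; have : (\sum_(b <= z < b + m) (~~ ok (T z) : nat) = 0)%N.
    rewrite (sums (fun i => ~~ ok i : nat)) big_mkord big1 // => p _.
    have lt_p : (p < nvar s vM)%N by rewrite -em.
    by have [_ h1 h2 h3] := gi p lt_p; rewrite /ok h1 h2 h3 eqxx.
  rewrite (@big_cat_nat _ _ _ z) //=; [|by lia|by lia].
  rewrite [X in (_ + X)%N]big_ltn; last by lia.
  by case: (ok (T z)) => //; lia.
have keyT z : (b <= z < b + m)%N -> rarr s aKey (T z) = cst (T z) (mid x y (T z)).
  by move=> /okT/and3P[_ _ /eqP].
have /and3P[lt_an act _] := okT a ha.
have vE : v = cst (T a) (mid x y (T a)) by apply: keyT.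
have le_lo : (T a <= lo_reach x (T a))%N by apply/reach_ge/ltnW.
have le_hi : (hi_reach y (T a) <= n)%N by apply: reach_le.
have mid_in : (lo_reach x (T a) <= mid x y (T a) < hi_reach y (T a))%N.
  by rewrite /middle; lia.
split.
- apply/andP; split; rewrite vE; last first.
    by apply: (@reach_in _ n cst (below y)); rewrite -/(hi_reach y _); lia.
  rewrite ltNge; apply/negP => le_x.
  have : (mid x y (T a) < lo_reach x (T a))%N.
    by apply: (@reach_max _ n _ csub (atmost x) _ _ (@down_atmost _ x)) => //; lia.
  by lia.
- by rewrite vE; apply: (cost_ge0 X_le Y_le); lia.
- apply: leq_trans le1 _; rewrite leq_double.
  apply: leq_trans (@sum_restrict _ (fun z => cst (T z) (mid x y (T z)) <= v) b (b + m) _ _ _ _ _ _) _;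
    [by []|by lia|by lia| |].
    by move=> z hz; rewrite -keyT; [apply: sorted|]; lia.
  rewrite (sumE (fun i => if cst i (mid x y i) <= v then weight x y i else 0%N)).
  rewrite [X in (_ <= X)%N]big_mkcond /=; apply: leq_sum => q _.
  by rewrite /on_active; case: ifP.
- apply: leq_trans le2 _; rewrite leq_double.
  apply: leq_trans (@sum_restrict _ (fun z => v <= cst (T z) (mid x y (T z))) b (b + m) _ _ _ _ _ _) _;
    [by lia|by lia|by []| |].
    by move=> z hz; rewrite -keyT; [apply: sorted|]; lia.
  rewrite (sumE (fun i => if v <= cst i (mid x y i) then weight x y i else 0%N)).
  rewrite [X in (_ <= X)%N]big_mkcond /=; apply: leq_sum => q _.
  by rewrite /on_active; case: ifP.
Qed.

Lemma runs_round x y r s : search_inv x y r s -> (0 < nvar s vC)%N ->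
  runs round s
    (sort_const * (nvar s vM).+1 * (up_log 2 (nvar s vM)).+1 + round_const * n.+1)
    (fun s' => exists x' y', core_inv x' y' r s' /\
       (4 * candidates x' y' (2 ^ r) <= 3 * candidates x y (2 ^ r))%N).
Proof.
move=> si C_gt0; set m := nvar s vM; have ci := si_core si.
have m_gt0 : (0 < m)%N.
  rewrite lt0n; apply/eqP => m0; move: C_gt0; rewrite (si_C si) /candidates /total.
  have [gs _ _] := si_list si; have := gs (fun i => hi_reach y i - lo_reach x i)%N.
  rewrite -/m m0 big_ord0 => /esym/eqP; rewrite sum_nat_eq0 => /forallP all0.
  rewrite big1 // => q _; have := all0 q; rewrite /on_active.
  by case: ltnP => [_ /eqP|]; lia.
have le_mn : (m <= n)%N.
  by apply: (si_M si); rewrite leq_pmulr // expn_gt0.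
apply: (@runs_sub _ _ _ (sort_const * m.+1 * (up_log 2 m).+1 +
  (median_const * n.+1 + (sweep_const false aReach * n.+1 + (jump_const * n.+1 +
    (bcost (NLe (NVar vN) (NVar vI)) +
     (maxcost (RSet rHi (RVar rLam)) + sweep_const true aHi +
      sweep_const false aLo) * n.+1).+1))))%N _ _ _ _ (fun _ _ q => q)).
  rewrite leq_add2l /round_const.
  move: median_const (sweep_const false aReach) jump_const (bcost _)
    (maxcost _ + sweep_const true aHi + sweep_const false aLo)%N => M S J u v.
  by have := leq_pmulr u.+1 (ltn0Sn n); rewrite -addSn !mulnDl; lia.
apply: runs_seq; first exact: runs_sort.
move=> s1 u1 [ek sums sorted]; set b := nvar s1 vBase in sums sorted.
have ci1 : core_inv x y r s1 by apply: core_unchanged u1 _ _ ci; vm_compute.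
have eC1 : nvar s1 vC = candidates x y (2 ^ r).
  by rewrite (same_nvar u1) ?(si_C si) //; vm_compute.
have [gs gt gi] := si_list si.
have weightE z : (b <= z < b + m)%N ->
    (narr s1 aHi (narr s1 aList z) - narr s1 aLo (narr s1 aList z) =
     weight x y (narr s1 aList z))%N.
  move=> hz; have : (\sum_(b <= z < b + m) ((n <= narr s1 aList z)%N : nat) = 0)%N.
    rewrite (sums (fun i => (n <= i)%N : nat)) big_mkord big1 // => p _.
    by have [_ h1 _ _] := gi p (ltn_ord p); rewrite leqNgt h1.
  rewrite (@big_cat_nat _ _ _ z) //=; [|by lia|by lia].
  rewrite [X in (_ + X)%N]big_ltn; last by lia.
  by case: leqP => [|lt_n _]; [lia|rewrite (ci_lo ci1) ?(ci_hi ci1)].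
have sumW : (\sum_(b <= z < b + m) (narr s1 aHi (narr s1 aList z) -
    narr s1 aLo (narr s1 aList z)) = candidates x y (2 ^ r))%N.
  have -> : candidates x y (2 ^ r) = (\sum_(q < n)
      on_active (lo_reach x) (hi_reach y) (fun i => weight x y i) (q * 2 ^ r))%N.
    apply: eq_bigr => q _; rewrite /on_active; case: ltnP => //.
    by rewrite -subn_eq0 => /eqP.
  rewrite -gs -(big_mkord xpredT (fun z => weight x y (narr s aList z))).
  by rewrite -(sums (fun i => weight x y i)); apply: eq_big_nat.
have med := runs_median (erefl b) m_gt0 (fun z => erefl _) (etrans eC1 (esym sumW)).
apply: runs_seq.
  apply: runs_sub _ _ med; first by rewrite leq_mul2l ltnS le_mn orbT.
  by move=> s2 u2 H; exact: (conj u2 H).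
move=> s2 _ [u2 [a [ha eLam le1 le2]]].
have ci2 : core_inv x y r s2 by apply: core_unchanged u2 _ _ ci1; vm_compute.
have eL2 : narr s2 aList = narr s1 aList by rewrite (same_narr u2) //; vm_compute.
have keyE : rarr s1 aKey = rarr s aKey by [].
set v := rarr s1 aKey _ in eLam.
have le1' : (candidates x y (2 ^ r) <= (\sum_(b <= z < a.+1) weight x y (narr s1 aList z)).*2)%N.
  rewrite -eC1; apply: leq_trans le1 _; rewrite leq_double eq_leq //.
  by apply: eq_big_nat => z hz; apply: weightE; lia.
have le2' : (candidates x y (2 ^ r) <= (\sum_(a <= z < b + m) weight x y (narr s1 aList z)).*2)%N.
  rewrite -eC1; apply: leq_trans le2 _; rewrite leq_double eq_leq //.
  by apply: eq_big_nat => z hz; apply: weightE; lia.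
have [/andP[xv vy] v_ge0 half_lo half_hi] :=
  median_split si (erefl m) sums sorted ha le1' le2'.
rewrite -keyE -/v in xv vy v_ge0 half_lo half_hi.
have [tb2 en2 ek2 ed2 _ _ _ _ _ _ _] := ci2.
apply: runs_seq.
  apply: runs_sub (leqnn _) _ (@runs_sweep _ n X Y X_le Y_le false aReach v isT s2 tb2 en2 eLam).
  by move=> s3 u3 H; exact: (conj u3 H).
move=> s3 _ [u3 reach3].
have ci3 : core_inv x y r s3 by apply: core_unchanged u3 _ _ ci2; vm_compute.
have eLam3 : rvar s3 rLam = v by rewrite (same_rvar u3) //; vm_compute.
have [tb3 en3 ek3 _ _ _ _ _ _ _ _] := ci3.
apply: runs_seq.
  apply: runs_sub (leqnn _) _ (@runs_jump _ n k (lo_reach v) s3 en3 ek3 _ _ reach3).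
  - by move=> s4 u4 H; exact: (conj u4 H).
  - exact: reach_n.
  - by move=> i le_i; rewrite reach_ge //= reach_le.
move=> s4 _ [u4 test].
have ci4 : core_inv x y r s4 by apply: core_unchanged u4 _ _ ci3; vm_compute.
have eLam4 : rvar s4 rLam = v by rewrite (same_rvar u4) //; vm_compute.
have [tb4 en4 ek4 ed4 elo4 ehi4 erhi4 y0 xy inf enou] := ci4.
have b_hi : beval s4 (NLe (NVar vN) (NVar vI)) = enough v.
  by rewrite /= en4 test.
apply: (@runs_sub _ _ _ (bcost (NLe (NVar vN) (NVar vI)) +
     (maxcost (RSet rHi (RVar rLam)) + sweep_const true aHi +
      sweep_const false aLo) * n.+1).+1 _ _ _ _ (fun _ _ q => q)) => //.
apply: runs_if; rewrite b_hi => test_v.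
  apply: (@runs_sub _ _ _ (maxcost (RSet rHi (RVar rLam)) + sweep_const true aHi * n.+1)
    _ _ _ _ (fun _ _ q => q)).
    move: (maxcost _) (sweep_const _ _) (sweep_const _ _) => a1 a2 a3.
    by rewrite !mulnDl; have := leq_pmulr a1 (ltn0Sn n); lia.
  apply: runs_seq; first by apply: (@runs_run _ _ _ (fun s' => s' = run (RSet rHi (RVar rLam)) s4)).
  move=> _ _ ->; set s5 := run _ s4.
  have eHi5 : rvar s5 rHi = v by rewrite /s5 /= eLam4.
  apply: runs_sub (leqnn _) _ (@runs_sweep _ n X Y X_le Y_le true aHi v isT s5 tb4 en4 eLam4).
  move=> s6 u6 reach6; exists x, v; split; last exact: (shrink_hi xv vy half_hi).
  split; rewrite ?(same_nvar u6) ?(same_rvar u6) //; try by vm_compute.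
  + by apply: tables_unchanged u6 _ tb4; vm_compute.
  + by move=> i lt_i; rewrite (same_narr u6); [apply: elo4|vm_compute].
apply: (@runs_sub _ _ _ (sweep_const false aLo * n.+1)
    _ _ _ _ (fun _ _ q => q)).
  by rewrite leq_mul2r leq_addl orbT.
apply: runs_sub (leqnn _) _ (@runs_sweep _ n X Y X_le Y_le false aLo v isT s4 tb4 en4 eLam4).
move=> s6 u6 reach6; exists v, y; split; last exact: (shrink_lo xv vy half_lo).
split; rewrite ?(same_nvar u6) ?(same_rvar u6) //; try by vm_compute.
+ by apply: tables_unchanged u6 _ tb4; vm_compute.
+ by move=> i lt_i; rewrite (same_narr u6); [apply: ehi4|vm_compute].
Qed.

End CandidateSearch.

(** * Potentials bounding the number of iterations and the total length of sorted lists *)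

Section Potential.
Local Open Scope nat_scope.
Variable n : nat.
Hypothesis n_gt0 : (0 < n)%N.
Local Notation levels := (up_log 2 n).

(* The number of rounds that may still be needed to bring [C] from at most [9n]
   down to [4n], each round removing a quarter. *)
Definition excess C : nat := (4 * n < C) + (16 * n < 3 * C) + (64 * n < 9 * C).

Lemma excess_le3 C : (excess C <= 3)%N.
Proof. by rewrite /excess; case: (4 * n < C); case: (16 * n < _); case: (64 * n < _). Qed.

(** The thresholds [4n], [16n/3], [64n/9] grow by the factor [4/3], so a round takes [C] below one
    more of them. Above the last one this uses [C <= 9n]: what remains is at most
    [27n/4 < 64n/9]. *)
Lemma excess_drop C C' : (C <= 9 * n)%N -> (4 * n < C)%N -> (4 * C' <= 3 * C)%N ->
  (excess C' < excess C)%N.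
Proof.
move=> le9 lt4 le34; rewrite /excess lt4.
case: (ltnP (4 * n) C'); case: (ltnP (16 * n) (3 * C'));
case: (ltnP (64 * n) (9 * C')); case: (ltnP (16 * n) (3 * C));
case: (ltnP (64 * n) (9 * C)); lia.
Qed.

(* The number of rounds that bring [C] to [0]: three of them halve [C]. *)
Definition rounds C : nat := if C == 0 then 0 else (trunc_log 2 (C ^ 3)).+1.

(** As [(3/4)^3 = 27/64 < 1/2], each round at least halves the cube of [C], and [rounds] counts
    these halvings. *)
Lemma rounds_drop C C' : (0 < C)%N -> (4 * C' <= 3 * C)%N ->
  (rounds C' < rounds C)%N.
Proof.
move=> C_gt0 le34; rewrite /rounds [C == 0](negbTE _) -?lt0n //.
case: eqVneq => [//|]; rewrite -lt0n => C'_gt0.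
rewrite ltnS -trunc_log2_double ?expn_gt0 ?C'_gt0 //.
apply: leq_trunc_log; rewrite -mul2n.
have : ((4 * C') ^ 3 <= (3 * C) ^ 3)%N by rewrite leq_exp2r.
by rewrite !expnMn; move: (C ^ 3)%N (C' ^ 3)%N => a b /=; lia.
Qed.

Lemma n_le_levels : (n <= 2 ^ levels)%N.
Proof. exact: up_logP. Qed.

Lemma levels_le : (2 ^ levels <= n.*2)%N.
Proof.
case: (ltnP 1 n) => [n_gt1|le1]; last by have -> : n = 1 by lia.
have /andP[+ _] := up_log_bounds (isT : (1 < 2)%N) n_gt1.
have : (0 < levels)%N by rewrite up_log_gt0 n_gt1.
by case: levels => // l _ /=; rewrite expnS; lia.
Qed.

Lemma levels_le_n : (levels <= n)%N.
Proof. by apply: up_log_min => //; apply/ltnW/ltn_expl. Qed.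

Definition max_rounds := (11 + 3 * levels)%N.

Lemma rounds_le C : (C <= 9 * n)%N -> (rounds C <= max_rounds)%N.
Proof.
move=> le9; rewrite /rounds; case: eqVneq => [//|]; rewrite -lt0n => C_gt0.
rewrite /max_rounds addSn ltnS.
(* [9 ^ 3 = 729] is below [2 ^ 11], which accounts for the 11. *)
have : (C ^ 3 < 2 ^ (11 + 3 * levels))%N.
  have : (C ^ 3 <= (9 * 2 ^ levels) ^ 3)%N.
    by rewrite leq_exp2r //; have := n_le_levels; lia.
  rewrite expnMn expnD (mulnC 3) expnM.
  have : (0 < (2 ^ levels) ^ 3)%N by rewrite !expn_gt0.
  move=> q_gt0 /leq_ltn_trans; apply.
  by rewrite ltn_pmul2r.
move=> lt_C; have : (trunc_log 2 (C ^ 3) < 11 + 3 * levels)%N.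
  by rewrite -(@ltn_exp2l 2) //; apply: leq_ltn_trans lt_C; apply: trunc_logP; rewrite ?expn_gt0 ?C_gt0.
by lia.
Qed.

(** A positive level allows three rounds and one refinement, hence [4 * r]. *)
Definition iterations r C : nat :=
  if r == 0 then rounds C else (excess C + 4 * r + max_rounds)%N.

(* Each level [r' > 0] below [r] sorts at most three lists of length
   [2 ^ (levels - r')], and level 0 lists of total length at most [36 n]. *)
Fixpoint later_lists r : nat :=
  if r is r'.+1 then (later_lists r' + 3 * 2 ^ (levels - r'))%N else (36 * n)%N.

(** At level 0 a list is no longer than the number of candidates, which loses a quarter per round:
    the geometric series is at most [C / (1 - 3/4) = 4 * C]. *)
Definition list_lengths r C : nat :=
  if r == 0 then (4 * C)%N else (2 ^ (levels - r) * excess C + later_lists r)%N.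

(** The term [6 * 2 ^ (levels - r)] on the left is the remainder of the geometric series, carried
    along to make the induction close. *)
Lemma later_lists_le r : (r <= levels)%N ->
  (later_lists r + 6 * 2 ^ (levels - r) <= 36 * n + 6 * 2 ^ levels)%N.
Proof.
elim: r => [|r IHr] lt_r; first by rewrite subn0.
have := IHr (ltnW lt_r); rewrite /=.
have -> : (levels - r = (levels - r.+1).+1)%N by lia.
by rewrite expnS; lia.
Qed.

Lemma list_lengths_le r C : (r <= levels)%N -> (C <= 9 * n)%N ->
  (list_lengths r C <= 54 * n)%N.
Proof.
move=> le_r le9; rewrite /list_lengths; case: eqVneq => [_|_]; first by lia.
have := later_lists_le le_r; have := levels_le; have := excess_le3 C.
move: (2 ^ levels)%N (2 ^ (levels - r))%N (excess C) => p q e e3.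
have : (q * e <= q * 3)%N by rewrite leq_mul2l e3 orbT.
by lia.
Qed.

Lemma iterations_le r C : (r <= levels)%N -> (C <= 9 * n)%N ->
  (iterations r C <= 14 + 7 * levels)%N.
Proof.
move=> le_r le9; rewrite /iterations; case: eqVneq => [_|_].
  by have := rounds_le le9; rewrite /max_rounds; lia.
by have := excess_le3 C; rewrite /max_rounds; lia.
Qed.

Lemma refine_potential r C C' : (C' <= 9 * n)%N ->
  (iterations r C' < iterations r.+1 C)%N /\
  (list_lengths r C' <= list_lengths r.+1 C)%N.
Proof.
move=> le9; have e3 := excess_le3 C'; have := rounds_le le9.
rewrite /iterations /list_lengths /=; case: r => [|r] /=; first by split; lia.
split; first by lia.
have : (2 ^ (levels - r.+1) * excess C' <= 2 ^ (levels - r.+1) * 3)%N.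
  by rewrite leq_mul2l e3 orbT.
by lia.
Qed.

Lemma round_potential r C C' M : (C <= 9 * n)%N -> (4 * C' <= 3 * C)%N ->
  (0 < C)%N -> (M <= C)%N -> (M <= 2 ^ (levels - r))%N ->
  ((0 < r)%N -> (4 * n < C)%N) ->
  (iterations r C' < iterations r C)%N /\
  (list_lengths r C' + M <= list_lengths r C)%N.
Proof.
move=> le9 le34 C_gt0 le_MC le_M lt4.
rewrite /iterations /list_lengths; case: r lt4 le_M => [|r] lt4 le_M /=.
  by split; [apply: rounds_drop|lia].
have drop := excess_drop le9 (lt4 isT) le34.
split; first by lia.
have : (2 ^ (levels - r.+1) * (excess C').+1 <= 2 ^ (levels - r.+1) * excess C)%N.
  by rewrite leq_mul2l drop orbT.
by rewrite mulnS; lia.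
Qed.

End Potential.

(** * The search loop *)

Definition refine := NSet vD (NHalf (NVar vD)).
Definition few_candidates :=
  NLe (NVar vC) (NAdd (NAdd (NVar vN) (NVar vN)) (NAdd (NVar vN) (NVar vN))).
Definition refine_guard := BAnd (NLe (NCst 2) (NVar vD)) few_candidates.
Definition search_guard := BNot (BAnd (NLe (NVar vD) (NCst 1)) (NLe (NVar vC) (NCst 0))).
Definition search_body := If refine_guard refine round ;; gather.
Definition search := While search_guard search_body.

Definition step_const :=
  (bcost search_guard + bcost refine_guard + maxcost refine + sort_const +
   round_const + gather_const + 2)%N.

Section SearchLoop.
Variables (R : realType) (n k : nat) (X Y : nat -> R).
Hypothesis n_gt0 : (0 < n)%N.
Hypothesis X_le : forall i, X i <= X i.+1.
Hypothesis Y_le : forall i, Y i <= Y i.+1.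
Local Notation levels := (up_log 2 n).
Local Notation cands := (candidates n X Y).

Lemma candidates_refine x y r : x < y ->
  (cands x y (2 ^ r) <= (cands x y (2 ^ r.+1)).*2 + n)%N.
Proof.
move=> lt_xy; have -> : (2 ^ r.+1 = 2 ^ r + 2 ^ r)%N by rewrite expnS mul2n addnn.
apply: (@total_refine n (lo_reach n X Y x) (hi_reach n X Y y)).
- exact: lo_reach_mono.
- exact: hi_reach_mono.
- by move=> i; apply: reach_le.
- by move=> i; apply: lo_hi_reach.
Qed.

(** With a stride of at least [n], row 0 is the only multiple inside the path. *)
Lemma candidates_top x y d : (n <= d)%N -> (cands x y d <= n)%N.
Proof.
move=> le_nd; rewrite /candidates /total; case: n n_gt0 le_nd => // m _ le_md.
rewrite big_ord_recl /= big1 ?addn0.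
  by apply: leq_trans (leq_subr _ _) _; apply: reach_le.
move=> q _; have le_m : (m.+1 <= lift ord0 q * d)%N.
  by apply: leq_trans le_md _; rewrite lift0 leq_pmull.
by rewrite /hi_reach /lo_reach !reach_out_of_range // subnn.
Qed.

(** Each iteration is granted linear time, and each sorted item [levels.+1] times a constant. *)
Definition budget r C :=
  (step_const * n.+1 * (iterations n r C).+1 + sort_const * levels.+1 * list_lengths n r C)%N.

Lemma budget_le r C : (r <= levels)%N -> (C <= 9 * n)%N ->
  (budget r C <= (15 * step_const + 54 * sort_const) * (n.+1 * levels.+1))%N.
Proof.
move=> le_r le9; rewrite /budget.
have := iterations_le n_gt0 le_r le9; have := list_lengths_le n_gt0 le_r le9.
move: (iterations _ _ _) (list_lengths _ _ _) => it ls le_ls le_it.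
rewrite mulnDl; apply: leq_add.
  rewrite -!mulnA (mulnCA 15) leq_mul2l; apply/orP; right.
  by rewrite (mulnCA 15) leq_mul2l; apply/orP; right; lia.
rewrite -!mulnA (mulnCA 54) leq_mul2l; apply/orP; right.
by rewrite mulnA [in leqRHS]mulnC leq_mul2l; apply/orP; right; lia.
Qed.

Definition loop_inv (T : nat) (s : state R) := exists x y r,
  [/\ search_inv n k X Y x y r s, (r <= levels)%N, (nvar s vC <= 9 * n)%N &
      (budget r (nvar s vC) <= T)%N].

Lemma runs_search_step T s : loop_inv T s -> beval s search_guard ->
  exists T1 T2, runs search_body s T1 (loop_inv T2) /\
    ((bcost search_guard + T1 + T2).+1 <= T)%N.
Proof.
case=> x [y [r [si le_r le9 le_T]]]; rewrite [beval _ _]/= => guard.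
have ci := si_core si; have [tb en ek ed elo ehi erhi y0 xy inf enou] := ci.
set C := nvar s vC in le9 le_T guard *.
have refineE : beval s refine_guard = (0 < r)%N && (C <= 4 * n)%N.
  rewrite [beval _ _]/= ed en; congr andb; last by rewrite -/C; lia.
  by case: (r) => // r'; rewrite expnS; have := expn_gt0 2 r'; lia.
case: (boolP (beval s refine_guard)) => [ref|nref].
  have ref' := ref; have := ref; rewrite refineE => /andP[r_gt0 le4].
  case: r r_gt0 si le_r le_T ci ed {guard refineE ref} => // r _ si le_r le_T ci ed.
  set C' := cands x y (2 ^ r).
  have le9' : (C' <= 9 * n)%N.
    by have := candidates_refine r xy; rewrite -(si_C si) -/C -/C'; lia.
  exists ((bcost refine_guard + maxcost refine).+1 + gather_const * n.+1)%N, (budget r C').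
  split.
    apply: (@runs_seq _ _ _ _ _ _ (core_inv n k X Y x y r)).
      apply: runs_if => [_|]; last by rewrite ref'.
      apply: runs_run => //; split=> //=.
      by rewrite /upd /= ed expnS mul2n doubleK.
    move=> s1 _ ci1; apply: runs_sub (leqnn _) _ (runs_gather_search n_gt0 X_le Y_le ci1).
    by move=> s2 _ si2; exists x, y, r; split; rewrite ?(si_C si2) //; apply: ltnW.
  apply: leq_trans le_T; have [it ls] := refine_potential n_gt0 r C le9'.
  rewrite /budget.
  have le_ls : (sort_const * levels.+1 * list_lengths n r C' <=
                sort_const * levels.+1 * list_lengths n r.+1 C)%N.
    by rewrite leq_mul2l ls orbT.
  have le_it : (step_const * n.+1 * (iterations n r C').+2 <=
                step_const * n.+1 * (iterations n r.+1 C).+1)%N.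
    by rewrite leq_mul2l ltnS it orbT.
  have le_step : ((bcost search_guard + (bcost refine_guard + maxcost refine).+1).+1 +
      gather_const * n.+1 <= step_const * n.+1)%N.
    rewrite /step_const; move: (bcost _) (bcost _) (maxcost _) sort_const round_const gather_const => u1 u2 u3 u4 u5 u6.
    by nia.
  rewrite mulnS in le_it.
  set a1 := (_ * list_lengths n r C')%N in le_ls *.
  set a2 := (_ * list_lengths n r.+1 C)%N in le_ls *.
  set b1 := (_ * (iterations n r C').+1)%N in le_it *.
  set b2 := (_ * (iterations n r.+1 C).+1)%N in le_it *.
  set c1 := (gather_const * n.+1)%N in le_step *.
  set c2 := (step_const * n.+1)%N in le_step le_it *.
  clearbody a1 a2 b1 b2 c1 c2.
  move: (bcost _) (bcost _) (maxcost _) le_step => u1 u2 u3 le_step.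
  by clear -le_ls le_it le_step; lia.
set m := nvar s vM.
have C_gt0 : (0 < C)%N.
  by move: guard nref; rewrite refineE ed; case: (r) => [|r']; lia.
have le_mn : (m <= n)%N by apply: (si_M si); rewrite leq_pmulr // expn_gt0.
have le_m : (m <= 2 ^ (levels - r))%N.
  by apply: (si_M si); rewrite -expnD subnK // n_le_levels.
have le_up : (up_log 2 m <= levels)%N by apply: leq_up_log.
have lt4 : (0 < r)%N -> (4 * n < C)%N.
  by move=> r_gt0; move: nref; rewrite refineE r_gt0 ltnNge.
(* Even a round that removed every candidate would have to pay for its list, so the potential is at
   least [m]. *)
have le_mL : (m <= list_lengths n r C)%N.
  have := @round_potential n n_gt0 r C 0 m le9 (leq0n _) C_gt0 (si_MC si) le_m lt4.
  by case=> _; apply: leq_trans; apply: leq_addl.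
set T2 := (step_const * n.+1 * iterations n r C +
  sort_const * levels.+1 * (list_lengths n r C - m))%N.
exists ((bcost refine_guard + (sort_const * m.+1 * (up_log 2 m).+1 +
  round_const * n.+1)).+1 + gather_const * n.+1)%N, T2.
split.
  apply: (@runs_seq _ _ _ _ _ _ (fun s1 => exists x' y', core_inv n k X Y x' y' r s1 /\
       (4 * cands x' y' (2 ^ r) <= 3 * cands x y (2 ^ r))%N)).
    apply: runs_if => [ref|_]; first by rewrite ref in nref.
    exact: (runs_round n_gt0 X_le Y_le si).
  move=> s1 _ [x' [y' [ci1 le34]]].
  apply: runs_sub (leqnn _) _ (runs_gather_search n_gt0 X_le Y_le ci1).
  rewrite -(si_C si) -/C in le34.
  move=> s2 _ si2; exists x', y', r; rewrite (si_C si2).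
  have [it ls] := @round_potential n n_gt0 r C _ m le9 le34 C_gt0 (si_MC si) le_m lt4.
  split=> //; first by lia.
  rewrite /budget /T2; apply: leq_add; first by rewrite leq_mul2l it orbT.
  by rewrite leq_mul2l; apply/orP; right; lia.
apply: leq_trans le_T; rewrite /budget /T2.
have -> : list_lengths n r C = (m + (list_lengths n r C - m))%N by lia.
rewrite addKn mulnDr [X in (_ <= X + _)%N]mulnSr.
(* The extra 1 in [m.+1] costs at most [levels.+1 <= n.+1], which is charged to the linear part of
   the iteration. *)
have le_sort : (sort_const * m.+1 * (up_log 2 m).+1 <=
    sort_const * levels.+1 * m + sort_const * n.+1)%N.
  rewrite -!mulnA -mulnDr leq_mul2l; apply/orP; right.
  have : (m.+1 * (up_log 2 m).+1 <= m.+1 * levels.+1)%N by rewrite leq_mul2l ltnS le_up.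
  move=> /leq_trans; apply; rewrite mulSn addnC (mulnC m) leq_add2l ltnS.
  exact: levels_le_n.
have le_step : ((bcost search_guard + bcost refine_guard).+2 +
    sort_const * n.+1 + round_const * n.+1 + gather_const * n.+1 <= step_const * n.+1)%N.
  rewrite /step_const.
  move: (bcost _) (bcost _) (maxcost _) sort_const round_const gather_const => u1 u2 u3 u4 u5 u6.
  by nia.
set a1 := (_ * m.+1 * _)%N in le_sort *.
set a2 := (_ * levels.+1 * m)%N in le_sort *.
set a3 := (sort_const * n.+1)%N in le_sort le_step *.
set b1 := (round_const * n.+1)%N in le_step *.
set b2 := (gather_const * n.+1)%N in le_step *.
set b3 := (step_const * n.+1)%N in le_step *.
move: (bcost _) (bcost _) (b3 * _)%N (_ * (_ - m))%N le_step => u1 u2 u3 u4 le_step.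
clearbody a1 a2 a3 b1 b2 b3.
by clear -le_sort le_step; lia.
Qed.

Definition search_bound := ((15 * step_const + 54 * sort_const) * (n.+1 * levels.+1))%N.

Lemma runs_search x y r s : search_inv n k X Y x y r s -> (r <= levels)%N ->
  (nvar s vC <= 9 * n)%N ->
  runs search s search_bound (fun s' => exists y',
    [/\ tables n X Y (narr s') (rarr s'), nvar s' vN = n, rvar s' rHi = y', 0 <= y' &
        enough n k X Y y' /\ forall x, x < y' -> ~~ enough n k X Y x]).
Proof.
move=> si le_r le9.
have inv0 : loop_inv search_bound s.
  by exists x, y, r; split=> //; apply: budget_le.
apply: runs_sub (leqnn _) _ (runs_while _ runs_search_step inv0); last first.
  move=> T s1 [x1 [y1 [r1 [_ _ _ le_T]]]] _; apply: leq_trans le_T.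
  rewrite /budget; apply: leq_trans (leq_addr _ _).
  have : (bcost search_guard < step_const)%N by rewrite /step_const; lia.
  by move=> /leq_trans; apply; rewrite -mulnA leq_pmulr.
move=> s' _ [[T [x' [y' [r' [si' _ _ _]]]]]] /negPn /=.
have [tb en ek ed elo ehi erhi y0 xy inf enou] := si_core si'.
rewrite ed (si_C si') => /andP[r_le C0]; exists y'; split=> //; split=> // z lt_z.
have r0 : r' = 0 by move: r_le; case: (r') => // r1; rewrite expnS; have := expn_gt0 2 r1; lia.
rewrite /enough neq_ltn; apply/orP; left.
(* At stride 1 with no candidate left, the reaches of both bounds agree in every row. *)
apply: (infeasible_below (cost_sub X_le Y_le) _ _ lt_z) => [i lt_in|]; last first.
  by rewrite ltn_neqAle; apply/andP; split; [apply: inf|apply: iter_reach_le].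
rewrite -[LHS]/(lo_reach n X Y x' i) -[RHS]/(hi_reach n X Y y' i).
have lo_i : (i <= lo_reach n X Y x' i)%N by apply/reach_ge/ltnW.
have le_lh := lo_hi_reach n X_le Y_le i xy.
apply/eqP; rewrite eqn_leq le_lh -subn_eq0.
have : candidates n X Y x' y' (2 ^ r') == 0 by rewrite -leqn0.
rewrite /candidates /total sum_nat_eq0 => /forallP/(_ (Ordinal lt_in)).
by rewrite r0 /= expn0 muln1.
Qed.

End SearchLoop.

(** * The initial stride and bounds *)

Definition double_stride := NSet vD (NAdd (NVar vD) (NVar vD)).
Definition stride_guard := NLe (nsucc vD) (NVar vN).
Definition stride := NSet vD (NCst 1) ;; While stride_guard double_stride.

(** Costs are nonnegative, so [-1] is infeasible, whereas 0 may be feasible. *)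
Definition set_lower := RSet rLam (RCst (-1)).
Definition set_upper :=
  RSet rHi (RAdd (RGet aX (nprev vN)) (RGet aY (nprev vN))) ;; RSet rLam (RVar rHi).
Definition setup :=
  stride ;; (set_lower ;; (sweep false aLo ;; (set_upper ;; (sweep true aHi ;; gather)))).
(** The successors keep the bound positive at [n = 1], where the logarithm vanishes but the program
    still takes time. *)
Definition nlogn n := (n.+1 * (up_log 2 n).+1)%N.

Definition stride_const :=
  (maxcost (NSet vD (NCst 1)) + (bcost stride_guard + maxcost double_stride).+1)%N.
Definition setup_const :=
  (stride_const + (maxcost set_lower + (sweep_const false aLo +
    (maxcost set_upper + (sweep_const true aHi + gather_const)))))%N.

Lemma le_nlogn a n : (a <= a * nlogn n)%N.
Proof. by rewrite leq_pmulr. Qed.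

Lemma linear_le_nlogn a n : (a * n.+1 <= a * nlogn n)%N.
Proof. by rewrite leq_mul2l leq_pmulr ?orbT. Qed.

Section Setup.
Variables (R : realType) (n k : nat) (X Y : nat -> R).
Hypothesis n_gt0 : (0 < n)%N.
Hypothesis k_gt0 : (0 < k)%N.
Hypothesis X_le : forall i, X i <= X i.+1.
Hypothesis Y_le : forall i, Y i <= Y i.+1.
Hypothesis X0 : X 0%N = 0.
Hypothesis Y0 : Y 0%N = 0.
Local Notation levels := (up_log 2 n).

Lemma runs_stride (s : state R) : nvar s vN = n ->
  runs stride s (stride_const * nlogn n)
    (fun s' => exists r, [/\ nvar s' vD = (2 ^ r)%N, (r <= levels)%N & (n <= 2 ^ r)%N]).
Proof.
move=> en.
set K := (bcost stride_guard + maxcost double_stride).+1.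
apply: (@runs_sub _ _ _ (maxcost (NSet vD (NCst 1)) + K * levels.+1)%N _ _ _ _ (fun _ _ q => q)).
  rewrite /stride_const -/K mulnDl; apply: leq_add; first exact: le_nlogn.
  by rewrite leq_mul2l /nlogn leq_pmull ?orbT.
apply: runs_seq.
  by apply: (@runs_run _ _ _ (fun s' => s' = run (NSet vD (NCst 1)) s)).
move=> _ _ ->.
pose inv (b : nat) (s' : state R) := nvar s' vN = n /\
  exists r, [/\ nvar s' vD = (2 ^ r)%N, (r <= levels)%N & b = (levels - r)%N].
have step b s' : inv b s' -> beval s' stride_guard ->
    exists2 b', (b' < b)%N & inv b' (run double_stride s').
  case=> en' [r [ed le_r eb]]; rewrite [beval _ _]/= en' ed addn1 => lt_r.
  have lt_up := up_log_gt lt_r; exists (levels - r.+1)%N; first by lia.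
  split=> //; exists r.+1; split=> //.
  by rewrite /= /upd /= ed expnS mul2n addnn.
have inv0 : inv levels (run (NSet vD (NCst 1)) s).
  by split=> //; exists 0%N; rewrite subn0.
apply: runs_sub (leqnn _) _ (runs_loop_ghost _ step inv0) => //.
move=> s' _ [[b [en' [r [ed le_r _]]]]]; rewrite [beval _ _]/= en' ed addn1 -leqNgt.
by exists r.
Qed.

Lemma not_enough_negative : ~~ enough n k X Y (-1).
Proof.
have stay m : iter m (lo_reach n X Y (-1)) 0%N = 0%N.
  elim: m => //= m ->; apply: reach_uniq => //.
  by move=> _; rewrite /atmost -ltNge; have := cost_ge0 X_le Y_le (leqnn 0%N); lra.
by rewrite /enough stay neq_ltn n_gt0.
Qed.

Lemma enough_whole y : cost X Y 0%N n.-1 <= y -> enough n k X Y y.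
Proof.
move=> le_y; have one : lo_reach n X Y y 0%N = n.
  apply: reach_uniq; rewrite ?ltnn ?leqnn //.
  move=> j hj; apply: le_trans le_y; apply: (cost_sub X_le Y_le) => //; lia.
rewrite /enough; case: k k_gt0 => // m _; rewrite iterSr one.
by elim: m => //= m /eqP ->; rewrite /lo_reach reach_n.
Qed.

Lemma runs_setup (s : state R) : tables n X Y (narr s) (rarr s) ->
  nvar s vN = n -> nvar s vK = k ->
  runs setup s (setup_const * nlogn n)
    (fun s' => exists x y r, [/\ search_inv n k X Y x y r s',
       (r <= levels)%N & (nvar s' vC <= 9 * n)%N]).
Proof.
move=> tb en ek; rewrite /setup_const 5!mulnDl; apply: runs_seq; first exact: runs_stride.
move=> s1 u1 [r [ed le_r le_n]].
have tb1 : tables n X Y (narr s1) (rarr s1) by apply: tables_unchanged u1 _ tb; vm_compute.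
have [en1 ek1] : nvar s1 vN = n /\ nvar s1 vK = k.
  by rewrite !(same_nvar u1) //; vm_compute.
apply: runs_seq.
  apply: (@runs_sub _ _ _ (maxcost set_lower) _ _ _ _ (fun _ _ q => q)); first exact: le_nlogn.
  by apply: (@runs_run _ _ _ (fun s' => s' = run set_lower s1)).
move=> _ _ ->; set s2 := run set_lower s1.
have lam2 : rvar s2 rLam = -1 by rewrite /s2 /= /upd /= mulrN1z.
apply: runs_seq.
  apply: runs_sub (linear_le_nlogn _ _) _
    (@runs_sweep _ n X Y X_le Y_le false aLo (-1) isT s2 tb1 en1 lam2).
  by move=> s3 u3 H; exact: (conj u3 H).
move=> s3 _ [u3 lo3].
have tb3 : tables n X Y (narr s3) (rarr s3) by apply: tables_unchanged u3 _ tb1; vm_compute.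
have [en3 ek3 ed3] : [/\ nvar s3 vN = n, nvar s3 vK = k & nvar s3 vD = (2 ^ r)%N].
  by rewrite !(same_nvar u3) //; vm_compute.
apply: runs_seq.
  apply: (@runs_sub _ _ _ (maxcost set_upper) _ _ _ _ (fun _ _ q => q)); first exact: le_nlogn.
  by apply: (@runs_run _ _ _ (fun s' => s' = run set_upper s3)).
move=> _ _ ->; set s4 := run set_upper s3; pose y := X n.-1 + Y n.-1.
have [lam4 hi4] : rvar s4 rLam = y /\ rvar s4 rHi = y.
  rewrite /s4 /= /upd /= en3 subn1 (tab_X tb3) ?(tab_Y tb3) //; exact: leq_pred.
have cost_y : cost X Y 0%N n.-1 <= y by apply: cost_whole.
have y_ge0 : 0 <= y by apply: le_trans cost_y; apply: cost_ge0.
apply: runs_seq.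
  apply: runs_sub (linear_le_nlogn _ _) _
    (@runs_sweep _ n X Y X_le Y_le true aHi y isT s4 tb3 en3 lam4).
  by move=> s5 u5 H; exact: (conj u5 H).
move=> s5 _ [u5 hi5].
have ci5 : core_inv n k X Y (-1) y r s5.
  split; rewrite ?(same_nvar u5) ?(same_rvar u5) //; try by vm_compute.
  - by apply: tables_unchanged u5 _ tb3; vm_compute.
  - by move=> i lt_i; rewrite (same_narr u5); [apply: lo3|vm_compute].
  - by lra.
  - exact: not_enough_negative.
  - exact: enough_whole.
apply: runs_sub (linear_le_nlogn _ _) _ (runs_gather_search n_gt0 X_le Y_le ci5).
move=> s6 _ si6; exists (-1), y, r; split=> //.
by rewrite (si_C si6); have := candidates_top X Y n_gt0 (-1) y le_n; lia.
Qed.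

End Setup.

(** * The output *)

Definition emit_vertex v := NPut 1 (NVar vQ) v ;; RPut 0 (NVar vQ) (RCst 0).
Definition emit_inner :=
  NPut 1 (NVar vQ) (nprev vS) ;;
  RPut 0 (NVar vQ)
    (RDiv (RDiv (RAdd (RSub (RVar rR1) (RVar rL))
                      (RSub (RGet aX (NVar vS)) (RGet aX (nprev vS)))) (RCst 2))
          (RVar rTau)).
(* The sink of an optimal placement for the segment, see [cost]. *)
Definition emit_sink :=
  If (NLe (NVar vS) (NVar vI)) (emit_vertex (NVar vI))
    (If (RLe (RVar rL) (RVar rCost)) (emit_vertex (NVar vS))
      (If (RLe (RVar rR1) (RVar rCost)) (emit_vertex (nprev vS)) emit_inner)).
Definition next_segment :=
  NSet vI (nsucc vJ) ;; NSet vS (NVar vI) ;; NSet vQ (nsucc vQ) ;;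
  NPut 0 (NVar vQ) (NVar vI).
Definition output_body :=
  NSet vJ (NSub (NGet aReach (NVar vI)) (NCst 1)) ;; (probe ;;
  If (RLe (RVar rR) (RVar rL)) (emit_sink ;; next_segment) (NSet vS (nsucc vS))).
Definition output_init :=
  NSet vI (NCst 0) ;; NSet vS (NCst 0) ;; NSet vQ (NCst 0) ;;
  NPut 0 (NCst 0) (NCst 0).
Definition output_guard := NLe (nsucc vI) (NVar vN).
Definition output :=
  RSet rLam (RVar rHi) ;; (sweep false aReach ;;
  (output_init ;; (While output_guard output_body ;; NSet vN (NVar vQ)))).

Section Output.
Variables (R : realType) (n : nat) (P : path_network R n) (c : R).
Hypotheses (n_gt0 : (0 < n)%N) (c_gt0 : 0 < c) (cap_c : forall e, cap P e = c).
Local Notation X := (xpos P).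
Local Notation Y := (ysup P c).
Local Notation cst := (cost X Y).
Let X_le := xpos_le P.
Let Y_le := ysup_le P c_gt0.

Variable lam : R.
Local Notation rch := (reach n cst (atmost lam)).
Local Notation cut q := (iter q rch 0%N).

Hypothesis lam_ge0 : 0 <= lam.

Lemma cst_nn i : cst i i = 0.
Proof.
apply/eqP; rewrite eq_le (cost_ge0 X_le Y_le) // andbT.
apply: (cost_le X_le Y_le); left; exists i.
by split; rewrite ?leqnn // ?lcost_nn ?rcost_nn.
Qed.

(** A single vertex costs 0, so every jump advances: the cuts increase strictly and no segment is
    empty. *)
Lemma rch_gt i : (i < n)%N -> (i < rch i)%N.
Proof.
move=> lt_in; apply: (@reach_max _ n _ (cost_sub X_le Y_le) (atmost lam) i i (@down_atmost _ lam)).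
  by rewrite leqnn.
by rewrite /atmost cst_nn.
Qed.

(* Entry [(v, t)] of the output encodes a sink for the vertices from [i] to [j]
   that is good enough. *)
Definition good_sink i j (v : nat) (t : R) := exists a : net_point R n,
  [/\ in_subpath P i j a, (evac_time P a i j <= lam%:E)%E, v = lvertex a &
      t = if a is Inner _ u then u else 0].

Lemma good_vertex i j v : (j < n)%N -> feasible_at_vertex X Y i j lam v ->
  good_sink i j v 0.
Proof.
move=> lt_jn [vij l r]; have lt_vn : (v < n)%N by lia.
exists (Vertex (Ordinal lt_vn)); split=> //; first by split=> //=; lia.
by apply/(evac_vertexP c_gt0 cap_c).
Qed.

Lemma good_inner i j e u : (j < n)%N -> feasible_inside X Y i j lam e u ->
  good_sink i j e (u / tau P).
Proof.
move=> lt_jn [eij tu l r]; have lt_en : (e < n.-1)%N by lia.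
have tau_gt := tau_gt0 P.
have uE : u / tau P * tau P = u by rewrite divfK // gt_eqF.
have te : 0 < u / tau P < len P (Ordinal lt_en).
  have := xpos_edge P (Ordinal lt_en); rewrite /= => edge.
  rewrite divr_gt0 ?ltr_pdivrMr //; first by case/andP: tu => _; rewrite edge.
  by case/andP: tu.
exists (Inner (Ordinal lt_en) (u / tau P)); split=> //.
  by split=> //=; lia.
by apply/(evac_innerP c_gt0 cap_c); rewrite //= uE.
Qed.

Lemma feasible_at_vertex_le i j x y v : x <= y ->
  feasible_at_vertex X Y i j x v -> feasible_at_vertex X Y i j y v.
Proof. by move=> le_xy [vij l r]; split=> //; lra. Qed.

Lemma feasible_inside_le i j x y e u : x <= y ->
  feasible_inside X Y i j x e u -> feasible_inside X Y i j y e u.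
Proof. by move=> le_xy [eij tu l r]; split=> //; lra. Qed.

Lemma run_emit_sink (s : state R) :
  let i := nvar s vI in let v := nvar s vS in let j := nvar s vJ in
  tables n X Y (narr s) (rarr s) -> rvar s rTau = tau P ->
  (j < n)%N -> (v <= j)%N -> crossing X Y i j v -> cst i j <= lam ->
  rvar s rL = lcost X Y i v -> ((i < v)%N -> rvar s rR1 = rcost_of X Y v.-1 j) ->
  rvar s rCost = cst i j ->
  exists v' t', run emit_sink s =
      State (nvar s) (rvar s) (upd (narr s) 1 (upd (narr s 1) (nvar s vQ) v'))
        (upd (rarr s) 0 (upd (rarr s 0) (nvar s vQ) t')) /\ good_sink i j v' t'.
Proof.
move=> i v j tb etau jn vj cr le_lam eL eR1 eC; have [le_iv le_rl lt_v] := cr.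
rewrite /emit_sink run_if [beval _ _]/= -/i -/v; case: (leqP v i) => [le_vi|lt_iv].
  exists i, 0; split; first by [].
  apply: good_vertex => //; have ev : v = i by lia.
  rewrite ev lcost_nn in le_rl; split; [by rewrite leqnn -ev|by rewrite lcost_nn|].
  exact: le_trans le_rl lam_ge0.
have sij : (i < v <= j)%N by rewrite lt_iv.
rewrite run_if [beval _ _]/= eL eC; case: (leP (lcost X Y i v) (cst i j)) => [le_L|lt_L].
  exists v, 0; split; first by [].
  by apply: good_vertex => //; split; [lia|lra|lra].
rewrite run_if [beval _ _]/= (eR1 lt_iv) eC.
case: (leP (rcost_of X Y v.-1 j) (cst i j)) => [le_R|lt_R].
  exists v.-1, 0; split; first by rewrite /= -/v subn1.
  apply: good_vertex => //; apply: feasible_at_vertex_le (cost_at_right sij cr).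
  by lra.
(* Neither end of the crossing edge attains the minimum, so it is attained inside. *)
have costE : cst i j = edge_cost X Y i j v.
  move: lt_L lt_R; rewrite /cost -(crossing_uniq X_le Y_le cr) gtn_eqF //.
  rewrite gt_min ltxx => /= lt_m; rewrite [Num.min (lcost _ _ _ _) _]min_r ?ltW //.
  by rewrite gt_min ltxx => /= lt_e; rewrite min_r ?ltW.
rewrite costE in lt_L lt_R le_lam.
exists v.-1, ((rcost_of X Y v.-1 j - lcost X Y i v + (X v - X v.-1)) / 2 / tau P).
split.
  rewrite /= -/v subn1 eL (eR1 lt_iv) etau.
  by rewrite !(tab_X tb) //; lia.
by apply: good_inner => //; apply: feasible_inside_le (cost_inside sij lt_L lt_R).
Qed.

Record output_inv (s : state R) : Prop := OutputInv {
  oi_tables : tables n X Y (narr s) (rarr s);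
  oi_n : nvar s vN = n;
  oi_tau : rvar s rTau = tau P;
  oi_reach : forall i, (i < n)%N -> narr s aReach i = rch i;
  oi_I : nvar s vI = cut (nvar s vQ);
  oi_cut : forall p, (p <= nvar s vQ)%N -> narr s 0 p = cut p;
  oi_sink : forall p, (p < nvar s vQ)%N ->
    good_sink (cut p) (cut p.+1).-1 (narr s 1 p) (rarr s 0 p);
  oi_lt : forall p, (p < nvar s vQ)%N -> (cut p < n)%N;
  oi_order : (nvar s vI < n)%N -> (nvar s vI <= nvar s vS <= (rch (nvar s vI)).-1)%N;
  oi_ptr : (nvar s vI < n)%N -> forall v, (nvar s vI <= v < nvar s vS)%N ->
    lcost X Y (nvar s vI) v < rcost_of X Y v (rch (nvar s vI)).-1 }.

Definition output_measure (s : state R) : nat := (n - nvar s vI) + (n - nvar s vS).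

(** The offsets of the sinks overwrite the input weights, an array disjoint from the tables. *)
Lemma tables_put_rarr na (ra : nat -> nat -> R) a f : (a < 3)%N ->
  tables n X Y na ra -> tables n X Y na (upd ra a f).
Proof. by move=> a3; apply: tables_same; rewrite // /upd gtn_eqF //; lia. Qed.

Lemma tables_put_narr na (ra : nat -> nat -> R) a f : (a < 2)%N ->
  tables n X Y na ra -> tables n X Y (upd na a f) ra.
Proof. by move=> a2; apply: tables_same; rewrite // /upd gtn_eqF //; lia. Qed.

Lemma output_step s : output_inv s -> (nvar s vI < n)%N ->
  output_inv (run output_body s) /\
  (output_measure (run output_body s) < output_measure s)%N.
Proof.
case=> tb en etau er eI ecut esink elt ord ptr lt_in.
have := rch_gt lt_in; have := reach_le n cst (atmost lam) (nvar s vI) => rle rgt.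
have ord_in := ord lt_in; have ptr_in := ptr lt_in.
rewrite /output_body run_seq run_nset.
have eJ : neval s (NSub (NGet aReach (NVar vI)) (NCst 1)) = (rch (nvar s vI)).-1.
  by rewrite /= er // subn1.
rewrite {}eJ; set s1 := set_nvar s vJ _.
have eJ : nvar s1 vJ = (rch (nvar s vI)).-1 by [].
have jn : (nvar s1 vJ < n)%N by rewrite eJ; lia.
rewrite run_seq.
have [rv [-> [l r r1 cc] others]] := @run_probe R n X Y X_le Y_le s1 tb ord_in jn.
have tau2 : rvar (with_rvar s1 rv) rTau = tau P by rewrite /= others.
rewrite run_if [beval _ _]/= l r; case: leP => [le_rl|lt_lr]; last first.
  set s3 := run _ _.
  have eS3 : nvar s3 vS = (nvar s vS).+1 by rewrite /s3 /= /upd /= addn1.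
  have lt_vj : (nvar s vS < nvar s1 vJ)%N.
    rewrite ltnNge; apply/negP => le_jv; move: lt_lr.
    by rewrite [X in _ < X]/rcost_of le_jv ltNge (lcost_ge0 X_le Y_le).
  have eI3 : nvar s3 vI = nvar s vI by [].
  split; last by rewrite /output_measure eS3 eI3; lia.
  split; rewrite ?eI3 ?eS3 //.
  - by move=> _; lia.
  - move=> _ v hv; case: (ltngtP v (nvar s vS)) => [lt_v|?|->]; last exact: lt_lr.
      by apply: ptr_in; lia.
    by lia.
have cr : crossing X Y (nvar s vI) (nvar s1 vJ) (nvar s vS).
  by split=> //; lia.
have le_lam : cst (nvar s vI) (nvar s1 vJ) <= lam.
  by apply: (@reach_in _ n cst (atmost lam)); rewrite eJ; lia.
have vj : (nvar s vS <= nvar s1 vJ)%N by lia.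
rewrite run_seq.
have [v' [t' [-> good]]] := @run_emit_sink (with_rvar s1 rv) tb tau2 jn vj cr le_lam l r1 (cc cr).
set s2 := State _ _ _ _; set s3 := run next_segment s2.
have eI3 : nvar s3 vI = rch (nvar s vI).
  by rewrite /s3 /= /upd /= addn1 prednK //; lia.
have eS3 : nvar s3 vS = rch (nvar s vI) by rewrite -eI3.
have eQ3 : nvar s3 vQ = (nvar s vQ).+1 by rewrite /s3 /= /upd /= addn1.
have cutS : rch (nvar s vI) = cut (nvar s vQ).+1 by rewrite /= -eI.
have eJ' : nvar s1 vJ = (cut (nvar s vQ).+1).-1 by rewrite -cutS.
have cut3 p : (p <= (nvar s vQ).+1)%N -> narr s3 0 p = cut p.
  move=> le_p; rewrite /s3 /= /upd /= addn1.
  case: eqP => [->|ne_p]; first by rewrite addn1 prednK ?cutS //; lia.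
  by rewrite ecut //; lia.
have sink3 p : (p < (nvar s vQ).+1)%N ->
    good_sink (cut p) (cut p.+1).-1 (narr s3 1 p) (rarr s3 0 p).
  rewrite ltnS leq_eqVlt => /predU1P[->|lt_p].
    by rewrite -eJ' -eI /s3 /= /upd /= !eqxx; exact: good.
  by rewrite /s3 /= /upd /= ltn_eqF //; apply: esink.
have e3 : [/\ nvar s3 vN = n, rvar s3 rTau = tau P &
    forall i, (i < n)%N -> narr s3 aReach i = rch i] by [].
have tb3 : tables n X Y (narr s3) (rarr s3).
  by apply: tables_put_narr => //; apply: tables_put_narr => //; apply: tables_put_rarr.
case: e3 => en3 tau3 r3; clearbody s3.
split; last by rewrite /output_measure eI3 eS3; lia.
split; rewrite ?eI3 ?eS3 ?eQ3 //.
- move=> p; rewrite ltnS leq_eqVlt => /predU1P[->|]; last exact: elt.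
  by rewrite -eI.
- by move=> lt_r; have := rch_gt lt_r; lia.
- by move=> _ v; lia.
Qed.

Definition output_const :=
  (maxcost (RSet rLam (RVar rHi)) + (sweep_const false aReach +
    (linear_const output_init output_guard output_body + maxcost (NSet vN (NVar vQ)))))%N.

Lemma runs_output k s : tables n X Y (narr s) (rarr s) -> nvar s vN = n ->
  rvar s rTau = tau P -> rvar s rHi = lam -> enough n k X Y lam ->
  (forall x, x < lam -> ~~ enough n k X Y x) ->
  runs output s (output_const * nlogn n)
    (fun s' => exists S : ksink R n, outputs s' S /\ optimal_ksink P k S).
Proof.
move=> tb en etau ehi enou inf; rewrite /output_const 3!mulnDl.
apply: runs_seq.
  apply: (@runs_sub _ _ _ (maxcost (RSet rLam (RVar rHi))) _ _ _ _ (fun _ _ q => q)); first exact: le_nlogn.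
  by apply: (@runs_run _ _ _ (fun s' => s' = run (RSet rLam (RVar rHi)) s)).
move=> _ _ ->; set s1 := run _ s.
have lam1 : rvar s1 rLam = lam by rewrite /s1 /= ehi.
apply: runs_seq.
  apply: runs_sub (linear_le_nlogn _ _) _
    (@runs_sweep _ n X Y X_le Y_le false aReach lam isT s1 tb en lam1).
  by move=> s2 u2 H; exact: (conj u2 H).
move=> s2 _ [u2 reach2].
have tb2 : tables n X Y (narr s2) (rarr s2) by apply: tables_unchanged u2 _ tb; vm_compute.
have en2 : nvar s2 vN = n by rewrite (same_nvar u2) //; vm_compute.
have tau2 : rvar s2 rTau = tau P by rewrite (same_rvar u2) //; vm_compute.
set s3 := run output_init s2.
have inv3 : output_inv s3.
  have r0 := rch_gt n_gt0; split=> //=.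
  - by apply: tables_put_narr.
  - by move=> p; rewrite leqn0 => /eqP ->.
apply: (@runs_sub _ _ _ (maxcost output_init +
   ((bcost output_guard + maxcost output_body).+1 * (output_measure s3).+1
    + maxcost (NSet vN (NVar vQ))))%N _ _ _ _ (fun _ _ q => q)).
  rewrite addnA; apply: leq_add; last exact: le_nlogn.
  apply: leq_trans (linear_le_nlogn _ _); apply: linear_constP.
  by rewrite /output_measure /s3 /= /upd /=; lia.
apply: runs_seq.
  by apply: (@runs_run _ _ _ (fun s' => s' = s3)).
move=> _ _ ->; apply: runs_seq.
  apply: runs_loop inv3 => // s4 inv4; rewrite [beval _ _]/= (oi_n inv4) addn1.
  exact: output_step.
move=> s4 _ [inv4]; rewrite [beval _ _]/= (oi_n inv4) addn1 -leqNgt => ge_n.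
apply: runs_run => //; set Q := nvar s4 vQ.
have cutQ : cut Q = n.
  by apply/eqP; rewrite eqn_leq iter_reach_le -(oi_I inv4).
(* Jumps were made only from positions below [n], and [k] jumps already reach [n]. *)
have le_Qk : (Q <= k)%N.
  rewrite leqNgt; apply/negP => /(oi_lt inv4).
  by rewrite (eqP (enou : cut k == n)) ltnn.
have /choice[f fP] : forall q : 'I_Q, exists a : net_point R n,
  [/\ in_subpath P (cut q) (cut q.+1).-1 a,
      (evac_time P a (cut q) (cut q.+1).-1 <= lam%:E)%E,
      narr s4 1 q = lvertex a & rarr s4 0 q = if a is Inner _ u then u else 0].
  by move=> q; apply: (oi_sink inv4).
exists (@KSink R n Q (fun p => cut p) f); split.
  split=> //= [q le_q|q]; first exact: (oi_cut inv4).
  by have [_ _ ? ?] := fP q.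
apply: (greedy_optimal c_gt0 cap_c (lam := lam)).
- split=> //= [q lt_q|q]; last by have [] := fP q.
  by apply/rch_gt/(oi_lt inv4).
- by move=> q; have [] := fP q.
move=> x /inf; rewrite /enough => ne; rewrite ltn_neqAle.
by apply/andP; split; [exact: ne|exact: iter_reach_le].
Qed.

End Output.

(** * The asymptotic bound and the whole program *)

Local Open Scope classical_set_scope.
Local Open Scope ring_scope.

Lemma nlogn_bigO (R : realType) (C : nat) :
  (fun n : nat => (C * nlogn n)%:R : R^o) =O_\oo
    (fun n : nat => n%:R * ln n%:R : R^o).
Proof.
have ln2_gt0 : 0 < ln 2 :> R by rewrite ln_gt0 // ltr1n.
(* The 6 is the product of [n.+1 <= 2 * n] and [(up_log 2 n).+1 * ln 2 <= 3 * ln n]; the summand 1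
   keeps the constant positive when [C = 0]. *)
apply/eqO_exP; exists (C%:R * (6 / ln 2) + 1).
  by apply: ltr_wpDl => //; rewrite mulr_ge0 // divr_ge0 // ltW.
near=> n; have n_gt1 : (1 < n)%N by near: n; apply: nbhs_infty_ge.
have ln_n : ln 2 <= ln n%:R :> R by rewrite ler_ln ?posrE ?ler_nat // ltr0n; lia.
have ln_n_gt0 : 0 < ln n%:R :> R by apply: lt_le_trans ln_n.
have levels_ln : (up_log 2 n)%:R * ln 2 <= ln 2 + ln n%:R :> R.
  rewrite mulr_natl -lnXn ?ltr0n // -lnM ?posrE ?ltr0n //; last by lia.
  rewrite ler_ln ?posrE ?exprn_gt0 ?mulr_gt0 ?ltr0n //; last by lia.
  by rewrite -natrX -natrM ler_nat mul2n; apply: levels_le; lia.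
have fact : (nlogn n)%:R * ln 2 <= 6 * (n%:R * ln n%:R) :> R.
  rewrite /nlogn natrM -mulrA.
  have le_n1 : n.+1%:R <= 2 * n%:R :> R by rewrite -natrM ler_nat; lia.
  have le_l1 : (up_log 2 n).+1%:R * ln 2 <= 3 * ln n%:R :> R.
    by rewrite -natr1 mulrDl mul1r; lra.
  have l1_ge0 : 0 <= (up_log 2 n).+1%:R * ln 2 :> R by rewrite mulr_ge0 ?ltW.
  apply: le_trans (ler_pM _ l1_ge0 le_n1 le_l1) _ => //.
  by rewrite le_eqVlt; apply/orP; left; apply/eqP; ring.
rewrite ger0_norm // ger0_norm; last by rewrite mulr_ge0 // ltW.
rewrite natrM mulrDl mul1r; apply: ler_wpDr; first by rewrite mulr_ge0 // ltW.
rewrite -mulrA ler_wpM2l // mulrAC ler_pdivlMr //.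
Unshelve. all: by end_near. Qed.

Definition sparse_const :=
  (maxcost sparse_init + (bcost sparse_guard + maxcost sparse_body).+1)%N.
Definition prefix_const := linear_const prefix_init prefix_guard prefix_body.
Definition powers_const := linear_const powers_init powers_guard powers_body.
Definition ksink_const :=
  (maxcost get_capacity + (prefix_const + (powers_const + (sparse_const +
    (setup_const + (15 * step_const + 54 * sort_const + output_const))))))%N.

Definition ksink_program :=
  get_capacity ;; (prefix_sums ;; (powers ;; (sparse ;; (setup ;; (search ;; output))))).

Lemma runs_ksink (R : realType) (n k : nat) (P : path_network R n) :
  (0 < n)%N -> (0 < k)%N -> uniform_capacity P ->
  runs ksink_program (input_state P k) (ksink_const * nlogn n)
    (fun s => exists S : ksink R n, outputs s S /\ optimal_ksink P k S).
Proof.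
move=> n_gt0 k_gt0 unif; set s0 := input_state P k.
have [c [c_gt0 cap_c eC]] : exists c, [/\ 0 < c, forall e, cap P e = c &
    rvar (run get_capacity s0) rC = c].
  rewrite /get_capacity run_if [beval _ _]/=; case: (leqP n 1) => [le1|gt1].
    exists 1; split=> // e; by have := ltn_ord e; lia.
  case: unif => c c_gt0 cap_c; exists c; split=> //=.
  have lt0 : (0 < n.-1)%N by lia.
  by rewrite /upd /= (ord_arrayE (cap P) (Ordinal lt0)).
pose X := xpos P; pose Y := ysup P c.
have X_le : forall i, X i <= X i.+1 := xpos_le P.
have Y_le : forall i, Y i <= Y i.+1 := ysup_le P c_gt0.
rewrite /ksink_const 6!mulnDl.
apply: runs_seq.
  apply: (@runs_sub _ _ _ (maxcost get_capacity) _ _ _ _ (fun _ _ q => q)); first exact: le_nlogn.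
  by apply: (@runs_run _ _ _ (fun s' => s' = run get_capacity s0)).
move=> s1 u1 e1; rewrite -e1 in eC.
have [en1 ek1 et1] : [/\ nvar s1 vN = n, nvar s1 vK = k & rvar s1 rTau = tau P].
  by rewrite !(same_nvar u1) ?(same_rvar u1) //; vm_compute.
have [ew1 el1] : rarr s1 0 = ord_array 0 (fun i => (weight P i)%:R) /\
    rarr s1 1 = ord_array 0 (len P).
  by rewrite !(same_rarr u1).
have run1 := @runs_prefix R n X Y (tau P) c _ _ (xpos0 P) (ysup0 P c) (xposS P)
  (ysupS P c) s1 en1 et1 eC ew1 el1.
apply: runs_seq.
  by apply: runs_sub (linear_le_nlogn _ _) _ run1 => s2 u2 H; exact: (conj u2 H).
move=> s2 _ [u2 [tX tY tU tD]].
have [en2 ek2 et2] : [/\ nvar s2 vN = n, nvar s2 vK = k & rvar s2 rTau = tau P].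
  by rewrite !(same_nvar u2) ?(same_rvar u2) //; vm_compute.
apply: runs_seq.
  apply: runs_sub (linear_le_nlogn _ _) _ (runs_powers en2).
  by move=> s3 u3 H; exact: (conj u3 H).
move=> s3 _ [u3 pow3].
have [en3 ek3 et3] : [/\ nvar s3 vN = n, nvar s3 vK = k & rvar s3 rTau = tau P].
  by rewrite !(same_nvar u3) ?(same_rvar u3) //; vm_compute.
have same3 : rarr s3 = rarr s2 by apply/funext => a; rewrite (same_rarr u3).
have run3 := @runs_sparse R n (lkey X Y) (rkey X Y) n_gt0 s3 en3.
rewrite same3 in run3.
apply: runs_seq.
  apply: runs_sub _ _ (run3 (fun i lt_in => conj (tU i lt_in) (tD i lt_in))).
    rewrite /sparse_const mulnDl; apply: leq_add; first exact: le_nlogn.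
    by rewrite leq_mul2l /nlogn; apply/orP; right; nia.
  by move=> s4 u4 H; exact: (conj u4 H).
move=> s4 _ [u4 rows4].
have [en4 ek4 et4] : [/\ nvar s4 vN = n, nvar s4 vK = k & rvar s4 rTau = tau P].
  by rewrite !(same_nvar u4) ?(same_rvar u4) //; vm_compute.
have tb4 : tables n X Y (narr s4) (rarr s4).
  split.
  - by move=> i le_i; rewrite (same_rarr u4) ?same3 ?tX //; vm_compute.
  - by move=> i le_i; rewrite (same_rarr u4) ?same3 ?tY //; vm_compute.
  - by move=> m /pow3; rewrite !(same_narr u4) //; vm_compute.
  - by move=> l i /rows4[].
  - by move=> l i /rows4[].
apply: runs_seq; first exact: (runs_setup n_gt0 k_gt0 X_le Y_le (xpos0 P) (ysup0 P c) tb4 en4 ek4).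
move=> s5 u5 [x [y [r [si5 le_r le9]]]].
have et5 : rvar s5 rTau = tau P by rewrite (same_rvar u5) //; vm_compute.
apply: runs_seq.
  exact: (runs_search n_gt0 X_le Y_le si5 le_r le9).
move=> s6 u6 [lam [tb6 en6 ehi6 lam_ge0 [enou inf]]].
have et6 : rvar s6 rTau = tau P by rewrite (same_rvar u6) //; vm_compute.
exact: (runs_output n_gt0 c_gt0 cap_c lam_ge0 tb6 en6 et6 ehi6 enou inf).
Qed.

Theorem theorem4 (R : realType) :
  exists (prog : cmd) (T : nat -> nat),
    ((fun n : nat => (T n)%:R : R^o) =O_\oo
       (fun n : nat => n%:R * ln n%:R : R^o)) /\
    forall (n k : nat) (P : path_network R n),
      (0 < n)%N -> (0 < k)%N -> uniform_capacity P ->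
      exists (t : nat) (s : state R) (S : ksink R n),
        [/\ exec prog (input_state P k) t s, (t <= T n)%N,
            outputs s S & optimal_ksink P k S].
Proof.
exists ksink_program, (fun n => ksink_const * nlogn n)%N.
split; first exact: nlogn_bigO.
move=> n k P n_gt0 k_gt0 unif.
have [t [s [ex le_t [S [out opt]]]]] := runs_ksink n_gt0 k_gt0 unif.
by exists t, s, S.
Qed.
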